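(* Let $\mathcal{A}$ and $\mathcal{B}$ be operator $*$-algebras and let $\mathcal{X}$ be an operator $*$-correspondence from $\mathcal{A}$ to $\mathcal{B}$. Then there exists a standard form representation $(H_\pi,U,\pi_{\mathcal{A}},\pi_{\mathcal{B}},\pi_{\mathcal{X}})$ for $\mathcal{X}$.
   Context: An operator space is a complex vector space $\mathcal{X}$ with norms on $M_n(\mathcal{X})$, $n\in\mathbb{N}$, such that: $\mathcal{X}=M_1(\mathcal{X})$ is complete; $\|\lambda\xi\mu\|\le\|\lambda\|\,\|\xi\|\,\|\mu\|$ for $\lambda,\mu\in M_n(\mathbb{C})$, $\xi\in M_n(\mathcal{X})$; $\|\xi\oplus\eta\|=\max\{\|\xi\|,\|\eta\|\}$. A linear map is completely bounded if the maps it induces entrywise on all $M_n$ are bounded by one common constant; a cb-isomorphism is an invertible completely bounded map with completely bounded inverse. An operator algebra is an operator space $\mathcal{A}$ that is an algebra over $\mathbb{C}$ with $\|xy\|\le\|x\|\,\|y\|$ for all $n$ and $x,y\in M_n(\mathcal{A})$ (no unit, approximate identity or completely isometric Hilbert space representation is assumed). An operator $*$-algebra is an operator algebra that is a $*$-algebra with an involution $\dagger$ satisfying $\|x^\dagger\|=\|x\|$ for all $n$ and $x\in M_n(\mathcal{A})$, where $(x^\dagger)_{ij}=(x_{ji})^\dagger$. A right operator $\mathcal{B}$-module is an operator space $\mathcal{X}$ that is a right $\mathcal{B}$-module with $\|\xi\cdot b\|\le\|\xi\|\,\|b\|$ for all $n$, $\xi\in M_n(\mathcal{X})$, $b\in M_n(\mathcal{B})$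 (matrix product); left operator modules are defined similarly. For an operator $*$-algebra $\mathcal{B}$, an operator $*$-module over $\mathcal{B}$ is a right operator $\mathcal{B}$-module $\mathcal{X}$ with a pairing $\langle\cdot,\cdot\rangle_{\mathcal{X}}:\mathcal{X}\times\mathcal{X}\to\mathcal{B}$ that is linear in the second variable and satisfies $\langle\xi,\eta b\rangle=\langle\xi,\eta\rangle b$, $\langle\xi,\eta\rangle=\langle\eta,\xi\rangle^\dagger$, and $\|\langle\xi,\eta\rangle\|_{\mathcal{B}}\le\|\xi\|\,\|\eta\|$ for all $n$ and $\xi,\eta\in M_n(\mathcal{X})$, where $\langle\xi,\eta\rangle_{ij}=\sum_{k}\langle\xi_{ki},\eta_{kj}\rangle$. An operator $*$-correspondence from $\mathcal{A}$ to $\mathcal{B}$ is an operator $*$-module $\mathcal{X}$ over $\mathcal{B}$ with a left operator $\mathcal{A}$-module structure such that $a(\xi b)=(a\xi)b$ and $\langle a\xi,\eta\rangle=\langle\xi,a^\dagger\eta\rangle$ for all $a \in \mathcal{A}$, $b \in \mathcal{B}$, $\xi,\eta \in \mathcal{X}$. A standard form representation of $\mathcal{X}$ is a quintuple $(H_\pi,U,\pi_{\mathcal{A}},\pi_{\mathcal{B}},\pi_{\mathcal{X}})$ where $H_\pi$ is a Hilbert space, $U\in B(H_\pi)$ is a selfadjoint unitary, $\pi_{\mathcal{A}}:\mathcal{A}\to B(H_\pi)$ and $\pi_{\mathcal{B}}:\mathcal{B}\to B(H_\pi)$ are completely bounded algebra homomorphisms and $\pi_{\mathcal{X}}:\mathcal{X}\to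 B(H_\pi)$ is a completely bounded linear map such that: (1) $\pi_{\mathcal{A}},\pi_{\mathcal{B}},\pi_{\mathcal{X}}$ are cb-isomorphisms onto their images (in particular these images are closed in operator norm); (2) $\pi_{\mathcal{X}}(x\cdot b)=\pi_{\mathcal{X}}(x)\pi_{\mathcal{B}}(b)$ and $\pi_{\mathcal{X}}(a\cdot x)=\pi_{\mathcal{A}}(a)\pi_{\mathcal{X}}(x)$ for all $a\in\mathcal{A},x\in\mathcal{X},b\in\mathcal{B}$; (3) $U\pi_{\mathcal{A}}(a)^*U=\pi_{\mathcal{A}}(a^\dagger)$, $U\pi_{\mathcal{B}}(b)^*U=\pi_{\mathcal{B}}(b^\dagger)$ and $U\pi_{\mathcal{X}}(x)^*U\pi_{\mathcal{X}}(y)=\pi_{\mathcal{B}}(\langle x,y\rangle_{\mathcal{X}})$ for all $a\in\mathcal{A}$, $b\in\mathcal{B}$, $x,y\in\mathcal{X}$, where $*$ is the Hilbert space adjoint. *)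

(* Defs.v *)
(* The complex numbers are R[i] for an arbitrary R : realType. *)
From HB Require Import structures.
From mathcomp Require Import all_boot all_order all_algebra.
From mathcomp Require Import all_classical all_reals all_analysis.
From mathcomp Require Export complex.
From mathcomp Require Import sesquilinear.

Set Implicit Arguments.
Unset Strict Implicit.
Unset Printing Implicit Defensive.

Import Order.TTheory GRing.Theory Num.Theory.
Import numFieldNormedType.Exports.

Local Open Scope classical_set_scope.
Local Open Scope ring_scope.
Local Open Scope complex_scope.

(* The matrix product attached to a product f : U -> V -> W on entries. It is
   used for complex matrices acting on matrices of vectors, for products in
   non-unital algebras, for module actions, for pairings and for matrices of
   operators acting on column vectors. *)
Definition mxprod (U V : Type) (W : nmodType) (f : U -> V -> W) (m n p : nat)
    (a : 'M[U]_(m, n)) (b : 'M[V]_(n, p)) : 'M[W]_(m, p) :=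
  \matrix_(i, j) \sum_k f (a i k) (b k j).

(* Norms on normed modules over R[i] take their values in R[i]. *)
Definition rnorm (R : realType) (V : normedZmodType R[i]) (v : V) : R :=
  complex.Re `|v|.

Definition l2norm (R : realType) (V : normedZmodType R[i]) (n : nat)
    (v : 'cV[V]_n) : R :=
  Num.sqrt (\sum_i rnorm (v i 0) ^+ 2).

(* The operator norm of M_n(C) = B(C^n). *)
Definition cmxnorm (R : realType) (n : nat) (l : 'M[R[i]]_n) : R :=
  sup [set l2norm (l *m v) | v in [set v : 'cV[R[i]]_n | l2norm v <= 1]].

Definition mxnorms (R : realType) (X : Type) := forall n : nat, 'M[X]_n -> R.

(* M_0(X) is the zero space, so that the case n = 0 carries no information. *)
Record operatorSpace (R : realType) := OperatorSpace {
  os_carrier :> completeNormedModType R[i];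
  mxnorm : mxnorms R os_carrier;
  mxnorm_triangle : forall n (x y : 'M[os_carrier]_n),
    mxnorm (x + y) <= mxnorm x + mxnorm y;
  mxnorm_scale : forall n (c : R[i]) (x : 'M[os_carrier]_n),
    mxnorm (map_mx ( *:%R c) x) = rnorm c * mxnorm x;
  mxnorm_eq0 : forall n (x : 'M[os_carrier]_n), mxnorm x = 0 -> x = 0;
  mxnorm_norm : forall x : os_carrier,
    mxnorm (const_mx x : 'M[os_carrier]_1) = rnorm x;
  mxnorm_bimodule : forall n (l m : 'M[R[i]]_n) (x : 'M[os_carrier]_n),
    mxnorm (mxprod (fun y c => c *: y) (mxprod *:%R l x) m)
      <= cmxnorm l * mxnorm x * cmxnorm m;
  mxnorm_dsum : forall m n (x : 'M[os_carrier]_m) (y : 'M[os_carrier]_n),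
    mxnorm (block_mx x 0 0 y) = Num.max (mxnorm x) (mxnorm y)
}.

Arguments mxnorm {R o n} x : rename.

Record operatorAlgebra (R : realType) := OperatorAlgebra {
  oa_space :> operatorSpace R;
  amul : oa_space -> oa_space -> oa_space;
  amul_linearl : forall y, linear (amul^~ y);
  amul_linearr : forall x, linear (amul x);
  amulA : associative amul;
  mxnorm_amul : forall n (x y : 'M[oa_space]_n),
    mxnorm (mxprod amul x y) <= mxnorm x * mxnorm y
}.

Record operatorStarAlgebra (R : realType) := OperatorStarAlgebra {
  osa_algebra :> operatorAlgebra R;
  dagger : osa_algebra -> osa_algebra;
  daggerD : {morph dagger : x y / x + y};
  daggerZ : forall (c : R[i]) x, dagger (c *: x) = Num.conj c *: dagger x;
  daggerK : involutive dagger;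
  daggerM : forall x y, dagger (amul x y) = amul (dagger y) (dagger x);
  mxnorm_dagger : forall n (x : 'M[osa_algebra]_n),
    mxnorm (map_mx dagger x^T) = mxnorm x
}.

Record rightOperatorModule (R : realType) (B : operatorAlgebra R) :=
    RightOperatorModule {
  rom_space :> operatorSpace R;
  ract : rom_space -> B -> rom_space;
  ract_linearl : forall b, linear (ract^~ b);
  ract_linearr : forall x, linear (ract x);
  ractM : forall x b c, ract (ract x b) c = ract x (amul b c);
  mxnorm_ract : forall n (x : 'M[rom_space]_n) (b : 'M[B]_n),
    mxnorm (mxprod ract x b) <= mxnorm x * mxnorm b
}.

(* The operator space X is a parameter, since a correspondence carries a left
   and a right module structure on one operator space. *)
Record leftOperatorModuleOn (R : realType) (A : operatorAlgebra R)
    (X : operatorSpace R) := LeftOperatorModuleOn {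
  lom_act :> A -> X -> X;
  lom_act_linearl : forall x, linear (lom_act^~ x);
  lom_act_linearr : forall a, linear (lom_act a);
  lom_actM : forall a b x, lom_act a (lom_act b x) = lom_act (amul a b) x;
  mxnorm_lom_act : forall n (a : 'M[A]_n) (x : 'M[X]_n),
    mxnorm (mxprod lom_act a x) <= mxnorm a * mxnorm x
}.

Record operatorStarModule (R : realType) (B : operatorStarAlgebra R) :=
    OperatorStarModule {
  osm_module :> rightOperatorModule B;
  pairing : osm_module -> osm_module -> B;
  pairing_linearr : forall x, linear (pairing x);
  pairing_ract : forall x y b, pairing x (ract y b) = amul (pairing x y) b;
  pairing_dagger : forall x y, pairing x y = dagger (pairing y x);
  mxnorm_pairing : forall n (x y : 'M[osm_module]_n),
    mxnorm (mxprod pairing x^T y) <= mxnorm x * mxnorm y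
}.

Record operatorStarCorrespondence (R : realType)
    (A B : operatorStarAlgebra R) := OperatorStarCorrespondence {
  osc_module :> operatorStarModule B;
  lact : leftOperatorModuleOn A osc_module;
  lact_ract : forall a x b, lact a (ract x b) = ract (lact a x) b;
  pairing_lact : forall a (x y : osc_module),
    pairing (lact a x) y = pairing x (lact (dagger a) y)
}.

(* The inner product is linear in its first variable. *)
Record hilbertSpace (R : realType) := HilbertSpace {
  hs_carrier :> completeNormedModType R[i];
  hdot : {dot hs_carrier for Num.conj};
  hdot_norm : forall x, `|x| ^+ 2 = hdot x x
}.

Section BoundedOperators.
Variables (R : realType) (H : normedModType R[i]).

Definition bounded_op_pred : {pred H -> H} :=
  [pred f | `[< linear f /\ continuous f >]].

Lemma bounded_op_submod_closed : submod_closed bounded_op_pred.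
Proof.
split.
  apply/asboolP; split=> [a x y|]; first by rewrite scaler0 addr0.
  exact: cst_continuous.
move=> a f g /asboolP[fl fc] /asboolP[gl gc]; apply/asboolP; split.
  have sE z : (a *: f) z = a *: f z by [].
  move=> c x y; rewrite fctE /= !sE.
  by rewrite fl gl !scalerDr !scalerA [(a * c)%R]mulrC addrACA.
move=> x; apply: continuousD (gc x).
by apply: continuousZr; exact: fc.
Qed.

HB.instance Definition _ :=
  GRing.isSubmodClosed.Build _ _ bounded_op_pred bounded_op_submod_closed.

(* B(H): a linear map between normed spaces is bounded iff it is continuous. *)
Record bounded_op := BoundedOp {
  bounded_op_fun :> H -> H;
  bounded_opP : bounded_op_fun \in bounded_op_pred }.

HB.instance Definition _ := [isSub for bounded_op_fun].
HB.instance Definition _ := [Choice of bounded_op by <:].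
HB.instance Definition _ := [SubChoice_isSubLmodule of bounded_op by <:].

Lemma bounded_op_linear (T : bounded_op) : linear T.
Proof. by case: T => f /= /asboolP[]. Qed.

Lemma bounded_op_continuous (T : bounded_op) : continuous T.
Proof. by case: T => f /= /asboolP[]. Qed.

Fact bounded_op_one_subproof : idfun \in bounded_op_pred.
Proof. by apply/asboolP; split=> // x; exact: cvg_id. Qed.

Fact bounded_op_mul_subproof (S T : bounded_op) : S \o T \in bounded_op_pred.
Proof.
apply/asboolP; split=> [a x y|x] /=; first by rewrite !bounded_op_linear.
apply: continuous_comp; exact: bounded_op_continuous.
Qed.

Definition bounded_op_one := BoundedOp bounded_op_one_subproof.
Definition bounded_op_mul (S T : bounded_op) :=
  BoundedOp (bounded_op_mul_subproof S T).

Fact bounded_op_mulA : associative bounded_op_mul.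
Proof. by move=> S T V; exact/val_inj. Qed.

Fact bounded_op_mul1l : left_id bounded_op_one bounded_op_mul.
Proof. by move=> S; exact/val_inj. Qed.

Fact bounded_op_mul1r : right_id bounded_op_one bounded_op_mul.
Proof. by move=> S; exact/val_inj. Qed.

Fact bounded_op_mulDl : left_distributive bounded_op_mul +%R.
Proof. by move=> S T V; exact/val_inj. Qed.

Fact bounded_op_mulDr : right_distributive bounded_op_mul +%R.
Proof.
move=> S T V; apply/val_inj/funext => x /=.
by have := bounded_op_linear S 1 (T x) (V x); rewrite !scale1r.
Qed.

(* H = 0 is allowed, so that 1 = 0 may hold in B(H). *)
HB.instance Definition _ := GRing.Zmodule_isPzRing.Build bounded_op
  bounded_op_mulA bounded_op_mul1l bounded_op_mul1r
  bounded_op_mulDl bounded_op_mulDr.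

(* The operator norm of M_n(B(H)) = B(H^n). *)
Definition opnorm : mxnorms R bounded_op := fun n T =>
  sup [set l2norm (mxprod (fun (S : bounded_op) x => S x) T v)
      | v in [set v : 'cV[H]_n | l2norm v <= 1]].

End BoundedOperators.

Section Adjoint.
Variables (R : realType) (H : hilbertSpace R).

Definition is_adjoint (T S : bounded_op H) : Prop :=
  forall x y : H, hdot H (T x) y = hdot H x (S y).

(* By the Riesz representation theorem there is exactly one S such that
   is_adjoint T S; the default value 0 is never used. *)
Definition adjoint (T : bounded_op H) : bounded_op H :=
  xget 0 [set S | is_adjoint T S].

Definition selfadjoint (T : bounded_op H) : Prop := adjoint T = T.

Definition unitary (T : bounded_op H) : Prop :=
  adjoint T * T = 1 /\ T * adjoint T = 1.

End Adjoint.

Section CompletelyBounded.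
Variables (R : realType) (V W : lmodType R[i]).
Variables (nV : mxnorms R V) (nW : mxnorms R W).

Definition cb_on (D : set V) (f : V -> W) : Prop :=
  exists M : R, forall n (x : 'M[V]_n), (forall i j, D (x i j)) ->
    nW (map_mx f x) <= M * nV x.

Definition completely_bounded (f : V -> W) : Prop :=
  linear f /\ cb_on setT f.

Definition norm_closed (D : set W) : Prop :=
  forall w : W,
    (forall e : R, 0 < e ->
      exists2 v, D v & nW (const_mx (w - v) : 'M[W]_1) < e) -> D w.

End CompletelyBounded.

(* The inverse g on range f of an injective linear f is linear. *)
Definition cb_iso_onto_image (R : realType) (V W : lmodType R[i])
    (nV : mxnorms R V) (nW : mxnorms R W) (f : V -> W) : Prop :=
  [/\ completely_bounded nV nW f,
      exists2 g : W -> V, cancel f g & cb_on nW nV (range f) g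
    & norm_closed nW (range f)].

Definition algebra_hom (R : realType) (A : operatorAlgebra R)
    (H : hilbertSpace R) (f : A -> bounded_op H) : Prop :=
  linear f /\ {morph f : a b / amul a b >-> a * b}.

Record standard_form (R : realType) (A B : operatorStarAlgebra R)
    (X : operatorStarCorrespondence A B) (H : hilbertSpace R)
    (U : bounded_op H) (piA : A -> bounded_op H) (piB : B -> bounded_op H)
    (piX : X -> bounded_op H) : Prop := StandardForm {
  sf_selfadjoint : selfadjoint U;
  sf_unitary : unitary U;
  sf_homA : algebra_hom piA;
  sf_homB : algebra_hom piB;
  sf_cb_isoA : cb_iso_onto_image (@mxnorm R A) (@opnorm R H) piA;
  sf_cb_isoB : cb_iso_onto_image (@mxnorm R B) (@opnorm R H) piB;
  sf_cb_isoX : cb_iso_onto_image (@mxnorm R X) (@opnorm R H) piX;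
  sf_ract : forall (x : X) (b : B), piX (ract x b) = piX x * piB b;
  sf_lact : forall (a : A) (x : X), piX (lact X a x) = piA a * piX x;
  sf_daggerA : forall a : A, U * adjoint (piA a) * U = piA (dagger a);
  sf_daggerB : forall b : B, U * adjoint (piB b) * U = piB (dagger b);
  sf_pairing : forall x y : X,
    U * adjoint (piX x) * U * piX y = piB (pairing x y)
}.

(* Main.v *)
(* Let Z = C + A + B + X, on which A, B and X act by left multiplication, X
   also acts through y |-> <y, .>, and the scalar summand serves as a unit. For
   a prescribed triple of N x N matrices over A, B and X we look for a
   semi-inner product on Z^N for which all these actions are bounded, uniformly
   on matrices, and for which the triple, applied to the unit vectors, is not
   shorter than its matrix norms. Semi-inner products are positive functionals
   on the squares |f v|^2, f a linear functional, so Hahn-Banach reduces the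
   task to one inequality. A domination of such squares is implemented by a
   contraction L of C^n, and then the vectors involved solve U = L (E + a U)
   with a of small norm; the operator algebra inequalities bound U by E.

   The direct sum over all triples gives a Hilbert space D carrying the actions
   and recovering the matrix norms up to a constant, but adjoints in D are
   unrelated to the involution. Hence D is doubled: g acts as g on the first
   copy and as the adjoint of its dagger on the second one, where the dagger of
   x in X is <x, .>, and U exchanges the copies. *)

Require Import Defs.
From HB Require Import structures.
From mathcomp Require Import all_boot all_order all_algebra.
From mathcomp Require Import all_classical all_reals all_analysis.
From mathcomp Require Import finmap.
From mathcomp Require Import sesquilinear.
From mathcomp Require Import ring lra.

Set Implicit Arguments.
Unset Strict Implicit.
Unset Printing Implicit Defensive.

Import Order.TTheory GRing.Theory Num.Theory.
Import numFieldNormedType.Exports.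

Local Open Scope classical_set_scope.
Local Open Scope ring_scope.
Local Open Scope complex_scope.

(** With neither a unit nor an approximate identity, a multiplication may vanish identically, and
    then left multiplications cannot see the norms. A generator applied to the scalar 1 returns its
    components, which is why the lower bounds are tested on unit vectors. The summand [A] stands
    beside [B] and [X] because the action of [A] on [X] may forget part of [A].

    Every triple of matrices has its own semi-inner product, so the direct sum carries the actions
    only if their bounds do not depend on the triple. One threshold serves all of them: matrices of
    generators with component norms at most 1/8 become contractions. With 1/8 the coupled
    inequalities for the components of the solution close up. The representation then has lower
    constant 1 and upper constant 16, namely 8 for each copy.

    Transposition needs care. The pairing is antilinear on the left, so matrices acting through it
    are measured after transposition, and passing to adjoints transposes once more. The isometry of
    the dagger and the pairing inequality are stated for exactly these transposed matrices.

    The functionals in the dominations are merely linear, and all that is asked of them is to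
    separate points. *)

Local Notation Re := (@complex.Re _).
Local Notation Im := (@complex.Im _).

(** * Complex numbers and real-valued norms *)

Section ComplexNumbers.
Variable R : realType.
Implicit Types (x y z : R[i]) (c : R).

Lemma ReD x y : Re (x + y) = Re x + Re y.
Proof. by case: x; case: y. Qed.

Lemma ImD x y : Im (x + y) = Im x + Im y.
Proof. by case: x; case: y. Qed.

Lemma ReN x : Re (- x) = - Re x.
Proof. by case: x. Qed.

Lemma ImN x : Im (- x) = - Im x.
Proof. by case: x. Qed.

Lemma Re_mul x y : Re (x * y) = Re x * Re y - Im x * Im y.
Proof. by case: x; case: y. Qed.

Lemma Im_mul x y : Im (x * y) = Re x * Im y + Im x * Re y.
Proof. by case: x; case: y. Qed.

Lemma ReJ x : Re (Num.conj x) = Re x.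
Proof. by case: x. Qed.

Lemma ImJ x : Im (Num.conj x) = - Im x.
Proof. by case: x. Qed.

Lemma Re_sum (I : Type) (r : seq I) (P : pred I) (F : I -> R[i]) :
  Re (\sum_(i <- r | P i) F i) = \sum_(i <- r | P i) Re (F i).
Proof. exact: (big_morph _ ReD). Qed.

Lemma complexP x y : Re x = Re y -> Im x = Im y -> x = y.
Proof. by case: x => a b; case: y => c d /= -> ->. Qed.

Lemma sqr_rnorm z : rnorm z ^+ 2 = Re z ^+ 2 + Im z ^+ 2.
Proof. by rewrite /rnorm normc_def /= sqr_sqrtr // addr_ge0 ?sqr_ge0. Qed.

Lemma rnormM x y : rnorm (x * y) = rnorm x * rnorm y.
Proof. by rewrite /rnorm normrM !normc_def /= mul0r subr0. Qed.

Lemma rnorm_conj x : rnorm (Num.conj x) = rnorm x.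
Proof. by rewrite /rnorm norm_conjC. Qed.

Lemma rnorm_real c : rnorm c%:C = `|c|.
Proof. by rewrite /rnorm normc_def /= expr0n /= addr0 sqrtr_sqr. Qed.

Lemma Re_le_rnorm z : `|Re z| <= rnorm z.
Proof. by rewrite /rnorm normc_def /= -sqrtr_sqr ler_wsqrtr // lerDl sqr_ge0. Qed.

Lemma Im_le_rnorm z : `|Im z| <= rnorm z.
Proof. by rewrite /rnorm normc_def /= -sqrtr_sqr ler_wsqrtr // lerDr sqr_ge0. Qed.

Lemma rnorm_le_ReIm z : rnorm z <= `|Re z| + `|Im z|.
Proof.
rewrite -ler_sqr ?nnegrE ?addr_ge0 //; last by rewrite /rnorm normc_def /= sqrtr_ge0.
rewrite sqr_rnorm -(real_normK (num_real (Re z))) -(real_normK (num_real (Im z))).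
have := normr_ge0 (Re z); have := normr_ge0 (Im z); nra.
Qed.

Lemma mul_conj z : z * Num.conj z = (rnorm z ^+ 2)%:C.
Proof. by apply: complexP; rewrite ?Re_mul ?Im_mul ReJ ImJ ?sqr_rnorm /=; ring. Qed.

End ComplexNumbers.

Section RealNorm.
Variables (R : realType) (V : normedZmodType R[i]).
Implicit Types u v : V.

Lemma rnormE v : `|v| = (rnorm v)%:C.
Proof. by rewrite /rnorm RRe_real // normr_real. Qed.

Lemma rnorm_ge0 v : 0 <= rnorm v.
Proof. by rewrite -ler0c -rnormE. Qed.

Lemma rnormD u v : rnorm (u + v) <= rnorm u + rnorm v.
Proof. by rewrite -lecR rmorphD /= -!rnormE ler_normD. Qed.

Lemma rnorm0 : rnorm (0 : V) = 0.
Proof. by rewrite /rnorm normr0. Qed.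

Lemma rnorm_eq0 v : rnorm v = 0 -> v = 0.
Proof. by move=> v0; apply/normr0_eq0; rewrite rnormE v0. Qed.

Lemma rnormN v : rnorm (- v) = rnorm v.
Proof. by rewrite /rnorm normrN. Qed.

Lemma rnormB u v : rnorm (u - v) = rnorm (v - u).
Proof. by rewrite /rnorm distrC. Qed.

End RealNorm.

Lemma rnormZ (R : realType) (V : normedModType R[i]) (c : R[i]) (v : V) :
  rnorm (c *: v) = rnorm c * rnorm v.
Proof.
by apply: complexI; rewrite -rnormE normrZ !rnormE rmorphM.
Qed.

Lemma conj_scale_mul (R : realType) (c : R) (z : R[i]) :
  Num.conj (c%:C * z) * z = (c * rnorm z ^+ 2)%:C.
Proof.
by apply: complexP; rewrite ?(Re_mul, Im_mul) !(ReJ, ImJ) ?(Re_mul, Im_mul) ?sqr_rnorm /=; ring.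
Qed.

(** The form may be degenerate. Null vectors are never divided out: functionals bounded by the
    seminorm vanish on them. *)
Record preHilbert (R : realType) := PreHilbert {
  ph_carrier :> lmodType R[i];
  ph_form : ph_carrier -> ph_carrier -> R[i];
  ph_form_linearl : forall c u v w,
    ph_form (c *: u + v) w = c * ph_form u w + ph_form v w;
  ph_form_conj : forall u v, ph_form u v = Num.conj (ph_form v u);
  ph_form_ge0 : forall u, 0 <= Re (ph_form u u)
}.

(** * The completion of a semi-inner product space *)

Section PreHilbert.
Variables (R : realType) (V : preHilbert R).
Implicit Types u v w : V.
Local Notation g := (@ph_form R V).

Definition phq (v : V) : R := Re (g v v).
Definition phs (v : V) : R := Num.sqrt (phq v).

Lemma ph_formDl u v w : g (u + v) w = g u w + g v w.
Proof. by have := ph_form_linearl 1 u v w; rewrite scale1r mul1r. Qed.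

Lemma ph_form0l w : g 0 w = 0.
Proof. by have /eqP := ph_formDl 0 0 w; rewrite addr0 -subr_eq0 opprD addNKr oppr_eq0 =>
  /eqP. Qed.

Lemma ph_formZl c u w : g (c *: u) w = c * g u w.
Proof. by have := ph_form_linearl c u 0 w; rewrite addr0 ph_form0l addr0. Qed.

Lemma ph_formDr u v w : g w (u + v) = g w u + g w v.
Proof. by rewrite ph_form_conj ph_formDl rmorphD /= -!ph_form_conj. Qed.

Lemma ph_formZr c u w : g w (c *: u) = Num.conj c * g w u.
Proof. by rewrite ph_form_conj ph_formZl rmorphM /= -ph_form_conj. Qed.

Lemma ph_form_diag v : g v v = (phq v)%:C.
Proof.
apply: complexP => //=; have /(congr1 Im) := ph_form_conj v v.
by rewrite ImJ => /eqP; rewrite -addr_eq0 -mulr2n mulrn_eq0 => /eqP.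
Qed.

Lemma phq_ge0 v : 0 <= phq v. Proof. exact: ph_form_ge0. Qed.
Lemma phs_ge0 v : 0 <= phs v. Proof. exact: sqrtr_ge0. Qed.
Lemma sqr_phs v : phs v ^+ 2 = phq v. Proof. by rewrite sqr_sqrtr ?phq_ge0. Qed.

Lemma phqZ c v : phq (c *: v) = rnorm c ^+ 2 * phq v.
Proof.
by rewrite /phq ph_formZl ph_formZr ph_form_diag mulrA mul_conj -rmorphM.
Qed.

Lemma phsZ c v : phs (c *: v) = rnorm c * phs v.
Proof. by rewrite /phs phqZ sqrtrM ?sqr_ge0 // sqrtr_sqr ger0_norm ?rnorm_ge0. Qed.

Lemma phqD u v : phq (u + v) = phq u + phq v + 2 * Re (g u v).
Proof.
rewrite /phq !(ph_formDl, ph_formDr) !ReD [g v u]ph_form_conj ReJ; ring.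
Qed.

Lemma ph_cauchy_schwarz u v : rnorm (g u v) <= phs u * phs v.
Proof.
rewrite -ler_sqr ?nnegrE ?mulr_ge0 ?phs_ge0 ?rnorm_ge0 // exprMn !sqr_phs.
set z := g u v.
have key (c : R) : 0 <= phq u + c ^+ 2 * rnorm z ^+ 2 * phq v - 2 * c * rnorm z ^+ 2.
  have := phq_ge0 (u + ((- c)%:C * z) *: v).
  rewrite phqD phqZ ph_formZr -/z conj_scale_mul rnormM exprMn rnorm_real.
  by rewrite real_normK ?num_real //= sqrrN; lra.
have := rnorm_ge0 z; have := phq_ge0 u; have := phq_ge0 v.
have [v0|v0] := eqVneq (phq v) 0 => p0 q0 z0.
  rewrite v0 mulr0; have [->|zn0] := eqVneq (rnorm z) 0; first by rewrite expr0n.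
  (* If [phq v = 0], then [key] is affine in [c] with slope proportional to [- rnorm z ^+ 2]; this
     [c] makes it negative unless [z] vanishes. *)
  have := key ((phq u + 1) / rnorm z ^+ 2).
  rewrite v0 mulr0 addr0 -[2 * _ * _]mulrA divfK ?expf_neq0 //; lra.
have := key (phq v)^-1.
have -> : (phq v)^-1 ^+ 2 * rnorm z ^+ 2 * phq v = rnorm z ^+ 2 / phq v.
  by rewrite expr2; field.
rewrite -mulrA [_^-1 * _]mulrC => h.
rewrite -ler_pdivrMr ?lt_def ?v0 //; lra.
Qed.

Lemma phsD u v : phs (u + v) <= phs u + phs v.
Proof.
rewrite -ler_sqr ?nnegrE ?addr_ge0 ?phs_ge0 // sqr_phs phqD.
have := le_trans (Re_le_rnorm (g u v)) (ph_cauchy_schwarz u v).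
rewrite ler_norml => /andP[_]; rewrite -!sqr_phs; nra.
Qed.

End PreHilbert.

Section CompletionSpace.
Variables (R : realType) (V : preHilbert R).
Local Notation C := (R[i]).
Local Notation g := (@ph_form R V).

(* Vectors of the completion are bounded antilinear functionals on V: a vector
   phi stands for v |-> <phi, v>. *)
Definition completion_pred : {pred (V -> C^o)} :=
  [pred f : V -> C^o | `[< (forall c u v, f (c *: u + v) = Num.conj c * f u + f v) /\
    exists2 M : R, 0 <= M & forall v, rnorm (f v : C) <= M * phs v >]].

Lemma completion_submod_closed : submod_closed completion_pred.
Proof.
split.
  apply/asboolP; split=> [c u v|]; first by rewrite /= mulr0 addr0.
  by exists 0 => // v; rewrite mul0r rnorm0.
move=> a f h /asboolP[fl [Mf Mf0 fM]] /asboolP[hl [Mh Mh0 hM]].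
apply/asboolP; split=> [c u v|].
  have E w : (a *: f + h) w = a * f w + h w by [].
  by rewrite !E fl hl; ring.
exists (rnorm (a : C) * Mf + Mh) => [|v].
  by rewrite addr_ge0 // mulr_ge0 // rnorm_ge0.
rewrite (le_trans (rnormD _ _)) // mulrDl lerD // -mulrA.
have -> : rnorm ((a *: f) v : C) = rnorm (a : C) * rnorm (f v : C) by rewrite -rnormM.
by rewrite ler_wpM2l ?rnorm_ge0.
Qed.

HB.instance Definition _ :=
  GRing.isSubmodClosed.Build _ _ completion_pred completion_submod_closed.

Record completion := Completion {
  completion_fun :> V -> C^o;
  completionP : completion_fun \in completion_pred }.

HB.instance Definition _ := [isSub for completion_fun].
HB.instance Definition _ := [Choice of completion by <:].
HB.instance Definition _ := [SubChoice_isSubLmodule of completion by <:].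

Implicit Types (phi psi : completion) (u v w : V) (e : R).

Lemma completion_antilinear phi c u v :
  phi (c *: u + v) = Num.conj c * phi u + phi v.
Proof. by case: phi => f /= /asboolP[]. Qed.

Lemma completion_fun_inj phi psi : (forall v, phi v = psi v) -> phi = psi.
Proof. by move=> h; apply/val_inj/funext => v; exact: h. Qed.

Lemma completionDE phi psi v : (phi + psi) v = phi v + psi v. Proof. by []. Qed.
Lemma completionZE c phi v : (c *: phi) v = c * phi v. Proof. by []. Qed.

(** The dual norm is taken as the least admissible constant; a supremum of quotients would divide by
    [phs v], which can be 0 for nonzero [v]. *)
Definition cnorm_set phi := [set M : R | 0 <= M /\ forall v, rnorm (phi v : C) <= M * phs v].
Definition cnorm phi : R := inf (cnorm_set phi).

Lemma cnorm_set_has_inf phi : has_inf (cnorm_set phi).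
Proof.
split; last by exists 0 => M [].
by have /asboolP[_ [M M0 fM]] := completionP phi; exists M.
Qed.

Lemma cnorm_ge0 phi : 0 <= cnorm phi.
Proof. by apply: lb_le_inf; [exact: (cnorm_set_has_inf phi).1|move=> M []]. Qed.

Lemma cnorm_bound phi v : rnorm (phi v : C) <= cnorm phi * phs v.
Proof.
have [s0|s0] := eqVneq (phs v) 0.
  by have [[M [_ h]] _] := cnorm_set_has_inf phi; have := h v; rewrite s0 !mulr0.
have sp : 0 < phs v by rewrite lt_def s0 phs_ge0.
rewrite -ler_pdivrMr //; apply: lb_le_inf; first exact: (cnorm_set_has_inf phi).1.
by move=> M [_ h]; rewrite ler_pdivrMr.
Qed.

Lemma cnorm_le phi M : 0 <= M -> (forall v, rnorm (phi v : C) <= M * phs v) -> cnorm phi <= M.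
Proof. by move=> M0 h; apply: ge_inf; [exact: (cnorm_set_has_inf phi).2|]. Qed.

Lemma cnormD phi psi : cnorm (phi + psi) <= cnorm phi + cnorm psi.
Proof.
apply: cnorm_le => [|v]; first by rewrite addr_ge0 ?cnorm_ge0.
by rewrite completionDE (le_trans (rnormD _ _)) // mulrDl lerD ?cnorm_bound.
Qed.

Lemma cnormZ_le c phi : cnorm (c *: phi) <= rnorm (c : C) * cnorm phi.
Proof.
apply: cnorm_le => [|v]; first by rewrite mulr_ge0 ?cnorm_ge0 ?rnorm_ge0.
by rewrite completionZE rnormM -mulrA ler_wpM2l ?rnorm_ge0 ?cnorm_bound.
Qed.

Lemma cnormZ c phi : cnorm (c *: phi) = rnorm (c : C) * cnorm phi.
Proof.
apply/eqP; rewrite eq_le cnormZ_le /=.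
have [->|c0] := eqVneq c 0; first by rewrite rnorm0 mul0r cnorm_ge0.
have cp : 0 < rnorm (c : C).
  by rewrite lt_def rnorm_ge0 andbT; apply: contra c0 => /eqP/rnorm_eq0/eqP.
rewrite -ler_pdivlMl //; have := cnormZ_le c^-1 (c *: phi).
rewrite scalerK //; suff -> : rnorm (c^-1 : C) = (rnorm (c : C))^-1 by [].
apply: (mulfI (lt0r_neq0 cp)); rewrite -rnormM divff // mulfV ?lt0r_neq0 //.
by rewrite (rnorm_real 1) normr1.
Qed.

Lemma cnorm_eq0 phi : cnorm phi = 0 -> phi = 0.
Proof.
move=> h; apply: completion_fun_inj => v; apply: rnorm_eq0; apply: le_anti.
by rewrite rnorm_ge0 (le_trans (cnorm_bound _ _)) // h mul0r.
Qed.

Lemma iota_subproof v : (fun w => g v w : C^o) \in completion_pred.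
Proof.
apply/asboolP; split=> [c u w|]; first by rewrite ph_formDr ph_formZr.
by exists (phs v) => [|w]; rewrite ?phs_ge0 ?ph_cauchy_schwarz.
Qed.
Definition ciota v := Completion (iota_subproof v).

Lemma ciota_linear c u v : ciota (c *: u + v) = c *: ciota u + ciota v.
Proof. by apply: completion_fun_inj => w; rewrite /= ph_form_linearl. Qed.

Lemma cnorm_ciota v : cnorm (ciota v) = phs v.
Proof.
apply/eqP; rewrite eq_le cnorm_le ?phs_ge0 //=; last by move=> w; exact: ph_cauchy_schwarz.
have := cnorm_bound (ciota v) v; rewrite /= ph_form_diag rnorm_real.
rewrite ger0_norm ?phq_ge0 // -sqr_phs expr2.
have [->|s0] := eqVneq (phs v) 0; first by rewrite cnorm_ge0.
by rewrite ler_pM2r // lt_def s0 phs_ge0.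
Qed.

(* Near-maximisers of the concave functional 2 Re (phi v) - q v approximate phi. *)
Lemma ciota_dense phi e : 0 < e -> exists v, cnorm (phi - ciota v) <= e.
Proof.
move=> e0; pose J v := 2 * Re (phi v : C) - phq v.
pose S := range J.
have Sub : has_sup S.
  split; first by exists (J 0), 0.
  exists (cnorm phi ^+ 2) => _ [v _ <-]; rewrite /J -sqr_phs.
  have := le_trans (Re_le_rnorm _) (cnorm_bound phi v); rewrite ler_norml => /andP[_].
  by have := sqr_ge0 (cnorm phi - phs v); lra.
have e2 : 0 < e ^+ 2 by rewrite exprn_gt0.
have [_ [v _ <-] Jv] := sup_adherent e2 Sub.
exists v; apply: cnorm_le => [|w]; first exact: ltW.
set d := (phi - ciota v) w : C.
have dE : d = phi w - g v w by [].
(* Moving from [v] in the direction [d *: w] raises [J] by exactly the left-hand side, and [v] is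
   within [e ^+ 2] of the supremum. *)
have key (t : R) : 2 * t * rnorm d ^+ 2 - t ^+ 2 * rnorm d ^+ 2 * phq w <= e ^+ 2.
  have : J (v + (t%:C * d) *: w) <= sup S.
    by apply: (sup_upper_bound Sub); exists (v + (t%:C * d) *: w).
  rewrite /J phqD phqZ ph_formZr [v + _]addrC completion_antilinear ReD.
  rewrite rnormM exprMn rnorm_real real_normK ?num_real // => h.
  have {}h : 2 * Re (Num.conj (t%:C * d) * d) - t ^+ 2 * rnorm d ^+ 2 * phq w <= e ^+ 2.
    rewrite {2}dE mulrBr ReD ReN; move: Jv h; rewrite /J; lra.
  by move: h; rewrite conj_scale_mul /=; lra.
rewrite -ler_sqr ?nnegrE ?mulr_ge0 ?phs_ge0 ?rnorm_ge0 ?(ltW e0) // exprMn sqr_phs.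
have [w0|w0] := eqVneq (phq w) 0.
  have sw : phs w = 0 by rewrite /phs w0 sqrtr0.
  have := cnorm_bound (phi - ciota v) w; rewrite -/d sw mulr0 w0 mulr0 => h.
  by have -> : rnorm d = 0; [apply: le_anti; rewrite h rnorm_ge0|rewrite expr0n].
have wp : 0 < phq w by rewrite lt_def w0 phq_ge0.
(* This [t] maximises the left-hand side of [key]. *)
have := key (phq w)^-1.
have -> : 2 * (phq w)^-1 * rnorm d ^+ 2 - (phq w)^-1 ^+ 2 * rnorm d ^+ 2 * phq w
  = rnorm d ^+ 2 / phq w by field.
by rewrite ler_pdivrMr.
Qed.

End CompletionSpace.

(** * The inner product of the completion as a limit of the form *)

Section SequenceLimits.
Variable R : realType.
Implicit Types (f h : nat -> R) (a b : R).

Lemma seq_cvgD f h a b : f n @[n --> \oo] --> a -> h n @[n --> \oo] --> b ->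
  f n + h n @[n --> \oo] --> a + b.
Proof. by move=> fa hb; exact: cvgD fa hb. Qed.

Lemma seq_cvgB f h a b : f n @[n --> \oo] --> a -> h n @[n --> \oo] --> b ->
  f n - h n @[n --> \oo] --> a - b.
Proof. by move=> fa hb; exact: cvgB fa hb. Qed.

Lemma seq_cvgM f h a b : f n @[n --> \oo] --> a -> h n @[n --> \oo] --> b ->
  f n * h n @[n --> \oo] --> a * b.
Proof. by move=> fa hb; exact: cvgM fa hb. Qed.

Lemma seq_cvg_cst a : (fun=> a) n @[n --> \oo] --> a.
Proof. exact: cvg_cst. Qed.

Lemma seq_cvg_ext f h a : (forall n, f n = h n) ->
  f n @[n --> \oo] --> a -> h n @[n --> \oo] --> a.
Proof. by move=> /funext ->. Qed.

Lemma seq_cvg_le0 f h : (forall n, 0 <= f n <= h n) ->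
  h n @[n --> \oo] --> (0 : R) -> f n @[n --> \oo] --> (0 : R).
Proof. by move=> fh h0; apply: (squeeze_cvgr _ (cvg_cst 0) h0); exact: nearW. Qed.

Lemma cvg_complex_unique (f h : nat -> R[i]) (x y : R[i]) :
  Re (f n) @[n --> \oo] --> Re x -> Im (f n) @[n --> \oo] --> Im x ->
  Re (h n) @[n --> \oo] --> Re y -> Im (h n) @[n --> \oo] --> Im y ->
  (forall n, f n = h n) -> x = y.
Proof.
move=> f1 f2 h1 h2 E; have {}E : f = h by apply/funext.
rewrite E in f1 f2.
by apply: complexP; [exact: (cvg_unique _ f1 h1)|exact: (cvg_unique _ f2 h2)].
Qed.

End SequenceLimits.

Section CompletionNorm.
Variables (R : realType) (V : preHilbert R).
Local Notation C := (R[i]).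
Local Notation g := (@ph_form R V).
Local Notation H := (completion V).
Implicit Types (phi psi chi : H) (u v w : V) (e : R).

Lemma cnormN phi : cnorm (- phi) = cnorm phi.
Proof. by rewrite -scaleN1r cnormZ rnormN (rnorm_real 1) normr1 mul1r. Qed.

Lemma cnorm_dist phi psi : `|cnorm phi - cnorm psi| <= cnorm (phi - psi).
Proof.
rewrite ler_norml; apply/andP; split.
  have := cnormD phi (psi - phi); rewrite addrC subrK -(opprB phi) cnormN; lra.
have := cnormD psi (phi - psi); rewrite addrC subrK; lra.
Qed.

Lemma ciotaD u v : ciota (u + v) = ciota u + ciota v.
Proof. by rewrite -{1}[u]scale1r ciota_linear scale1r. Qed.

Lemma ciotaZ c u : ciota (c *: u) = c *: ciota u.
Proof.
apply: completion_fun_inj => w; rewrite /= ph_formZl //.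
Qed.

Definition capprox (a : nat -> V) phi := (cnorm (phi - ciota (a n)) @[n --> \oo] --> (0 : R)).

Lemma capprox_exists phi : exists a, capprox a phi.
Proof.
have /choice[a ha] (n : nat) : exists v, cnorm (phi - ciota v) <= n.+1%:R^-1.
  by apply: ciota_dense; rewrite invr_gt0 ltr0n.
exists a; apply: (seq_cvg_le0 _ (@cvg_harmonic R)) => n.
by rewrite cnorm_ge0 ha.
Qed.

Lemma capprox_ciota v : capprox (fun=> v) (ciota v).
Proof.
rewrite /capprox subrr; have -> : cnorm (0 : H) = 0; last exact: seq_cvg_cst.
by rewrite -(scale0r (0 : H)) cnormZ rnorm0 mul0r.
Qed.

Lemma capproxD a b phi psi : capprox a phi -> capprox b psi ->
  capprox (fun n => a n + b n) (phi + psi).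
Proof.
move=> ha hb; have := seq_cvgD ha hb; rewrite addr0; apply: seq_cvg_le0 => n.
by rewrite cnorm_ge0 /= (le_trans _ (cnormD _ _)) // ciotaD opprD addrACA.
Qed.

Lemma capproxZ a c phi : capprox a phi -> capprox (fun n => c *: a n) (c *: phi).
Proof.
move=> ha; have := seq_cvgM (@seq_cvg_cst _ (rnorm (c : C))) ha; rewrite mulr0.
by apply: seq_cvg_ext => n; rewrite ciotaZ -scalerBr cnormZ.
Qed.

Lemma capprox_norm a phi : capprox a phi -> phs (a n) @[n --> \oo] --> cnorm phi.
Proof.
move=> ha; apply/cvgrPdist_le => e e0; move/cvgrPdist_le : ha => /(_ _ e0).
apply: filterS => n; rewrite sub0r normrN ger0_norm ?cnorm_ge0 // => h.
by rewrite -cnorm_ciota (le_trans (cnorm_dist _ _)).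
Qed.

Lemma capprox_q a phi : capprox a phi -> phq (a n) @[n --> \oo] --> cnorm phi ^+ 2.
Proof.
move=> /capprox_norm h; have := seq_cvgM h h; rewrite -expr2.
by apply: seq_cvg_ext => n; rewrite -sqr_phs expr2.
Qed.

(** Polarisation recovers the real part of the inner product from the norm alone. Sesquilinearity is
    then inherited from the form on [V], as a limit along approximating sequences. *)
Definition credot phi psi : R := (cnorm (phi + psi) ^+ 2 - cnorm phi ^+ 2 - cnorm psi ^+ 2) / 2.

Lemma capprox_redot a b phi psi : capprox a phi -> capprox b psi ->
  Re (g (a n) (b n)) @[n --> \oo] --> credot phi psi.
Proof.
move=> ha hb.
have := seq_cvgM (seq_cvgB (seq_cvgB (capprox_q (capproxD ha hb)) (capprox_q ha))
  (capprox_q hb)) (@seq_cvg_cst R 2^-1).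
by apply: seq_cvg_ext => n; rewrite phqD; field.
Qed.

Definition cdot phi psi : C := credot phi psi +i* credot phi ('i *: psi).

Lemma Im_form_i u v : Im (g u v) = Re (g u ('i *: v)).
Proof. by rewrite ph_formZr Re_mul ReJ ImJ /=; ring. Qed.

Lemma capprox_imdot a b phi psi : capprox a phi -> capprox b psi ->
  Im (g (a n) (b n)) @[n --> \oo] --> Im (cdot phi psi).
Proof.
move=> ha hb; have := capprox_redot ha (capproxZ 'i hb).
by apply: seq_cvg_ext => n; rewrite Im_form_i.
Qed.

Lemma capprox_Re a b phi psi : capprox a phi -> capprox b psi ->
  Re (g (a n) (b n)) @[n --> \oo] --> Re (cdot phi psi).
Proof. exact: capprox_redot. Qed.

Lemma cdot_linearl c phi chi psi :
  cdot (c *: phi + chi) psi = c * cdot phi psi + cdot chi psi.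
Proof.
have [a ha] := capprox_exists phi; have [b hb] := capprox_exists psi.
have [d hd] := capprox_exists chi.
have hs := capproxD (capproxZ c ha) hd.
apply: (@cvg_complex_unique _ (fun n => g (c *: a n + d n) (b n))
    (fun n => c * g (a n) (b n) + g (d n) (b n))
    _ _ (capprox_Re hs hb) (capprox_imdot hs hb)) => [||n].
- rewrite ReD Re_mul; apply: (seq_cvg_ext (f := fun n =>
    Re c * Re (g (a n) (b n)) - Im c * Im (g (a n) (b n)) + Re (g (d n) (b n)))).
    by move=> n; rewrite ReD Re_mul.
  exact: (seq_cvgD (seq_cvgB (seq_cvgM (@seq_cvg_cst _ (Re c)) (capprox_Re ha hb))
    (seq_cvgM (@seq_cvg_cst _ (Im c)) (capprox_imdot ha hb))) (capprox_Re hd hb)).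
- rewrite ImD Im_mul; apply: (seq_cvg_ext (f := fun n =>
    Re c * Im (g (a n) (b n)) + Im c * Re (g (a n) (b n)) + Im (g (d n) (b n)))).
    by move=> n; rewrite ImD Im_mul.
  exact: (seq_cvgD (seq_cvgD (seq_cvgM (@seq_cvg_cst _ (Re c)) (capprox_imdot ha hb))
    (seq_cvgM (@seq_cvg_cst _ (Im c)) (capprox_Re ha hb))) (capprox_imdot hd hb)).
- by rewrite ph_form_linearl.
Qed.

Lemma cdot_conj phi psi : cdot phi psi = Num.conj (cdot psi phi).
Proof.
have [a ha] := capprox_exists phi; have [b hb] := capprox_exists psi.
apply: (@cvg_complex_unique _ (fun n => g (a n) (b n))
    (fun n => Num.conj (g (b n) (a n)))
    _ _ (capprox_Re ha hb) (capprox_imdot ha hb)) => [||n].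
- rewrite ReJ; apply: (seq_cvg_ext _ (capprox_Re hb ha)) => n.
  by rewrite ReJ.
- rewrite ImJ -sub0r.
  apply: (seq_cvg_ext _ (seq_cvgB (@seq_cvg_cst _ 0) (capprox_imdot hb ha))) => n.
  by rewrite ImJ sub0r.
- by rewrite -ph_form_conj.
Qed.

Lemma cdot_diag phi : cdot phi phi = (cnorm phi ^+ 2)%:C.
Proof.
have [a ha] := capprox_exists phi.
apply: (@cvg_complex_unique _ (fun n => g (a n) (a n)) (fun n => (phq (a n))%:C)
    _ _ (capprox_Re ha ha) (capprox_imdot ha ha)) => [||n].
- exact: (capprox_q ha).
- exact: (@seq_cvg_cst R 0).
- by rewrite ph_form_diag.
Qed.

(** The reproducing property: evaluation at [v] is the inner product with the image of [v]. It makes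
    every bounded antilinear functional on [V] an inner product, so the Riesz theorem holds by
    construction. *)
Lemma cdot_ciota phi v : cdot phi (ciota v) = phi v.
Proof.
have [a ha] := capprox_exists phi.
have key n : rnorm (phi v - g (a n) v : C) <= cnorm (phi - ciota (a n)) * phs v.
  by have := cnorm_bound (phi - ciota (a n)) v.
have h0 : cnorm (phi - ciota (a n)) * phs v @[n --> \oo] --> (0 : R).
  by have := seq_cvgM ha (@seq_cvg_cst _ (phs v)); rewrite mul0r.
apply: (@cvg_complex_unique _ (fun n => g (a n) v) (fun n => g (a n) v)
    _ _ (capprox_Re ha (capprox_ciota v)) (capprox_imdot ha (capprox_ciota v))) => //.
- apply/cvgrPdist_le => e e0; move/cvgrPdist_le : h0 => /(_ _ e0).
  apply: filterS => n; rewrite sub0r normrN => /ler_normlW; apply: le_trans.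
  by apply: le_trans (key n); rewrite -ReN -ReD Re_le_rnorm.
- apply/cvgrPdist_le => e e0; move/cvgrPdist_le : h0 => /(_ _ e0).
  apply: filterS => n; rewrite sub0r normrN => /ler_normlW; apply: le_trans.
  by apply: le_trans (key n); rewrite -ImN -ImD Im_le_rnorm.
Qed.

End CompletionNorm.

(** * The completion as a Hilbert space *)

Section CompletionHilbert.
Variables (R : realType) (V : preHilbert R).
Local Notation C := (R[i]).
Local Notation H := (completion V).
Implicit Types (phi psi chi : H) (u v w : V) (e : R).

Definition completion_norm phi : C := (cnorm phi)%:C.

Lemma completion_normD phi psi :
  completion_norm (phi + psi) <= completion_norm phi + completion_norm psi.
Proof. by rewrite /completion_norm -rmorphD lecR cnormD. Qed.

Lemma completion_normZ (c : C) phi :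
  completion_norm (c *: phi) = `|c| * completion_norm phi.
Proof. by rewrite /completion_norm cnormZ rmorphM /= -rnormE. Qed.

Lemma completion_norm0_eq0 phi : completion_norm phi = 0 -> phi = 0.
Proof. by move=> /complexI; exact: cnorm_eq0. Qed.

HB.instance Definition _ := Lmodule_isNormed.Build C H
  completion_normD completion_normZ completion_norm0_eq0.

Lemma rnorm_completion phi : rnorm phi = cnorm phi.
Proof. by []. Qed.

Lemma le0_of_small (x K : R) : (forall e, 0 < e -> x <= K * e) -> x <= 0.
Proof.
move=> h; rewrite leNgt; apply/negP => x0.
have K0 : 0 < `|K| + 1 by rewrite ltr_wpDl.
have e0 : 0 < x / (2 * (`|K| + 1)) by rewrite divr_gt0 // mulr_gt0.
have := h _ e0; rewrite mulrCA -ler_pdivrMl // mulVf ?gt_eqF //.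
rewrite invfM mulrA ler_pdivlMr // mul1r.
by have := ler_norm K; lra.
Qed.

Section Complete.
Variables (F : set_system H) (FF : ProperFilter F) (FC : cauchy F).

Lemma cauchy_small e : 0 < e ->
  exists2 A, F A & forall phi psi, A phi -> A psi -> cnorm (phi - psi) <= e.
Proof.
move=> e0; have /cauchy_ballP : cauchy F by [].
move=> /(_ e%:C); rewrite ltcR => /(_ e0) [[A B] /= [FA FB] AB].
exists (A `&` B); first exact: filterI.
move=> phi psi [Ap Bp] [As Bs]; have := AB (phi, psi) (conj Ap Bs).
by rewrite -ball_normE /= rnormE ltcR => /ltW.
Qed.

(** Limits of Cauchy filters are built pointwise: evaluation at [w] is Lipschitz with constant
    [phs w], so completeness of the reals, applied with [f] the real or imaginary part, gives the
    value at [w]. *)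
Lemma cauchy_eval (f : C -> R) w :
  (forall x y, `|f x - f y| <= rnorm (x - y)) ->
  cvg (f (phi w) @[phi --> F]).
Proof.
move=> fL; apply: cauchy_cvg; apply: cauchy_exP => e e0.
have s0 : 0 < phs w + 1 by rewrite ltr_wpDl ?phs_ge0.
have d0 : 0 < e / (phs w + 1) / 2 by rewrite !divr_gt0.
have [A FA hA] := cauchy_small d0; have [phi0 Aphi0] := filter_ex FA.
exists (f (phi0 w)); suff : F [set phi : H | ball (f (phi0 w)) e (f (phi w))] by [].
apply: filterS FA => phi Aphi; rewrite /= -ball_normE /=; apply: le_lt_trans (fL _ _) _.
apply: le_lt_trans (cnorm_bound (phi0 - phi) w) _.
apply: le_lt_trans (_ : e / (phs w + 1) / 2 * phs w < _); first by rewrite ler_wpM2r ?phs_ge0 ?hA.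
have : e / (phs w + 1) * (phs w + 1) = e by rewrite divfK ?gt_eqF.
have : 0 < e / (phs w + 1) by rewrite divr_gt0.
by have := phs_ge0 w; nra.
Qed.

Definition cauchy_limit_fun w : C :=
  lim (Re (phi w : C) @[phi --> F]) +i* lim (Im (phi w : C) @[phi --> F]).

Lemma cauchy_limit_near w e : 0 < e ->
  \forall phi \near F, rnorm (cauchy_limit_fun w - (phi : H) w : C) <= e.
Proof.
move=> e0.
have LRe x y : `|Re x - Re y| <= rnorm (x - y : C) by rewrite -ReN -ReD Re_le_rnorm.
have LIm x y : `|Im x - Im y| <= rnorm (x - y : C) by rewrite -ImN -ImD Im_le_rnorm.
have e2 : 0 < e / 2 by rewrite divr_gt0.
have /cvgrPdist_le/(_ _ e2) h1 := cauchy_eval (w := w) LRe.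
have /cvgrPdist_le/(_ _ e2) h2 := cauchy_eval (w := w) LIm.
near=> phi; apply: le_trans (rnorm_le_ReIm _) _.
rewrite ReD ImD ReN ImN [leRHS](splitr e) lerD //=; near: phi; [exact: h1|exact: h2].
Unshelve. all: by end_near. Qed.

Lemma cauchy_limit_subproof : (cauchy_limit_fun : V -> C^o) \in @completion_pred R V.
Proof.
apply/asboolP; split=> [c u v|].
  apply/eqP; rewrite -subr_eq0; apply/eqP/rnorm_eq0/le_anti; rewrite rnorm_ge0 andbT.
  apply: (@le0_of_small _ (1 + rnorm (c : C) + 1)) => e e0.
  near F => phi.
  have h1 : rnorm (cauchy_limit_fun (c *: u + v) - phi (c *: u + v) : C) <= e.
    by near: phi; exact: cauchy_limit_near.
  have h2 : rnorm (cauchy_limit_fun u - phi u : C) <= e.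
    by near: phi; exact: cauchy_limit_near.
  have h3 : rnorm (cauchy_limit_fun v - phi v : C) <= e.
    by near: phi; exact: cauchy_limit_near.
  have -> : cauchy_limit_fun (c *: u + v) - (Num.conj c * cauchy_limit_fun u + cauchy_limit_fun v)
    = (cauchy_limit_fun (c *: u + v) - phi (c *: u + v))
      + (Num.conj c * - (cauchy_limit_fun u - phi u) - (cauchy_limit_fun v - phi v)) :> C.
    by rewrite completion_antilinear; ring.
  apply: le_trans (rnormD _ _) _; rewrite !mulrDl -addrA mul1r lerD //.
  apply: le_trans (rnormD _ _) _; rewrite lerD ?rnormN //.
  by rewrite rnormM rnorm_conj rnormN ler_wpM2l ?rnorm_ge0.
have [A FA hA] := cauchy_small (@ltr01 R); have [phi0 Aphi0] := filter_ex FA.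
exists (cnorm phi0 + 1) => [|w]; first by rewrite addr_ge0 ?cnorm_ge0.
rewrite -subr_le0; apply: (@le0_of_small _ 1) => e e0; rewrite mul1r.
near F => phi.
have h1 : rnorm (cauchy_limit_fun w - phi w : C) <= e.
  by near: phi; exact: cauchy_limit_near.
have h2 : cnorm (phi - phi0) <= 1 by apply: hA => //; near: phi.
have h3 := cnorm_bound phi w; have h4 := cnormD phi0 (phi - phi0).
have := rnormD (cauchy_limit_fun w - phi w : C) (phi w : C); rewrite subrK => h5.
have : cnorm phi * phs w <= (cnorm phi0 + 1) * phs w.
  by rewrite ler_wpM2r ?phs_ge0 //; move: h4; rewrite addrC subrK; lra.
lra.
Unshelve. all: by end_near. Qed.

Lemma completion_complete_subproof : cvg F.
Proof.
pose l : H := Completion cauchy_limit_subproof.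
apply/cvg_ex; exists l; apply/cvgrPdist_le => z z0.
(* Radii of balls are complex here; a positive element of R[i] is real. *)
have [e ze] : exists e, z = e%:C.
  by exists (Re z); apply: complexP => //=; move: z0; rewrite ltcE => /andP[/eqP].
move: z0; rewrite ze ltcR => e0 {z ze}.
have [A FA hA] := cauchy_small e0; apply: filterS (FA) => phi Aphi.
rewrite rnormE lecR rnorm_completion; apply: cnorm_le => [|w]; first exact: ltW.
rewrite -subr_le0; apply: (@le0_of_small _ 1) => d d0; rewrite mul1r.
near F => psi.
have h1 : rnorm (cauchy_limit_fun w - psi w : C) <= d.
  by near: psi; exact: cauchy_limit_near.
have h2 : cnorm (psi - phi) <= e by apply: hA => //; near: psi.
have h3 := cnorm_bound (psi - phi) w.
have := rnormD (cauchy_limit_fun w - psi w : C) ((psi - phi) w : C).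
have -> : (cauchy_limit_fun w - psi w : C) + ((psi - phi) w : C) = (l - phi) w.
  have -> : ((psi - phi) w : C) = psi w - phi w by [].
  have -> : ((l - phi) w : C) = cauchy_limit_fun w - phi w by [].
  by ring.
have : cnorm (psi - phi) * phs w <= e * phs w by rewrite ler_wpM2r ?phs_ge0.
lra.
Unshelve. all: by end_near. Qed.

End Complete.

HB.instance Definition _ := Uniform_isComplete.Build H completion_complete_subproof.

Lemma cdot_bilinear : bilinear_for ( *%R : C -> C -> C) (Num.conj \; *%R) (@cdot R V).
Proof.
split=> [psi c phi chi|phi c psi chi] /=; first exact: cdot_linearl.
by rewrite cdot_conj cdot_linearl rmorphD rmorphM /= -!cdot_conj.
Qed.

HB.instance Definition _ := bilinear_isBilinear.Build C H H C
  *%R (Num.conj \; *%R) (@cdot R V) cdot_bilinear.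

Lemma cdot_hermitian phi psi : cdot phi psi = (-1) ^+ false * Num.conj (cdot psi phi).
Proof. by rewrite mul1r -cdot_conj. Qed.

HB.instance Definition _ := isHermitianSesquilinear.Build C H false Num.conj (@cdot R V)
  cdot_hermitian.

Lemma cdot_pos phi : phi != 0 -> 0 < cdot phi phi.
Proof.
move=> phi0; rewrite cdot_diag ltcR exprn_gt0 // lt_def cnorm_ge0 andbT.
by apply: contra phi0 => /eqP/cnorm_eq0/eqP.
Qed.

HB.instance Definition _ := isDotProduct.Build C H (@cdot R V) cdot_pos.

Lemma cdot_norm phi : `|phi| ^+ 2 = cdot phi phi.
Proof. by rewrite cdot_diag rnormE rmorphXn. Qed.

Definition completionHilbert : hilbertSpace R :=
  @HilbertSpace R H (@cdot R V) cdot_norm.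

End CompletionHilbert.

(** * Operators and adjoints *)

Section HilbertSpace.
Variables (R : realType) (H : hilbertSpace R).
Local Notation C := (R[i]).
Implicit Types (x y z : H).

Lemma hdotDl x y z : hdot H (x + y) z = hdot H x z + hdot H y z.
Proof. exact: linearDl. Qed.

Lemma hdotZl (c : C) x y : hdot H (c *: x) y = c * hdot H x y.
Proof. exact: linearZl_LR. Qed.

Lemma hdotZr (c : C) x y : hdot H x (c *: y) = Num.conj c * hdot H x y.
Proof. exact: linearZr_LR. Qed.

Lemma hdot_linearl (c : C) x y z : hdot H (c *: x + y) z = c * hdot H x z + hdot H y z.
Proof. by rewrite hdotDl hdotZl. Qed.

Lemma hdot_conj x y : hdot H x y = Num.conj (hdot H y x).
Proof.
by have := @hermitian_subproof _ _ _ _ (hdot H) x y; rewrite expr0 mul1r.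
Qed.

Lemma hdot_diag x : hdot H x x = (rnorm x ^+ 2)%:C.
Proof. by rewrite -hdot_norm rnormE rmorphXn. Qed.

Lemma hdot_suml (I : Type) (r : seq I) (F : I -> H) y :
  hdot H (\sum_(i <- r) F i) y = \sum_(i <- r) hdot H (F i) y.
Proof.
elim: r => [|i r IH]; first by rewrite !big_nil linear0l.
by rewrite !big_cons hdotDl IH.
Qed.

Definition hpow_form (n : nat) (u v : 'I_n -> H) : C := \sum_i hdot H (u i) (v i).

Lemma hpow_form_linearl n c (u v w : 'I_n -> H) :
  hpow_form (c *: u + v) w = c * hpow_form u w + hpow_form v w.
Proof.
by rewrite mulr_sumr -big_split; apply: eq_bigr => i _; rewrite /= -hdot_linearl.
Qed.

Lemma hpow_form_conj n (u v : 'I_n -> H) : hpow_form u v = Num.conj (hpow_form v u).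
Proof. by rewrite rmorph_sum; apply: eq_bigr => i _; exact: hdot_conj. Qed.

Lemma hpow_form_diag n (u : 'I_n -> H) : hpow_form u u = (\sum_i rnorm (u i) ^+ 2)%:C.
Proof. by rewrite rmorph_sum; apply: eq_bigr => i _; exact: hdot_diag. Qed.

Lemma hpow_form_ge0 n (u : 'I_n -> H) : 0 <= Re (hpow_form u u).
Proof. by rewrite hpow_form_diag /= sumr_ge0 // => i _; exact: sqr_ge0. Qed.

(** The power H^n as a [preHilbert], so that the triangle and Cauchy-Schwarz inequalities for [phs]
    apply to column vectors. *)
Definition hpow n : preHilbert R :=
  PreHilbert (@hpow_form_linearl n) (@hpow_form_conj n) (@hpow_form_ge0 n).

Lemma hpow_q n (u : hpow n) : phq u = \sum_i rnorm (u i) ^+ 2.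
Proof. by rewrite /phq /= hpow_form_diag. Qed.

Lemma l2norm_hpow n (v : 'cV[H]_n) : l2norm v = phs ((fun i => v i 0) : hpow n).
Proof. by rewrite /phs hpow_q. Qed.

Lemma hpow_coord_le n (u : hpow n) i : rnorm (u i) <= phs u.
Proof.
rewrite -ler_sqr ?nnegrE ?phs_ge0 ?rnorm_ge0 // sqr_phs hpow_q (bigD1 i) //= lerDl.
by apply: sumr_ge0 => j _; exact: sqr_ge0.
Qed.

Lemma hpow_le_sum n (u : hpow n) : phs u <= \sum_i rnorm (u i).
Proof.
have s0 : 0 <= \sum_i rnorm (u i) by apply: sumr_ge0 => i _; exact: rnorm_ge0.
rewrite -ler_sqr ?nnegrE ?phs_ge0 // sqr_phs hpow_q expr2 mulr_suml ler_sum // => i _.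
rewrite expr2 ler_wpM2l ?rnorm_ge0 // (bigD1 i) //= lerDl.
by apply: sumr_ge0 => j _; exact: rnorm_ge0.
Qed.

Lemma rnorm_sum (I : Type) (r : seq I) (F : I -> H) :
  rnorm (\sum_(i <- r) F i) <= \sum_(i <- r) rnorm (F i).
Proof.
elim: r => [|i r IH]; first by rewrite !big_nil rnorm0.
by rewrite !big_cons (le_trans (rnormD _ _)) // lerD2l.
Qed.

Lemma hdot_cauchy_schwarz x y : rnorm (hdot H x y : C) <= rnorm x * rnorm y.
Proof.
have := ph_cauchy_schwarz ((fun=> x) : hpow 1) ((fun=> y) : hpow 1).
by rewrite /phs !hpow_q /= /hpow_form !big_ord1 !sqrtr_sqr !ger0_norm ?rnorm_ge0.
Qed.

Lemma hdot_ext x y : (forall z, hdot H z x = hdot H z y) -> x = y.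
Proof.
move=> h; apply/eqP; rewrite -subr_eq0; apply/eqP/rnorm_eq0/eqP.
rewrite -sqrf_eq0 -(inj_eq (@complexI R)) -hdot_diag.
by rewrite linearBr /= h subrr.
Qed.

Lemma bounded_op_of (f : H -> H) (M : R) :
  linear f -> (forall x, rnorm (f x) <= M * rnorm x) -> f \in @bounded_op_pred R H.
Proof.
move=> fl fM; apply/asboolP; split=> // x; apply/cvgrPdist_le => e e0.
have M0 : 0 < `|M| + 1 by rewrite ltr_wpDl.
have [d de] : exists d : R, e = d%:C.
  by exists (Re e); apply: complexP => //=; move: e0; rewrite ltcE => /andP[/eqP].
rewrite de ltcR in e0 *.
have d0 : 0 < (d / (`|M| + 1))%:C by rewrite ltcR divr_gt0.
near=> y; rewrite rnormE lecR.
have -> : f x - f y = f (x - y).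
  by rewrite -scaleN1r addrC -fl scaleN1r addrC.
apply: le_trans (fM _) _.
have : rnorm (x - y) <= d / (`|M| + 1).
  by rewrite -lecR -rnormE; near: y; apply/cvgr_dist_le => //; exact: cvg_id.
rewrite ler_pdivlMr // => h; apply: le_trans h; rewrite mulrC ler_wpM2l ?rnorm_ge0 //.
by have := ler_norm M; lra.
Unshelve. all: by end_near. Qed.

Lemma bounded_op_bound (T : bounded_op H) :
  exists2 M : R, 0 <= M & forall x, rnorm (T x) <= M * rnorm x.
Proof.
have T0 : T 0 = 0 by have := bounded_op_linear T (-1) 0 0; rewrite scaler0 addr0 scaleN1r addNr.
have TZ (c : C) x : T (c *: x) = c *: T x.
  by have := bounded_op_linear T c x 0; rewrite T0 !addr0.
have /cvgr_dist_lt/(_ _ ltr01) : {for 0, continuous T} := @bounded_op_continuous _ _ T 0.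
rewrite T0 => /nbhs_ballP[/= e e0 he].
have [d de] : exists d : R, e = d%:C.
  by exists (Re e); apply: complexP => //=; move: e0; rewrite ltcE => /andP[/eqP].
rewrite de ltcR in e0 he.
exists (2 / d) => [|x]; first by rewrite divr_ge0 // ltW.
have [->|x0] := eqVneq x 0; first by rewrite T0 !rnorm0 mulr0.
have xp : 0 < rnorm x.
  by rewrite lt_def rnorm_ge0 andbT; apply: contra x0 => /eqP/rnorm_eq0/eqP.
have cp : 0 < d / (2 * rnorm x) by rewrite divr_gt0 // mulr_gt0.
have : `|0 - T ((d / (2 * rnorm x))%:C *: x)| < 1.
  apply: he; rewrite -ball_normE /= sub0r normrN rnormE ltcR rnormZ rnorm_real gtr0_norm //.
  by rewrite invfM mulrA -mulrA mulVf ?gt_eqF // mulr1; lra.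
rewrite sub0r normrN TZ rnormE (ltcR _ 1) rnormZ rnorm_real gtr0_norm // => /ltW.
rewrite -ler_pdivlMl // mulr1 invf_div => /le_trans; apply.
by rewrite mulrAC.
Qed.

Lemma bounded_op0 (T : bounded_op H) : T 0 = 0.
Proof. by have := bounded_op_linear T (-1) 0 0; rewrite scaler0 addr0 scaleN1r addNr. Qed.

Lemma bounded_opB (T : bounded_op H) x y : T (x - y) = T x - T y.
Proof. by rewrite addrC -scaleN1r bounded_op_linear scaleN1r addrC. Qed.

Lemma bounded_op_ext (S T : bounded_op H) : (forall x, S x = T x) -> S = T.
Proof. by move=> h; apply/val_inj/funext. Qed.

Lemma is_adjoint_adjoint (T S : bounded_op H) : is_adjoint T S -> adjoint T = S.
Proof.
move=> TS; apply: bounded_op_ext => y; apply: hdot_ext => x.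
have TA : is_adjoint T (adjoint T) by apply: (xgetPex 0 (P := is_adjoint T)); exists S.
by rewrite -TA -TS.
Qed.

Lemma is_adjointC (T S : bounded_op H) : is_adjoint T S -> is_adjoint S T.
Proof. by move=> h x y; rewrite hdot_conj -h -hdot_conj. Qed.

Lemma is_adjointD (T S T' S' : bounded_op H) :
  is_adjoint T S -> is_adjoint T' S' -> is_adjoint (T + T') (S + S').
Proof. by move=> h h' x y; rewrite /= hdotDl h h' linearDr. Qed.

Lemma is_adjointM (T S T' S' : bounded_op H) :
  is_adjoint T S -> is_adjoint T' S' -> is_adjoint (T * T') (S' * S).
Proof. by move=> h h' x y; rewrite /= h h'. Qed.

Definition mxapp n (T : 'M[bounded_op H]_n) (v : hpow n) : hpow n :=
  fun i => \sum_k T i k (v k).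

Lemma mxapp_linear n (T : 'M[bounded_op H]_n) c u v :
  mxapp T (c *: u + v) = c *: mxapp T u + mxapp T v.
Proof.
apply/funext => i; rewrite /mxapp.
transitivity (\sum_k (c *: T i k (u k) + T i k (v k))).
  by apply: eq_bigr => k _; exact: bounded_op_linear.
by rewrite big_split /= -scaler_sumr.
Qed.

(** The working form of an operator norm bound; [opnorm_le] and [opnorm_bounded] translate it to and
    from the supremum. *)
Definition mxbounded n (T : 'M[bounded_op H]_n) (M : R) :=
  forall v, phs (mxapp T v) <= M * phs v.

Lemma l2norm_mxprod n (T : 'M[bounded_op H]_n) (v : 'cV[H]_n) :
  l2norm (mxprod (fun (S : bounded_op H) x => S x) T v)
    = phs (mxapp T ((fun i => v i 0) : hpow n)).
Proof. by rewrite l2norm_hpow; congr phs; apply/funext => i; rewrite mxE. Qed.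

Lemma mxbounded_ex n (T : 'M[bounded_op H]_n) : exists2 M, 0 <= M & mxbounded T M.
Proof.
have /choice[M hM] (p : 'I_n * 'I_n) : exists M : R, 0 <= M /\ forall x, rnorm (T p.1 p.2 x)
  <= M * rnorm x.
  by have [M M0 h] := bounded_op_bound (T p.1 p.2); exists M.
exists (\sum_i \sum_k M (i, k)) => [|v].
  by do 2!(apply: sumr_ge0 => ? _); exact: (hM _).1.
rewrite (le_trans (hpow_le_sum _)) // mulr_suml ler_sum // => i _.
rewrite (le_trans (rnorm_sum _ _)) // mulr_suml ler_sum // => k _.
rewrite (le_trans ((hM (i, k)).2 _)) // ler_wpM2l ?hpow_coord_le //; exact: (hM _).1.
Qed.

Lemma opnorm_le n (T : 'M[bounded_op H]_n) (M : R) :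
  0 <= M -> mxbounded T M -> opnorm T <= M.
Proof.
move=> M0 TM; apply: ge_sup.
  exists (l2norm (mxprod (fun (S : bounded_op H) x => S x) T (0 : 'cV[H]_n))); exists 0 => //=.
  rewrite /l2norm big1 ?sqrtr0 // => i _; by rewrite mxE rnorm0 expr0n.
move=> _ [v /= v1 <-]; rewrite l2norm_mxprod (le_trans (TM _)) //.
by rewrite -l2norm_hpow -[leRHS]mulr1 ler_wpM2l.
Qed.

Lemma opnorm_ge1 n (T : 'M[bounded_op H]_n) (v : hpow n) :
  phs v <= 1 -> phs (mxapp T v) <= opnorm T.
Proof.
move=> v1; have [M M0 TM] := mxbounded_ex T.
have vE : (fun i => (\col_i v i) i 0) = v :> hpow n by apply/funext => i; rewrite mxE.
have v1' : l2norm (\col_i v i) <= 1 by rewrite l2norm_hpow vE.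
have Tv : l2norm (mxprod (fun (S : bounded_op H) x => S x) T (\col_i v i)) = phs (mxapp T v).
  by rewrite l2norm_mxprod vE.
apply: sup_upper_bound; last by exists (\col_i v i).
split; first by exists (phs (mxapp T v)), (\col_i v i).
exists M => _ [w /= w1 <-]; rewrite l2norm_mxprod (le_trans (TM _)) //.
by rewrite -l2norm_hpow -[leRHS]mulr1 ler_wpM2l.
Qed.

Lemma opnorm_ge0 n (T : 'M[bounded_op H]_n) : 0 <= opnorm T.
Proof.
apply: le_trans (@opnorm_ge1 n T 0 _); first exact: phs_ge0.
by rewrite -(scale0r (0 : hpow n)) phsZ rnorm0 mul0r.
Qed.

Lemma opnorm_bounded n (T : 'M[bounded_op H]_n) : mxbounded T (opnorm T).
Proof.
move=> v; have mZ c : phs (mxapp T (c *: v)) = rnorm (c : C) * phs (mxapp T v).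
  have := mxapp_linear T c v 0; rewrite addr0.
  have -> : mxapp T 0 = 0 by apply/funext => i; apply: big1 => k _; exact: bounded_op0.
  by rewrite addr0 => ->; rewrite phsZ.
have [v0|v0] := eqVneq (phs v) 0.
  have [M M0 /(_ v)] := mxbounded_ex T; rewrite v0 !mulr0; exact.
have vp : 0 < phs v by rewrite lt_def v0 phs_ge0.
have := @opnorm_ge1 n T ((phs v)^-1%:C *: v).
rewrite phsZ mZ rnorm_real ger0_norm ?invr_ge0 ?phs_ge0 // mulVf // lexx => /(_ isT).
by rewrite ler_pdivrMl // mulrC.
Qed.

(** With S the adjoint matrix of T, |S v|^2 = <T (S v), v> is at most M |S v| |v|; cancel |S v|. *)
Lemma mxbounded_adjoint n (T S : 'M[bounded_op H]_n) (M : R) : 0 <= M ->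
  (forall i j, is_adjoint (T i j) (S j i)) -> mxbounded T M -> mxbounded S M.
Proof.
move=> M0 TS TM v.
have E : hpow_form (mxapp T (mxapp S v)) v = hpow_form (mxapp S v) (mxapp S v).
  rewrite /hpow_form.
  transitivity (\sum_i \sum_k hdot H (mxapp S v k) (S k i (v i))).
    apply: eq_bigr => i _; rewrite /mxapp hdot_suml.
    by apply: eq_bigr => k _; exact: TS.
  by rewrite exchange_big; apply: eq_bigr => k _; rewrite /= linear_sumr.
have [s0|s0] := eqVneq (phs (mxapp S v)) 0; first by rewrite s0 mulr_ge0 ?phs_ge0.
have sp : 0 < phs (mxapp S v) by rewrite lt_def s0 phs_ge0.
rewrite -(ler_pM2l sp) -expr2 sqr_phs.
have := ph_cauchy_schwarz (mxapp T (mxapp S v)) v.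
rewrite [ph_form _ _]E [hpow_form _ _](ph_form_diag (mxapp S v : hpow n)).
rewrite rnorm_real ger0_norm ?phq_ge0 // => h; apply: le_trans h _.
rewrite mulrA ler_wpM2r ?phs_ge0 // mulrC; exact: TM.
Qed.

Lemma mxboundedD n (T S : 'M[bounded_op H]_n) (M N : R) :
  mxbounded T M -> mxbounded S N -> mxbounded (T + S) (M + N).
Proof.
move=> TM SN v; have -> : mxapp (T + S) v = mxapp T v + mxapp S v.
  apply/funext => i; rewrite /mxapp -[RHS]big_split; apply: eq_bigr => k _.
  by rewrite mxE.
by rewrite (le_trans (phsD _ _)) // mulrDl lerD.
Qed.

End HilbertSpace.

(** * Operators given on a dense subspace, and existence of adjoints *)

Section DenseSubspace.
Variables (R : realType) (V : preHilbert R).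
Local Notation C := (R[i]).
Local Notation H := (completionHilbert V).
Implicit Types (x y : H) (v w : V) (e : R).

Definition hiota (v : V) : H := ciota v.
Local Notation iota := hiota.

Lemma hiota_linear : linear hiota.
Proof. exact: ciota_linear. Qed.

Lemma rnorm_hiota v : rnorm (hiota v) = phs v.
Proof. exact: cnorm_ciota. Qed.

Lemma hdot_ciota x v : hdot H x (iota v) = (x : completion V) v.
Proof. exact: cdot_ciota. Qed.

Lemma hdot_ciota2 v w : hdot H (iota v) (iota w) = ph_form v w.
Proof. exact: cdot_ciota. Qed.

Lemma dense_ext x y : (forall v, hdot H x (iota v) = hdot H y (iota v)) -> x = y.
Proof. by move=> h; apply: completion_fun_inj => v; rewrite -!hdot_ciota h. Qed.

Lemma dense_approx x e : 0 < e -> exists v, rnorm (x - iota v) <= e.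
Proof. exact: ciota_dense. Qed.

Lemma dense_op_ext (S T : bounded_op H) :
  (forall v, S (iota v) = T (iota v)) -> S = T.
Proof.
move=> ST; apply: bounded_op_ext => x; apply/eqP; rewrite -subr_eq0.
apply/eqP/rnorm_eq0/le_anti; rewrite rnorm_ge0 andbT.
have [M M0 hM] := bounded_op_bound S; have [N N0 hN] := bounded_op_bound T.
apply: (@le0_of_small _ _ (M + N)) => e e0.
have [v hv] := dense_approx x e0.
have -> : S x - T x = S (x - iota v) - T (x - iota v).
  by rewrite !bounded_opB ST opprB addrA subrK.
rewrite mulrDl (le_trans (rnormD _ _)) // rnormN lerD //.
  by rewrite (le_trans (hM _)) // ler_wpM2l.
by rewrite (le_trans (hN _)) // ler_wpM2l.
Qed.

(** The functional w |-> <y, T w> on [V] is bounded and antilinear, hence already a vector of the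
    completion; this vector is the value of the adjoint at y. *)
Lemma completion_adjoint_ex (T : bounded_op H) : exists S, is_adjoint T S.
Proof.
have [M M0 hM] := bounded_op_bound T.
have fP y : (fun w => hdot H y (T (iota w)) : C^o) \in @completion_pred R V.
  apply/asboolP; split=> [c u v|].
    rewrite hiota_linear bounded_op_linear hdot_conj hdot_linearl rmorphD rmorphM.
    by congr (_ * _ + _); rewrite [RHS]hdot_conj.
  exists (rnorm y * M) => [|v]; first by rewrite mulr_ge0 ?rnorm_ge0.
  rewrite (le_trans (hdot_cauchy_schwarz _ _)) // -mulrA ler_wpM2l ?rnorm_ge0 //.
  by rewrite (le_trans (hM _)) // rnorm_hiota.
pose f y : H := Completion (fP y).
have fE y w : hdot H (f y) (iota w) = hdot H y (T (iota w)) by rewrite hdot_ciota.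
have fl : linear f.
  by move=> c x y; apply: dense_ext => w; rewrite !(hdot_linearl, fE).
have fM y : rnorm (f y) <= M * rnorm y.
  apply: cnorm_le => [|v]; first by rewrite mulr_ge0 ?rnorm_ge0.
  apply: (le_trans (hdot_cauchy_schwarz y (T (iota v)))).
  rewrite -mulrA mulrCA ler_wpM2l ?rnorm_ge0 //.
  by rewrite (le_trans (hM _)) // rnorm_hiota.
exists (BoundedOp (bounded_op_of fl fM)) => x y; rewrite /=.
apply/eqP; rewrite -subr_eq0; apply/eqP/rnorm_eq0/le_anti; rewrite rnorm_ge0 andbT.
apply: (@le0_of_small _ _ (M * rnorm y + M * rnorm y)) => e e0.
have [v hv] := dense_approx x e0.
have -> : hdot H (T x) y - hdot H x (f y)
  = hdot H (T (x - iota v)) y - hdot H (x - iota v) (f y).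
  have fE' : hdot H (T (iota v)) y = hdot H (iota v) (f y).
    by rewrite hdot_conj -fE -hdot_conj.
  have dB a b c : hdot H (a - b) c = hdot H a c - hdot H b c.
    by rewrite -scaleN1r hdotDl hdotZl mulN1r.
  by rewrite bounded_opB !dB fE'; ring.
rewrite mulrDl (le_trans (rnormD _ _)) // rnormN lerD //.
  rewrite (le_trans (hdot_cauchy_schwarz _ _)) // mulrAC ler_wpM2r ?rnorm_ge0 //.
  by rewrite (le_trans (hM _)) // ler_wpM2l.
rewrite (le_trans (hdot_cauchy_schwarz _ _)) // mulrC ler_pM ?rnorm_ge0 //.
Qed.

(** Vectors are functionals on [V], so composing with [t] on the right is defined on the whole
    completion. Its adjoint is the extension of [t]. *)
Lemma completion_extend (t : V -> V) (M : R) : linear t ->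
  (forall v, phs (t v) <= M * phs v) ->
  exists T : bounded_op H, forall v, T (iota v) = iota (t v).
Proof.
move=> tl tM.
have M1 : 0 <= `|M| by [].
have {}tM v : phs (t v) <= `|M| * phs v.
  by rewrite (le_trans (tM v)) // ler_wpM2r ?phs_ge0 // ler_norm.
have fP (x : H) : (fun w => (x : completion V) (t w)) \in @completion_pred R V.
  apply/asboolP; split=> [c u v|]; first by rewrite tl completion_antilinear.
  exists (rnorm x * `|M|) => [|v]; first by rewrite mulr_ge0 ?rnorm_ge0.
  rewrite (le_trans (cnorm_bound _ _)) // -mulrA ler_wpM2l ?cnorm_ge0 //.
pose f x : H := Completion (fP x).
have fl : linear f by move=> c x y; apply: completion_fun_inj.
have fM x : rnorm (f x) <= `|M| * rnorm x.
  apply: cnorm_le => [|v]; first by rewrite mulr_ge0 ?rnorm_ge0.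
  rewrite /= (le_trans (cnorm_bound _ _)) // -mulrA mulrCA ler_wpM2l ?cnorm_ge0 //.
have [T hT] := completion_adjoint_ex (BoundedOp (bounded_op_of fl fM)).
exists T => v; apply: dense_ext => w; rewrite (is_adjointC hT) hdot_ciota2.
rewrite hdot_conj hdot_ciota /= [in RHS]ph_form_conj; congr Num.conj.
Qed.

(** [T] has some bound K, unrelated to M. It serves only to control the error of approximating a
    vector by one from the dense subspace. *)
Lemma mxbounded_dense n (T : 'M[bounded_op H]_n) (M : R) : 0 <= M ->
  (forall v : 'I_n -> V, phs (mxapp T (fun i => iota (v i)))
    <= M * Num.sqrt (\sum_i phq (v i))) ->
  mxbounded T M.
Proof.
move=> M0 TM u; have [K K0 TK] := mxbounded_ex T.
rewrite -subr_le0; apply: (@le0_of_small _ _ ((K + M) * n%:R)) => e e0.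
have /choice[v hv] i : exists v, rnorm (u i - iota v) <= e by exact: dense_approx.
pose w : hpow H n := fun i => iota (v i).
have wE : phs w = Num.sqrt (\sum_i phq (v i)).
  rewrite /phs hpow_q; congr Num.sqrt; apply: eq_bigr => i _.
  by rewrite rnorm_hiota sqr_phs.
have uw : phs (u - w) <= n%:R * e.
  rewrite (le_trans (hpow_le_sum _)) // -[n in n%:R]card_ord mulr_natl -sumr_const.
  by rewrite ler_sum // => i _; exact: hv.
have -> : u = (u - w) + w by rewrite subrK.
have := mxapp_linear T 1 (u - w) w; rewrite !scale1r => ->.
have h1 := phsD (mxapp T (u - w)) (mxapp T w).
have h2 := TK (u - w); have h3 := TM v; rewrite -wE in h3.
have h5 : phs w <= phs (u - w + w) + n%:R * e.
  have := phsD (u - w + w) ((-1) *: (u - w)); rewrite phsZ rnormN (rnorm_real 1) normr1 mul1r.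
  rewrite scaleN1r addrAC subrr add0r => h; apply: le_trans h _.
  by rewrite lerD2l.
have aux (a b c d p q ne : R) : a <= b + c -> b <= K * d -> c <= M * p -> p <= q + ne ->
  d <= ne -> a - M * q <= (K + M) * ne by clear -K0 M0; nra.
rewrite -mulrA; exact: (aux _ _ _ _ _ _ _ h1 h2 h3 h5 uw).
Qed.

End DenseSubspace.

(** * Hahn-Banach, and contractions implementing norm inequalities *)

Section HahnBanach.
Variables (R : realType) (W : lmodType R).
Implicit Types (p q : W -> R) (u v w : W).

Definition sublinear p :=
  (forall u v, p (u + v) <= p u + p v) /\ (forall t u, 0 < t -> p (t *: u) <= t * p u).

Lemma sublinear0 p : sublinear p -> p 0 = 0.
Proof.
have t2 : (0 : R) < 2 by [].
move=> [_ pZ]; have := pZ 2 0 t2; rewrite scaler0 => h1.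
by have := pZ 2^-1 0; rewrite scaler0 invr_gt0 => /(_ t2) h2; lra.
Qed.

Lemma sublinearN p u : sublinear p -> - p (- u) <= p u.
Proof. by move=> ps; have := ps.1 u (- u); rewrite subrr sublinear0 //; lra. Qed.

Lemma sublinearZ p t u : sublinear p -> 0 <= t -> p (t *: u) = t * p u.
Proof.
move=> ps; rewrite le_eqVlt => /orP[/eqP <-|t0].
  by rewrite scale0r sublinear0 // mul0r.
apply/eqP; rewrite eq_le ps.2 //= -ler_pdivlMl //.
by have := ps.2 t^-1 (t *: u); rewrite scalerK ?gt_eqF // invr_gt0 => /(_ t0).
Qed.

Lemma le_infD (A B : set R) x : A !=set0 -> B !=set0 ->
  (forall a b, A a -> B b -> x <= a + b) -> x <= inf A + inf B.
Proof.
move=> A0 B0 h; rewrite -lerBlDr; apply: lb_le_inf => // a Aa.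
rewrite lerBlDr addrC -lerBlDr; apply: lb_le_inf => // b Bb.
by rewrite lerBlDr addrC h.
Qed.

(** The infimum [descend p v] is a sublinear functional below [p] whose value at [- v] is at most
    [- p v]. If [p] is minimal, then [descend p v = p] for all v, which forces [p] to be
    additive. *)
Definition descend_set p v u := [set p (u + t *: v) - t * p v | t in [set t : R | 0 <= t]].
Definition descend p v u : R := inf (descend_set p v u).

Lemma descend_has_inf p v u : sublinear p -> has_inf (descend_set p v u).
Proof.
move=> ps; split; first by exists (p (u + 0 *: v) - 0 * p v), 0 => /=.
exists (- p (- u)) => _ [t /= t0 <-].
rewrite -(sublinearZ _ ps t0); have := ps.1 (u + t *: v) (- u).
by rewrite [u + _]addrC addrK; lra.
Qed.

Lemma descend_le p v u t : sublinear p -> 0 <= t ->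
  descend p v u <= p (u + t *: v) - t * p v.
Proof.
by move=> ps t0; apply: ge_inf; [exact: (descend_has_inf v u ps).2|exists t].
Qed.

Lemma descend_sublinear p v : sublinear p -> sublinear (descend p v).
Proof.
move=> ps; split=> [u w|c u c0].
  apply: le_infD; [exact: (descend_has_inf v _ ps).1..|].
  move=> _ _ [t /= t0 <-] [s /= s0 <-].
  apply: le_trans (descend_le v _ ps (addr_ge0 t0 s0)) _.
  by have := ps.1 (u + t *: v) (w + s *: v); rewrite addrACA -scalerDl; lra.
rewrite -ler_pdivrMl //; apply: lb_le_inf; first exact: (descend_has_inf v _ ps).1.
move=> _ [t /= t0 <-]; rewrite ler_pdivrMl //.
apply: le_trans (descend_le v _ ps (mulr_ge0 (ltW c0) t0)) _.
by rewrite -scalerA -scalerDr sublinearZ ?(ltW c0) // mulrBr mulrA.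
Qed.

Lemma descend_self p v : sublinear p -> descend p v (- v) <= - p v.
Proof.
by move=> ps; have := descend_le v (- v) ps (@ler01 R);
  rewrite scale1r addNr sublinear0 // mul1r sub0r.
Qed.

Lemma descend_le_self p v u : sublinear p -> descend p v u <= p u.
Proof.
by move=> ps; have := descend_le v u ps (lexx 0); rewrite scale0r addr0 mul0r subr0.
Qed.

(* A minimal sublinear functional is linear. *)
Lemma minimal_sublinear q : sublinear q -> exists p,
  [/\ sublinear p, forall u, p u <= q u & forall p', sublinear p' -> (forall u, p' u <= p u) ->
    p' = p].
Proof.
move=> qs; pose T := {p | sublinear p /\ forall u, p u <= q u}.
pose le (a b : T) := `[< forall u, sval b u <= sval a u >].
have T_eq (a b : T) : sval a = sval b -> a = b.
  by case: a b => a ha [b hb] /= E; subst b; congr exist; exact: Prop_irrelevance.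
have [||||[p [ps pq]] /= pmin] := @Zorn T le.
- by move=> a; apply/asboolP.
- by move=> a b c /asboolP ab /asboolP bc; apply/asboolP => u; exact: le_trans (bc u) (ab u).
- by move=> a b /asboolP ab /asboolP ba; apply: T_eq; apply/funext => u; apply: le_anti;
    rewrite ab ba.
- move=> A Atot; have [[a0 Aa0]|/forallNP A0] := pselect (exists a, A a); last first.
    by exists (exist _ q (conj qs (fun u => lexx (q u)))) => a /A0 [].
  (* The pointwise infimum of a chain is finite because every member is at least [- q (- u)], and
     subadditive because the smaller of two members serves both summands. *)
  pose S u := [set sval a u | a in A].
  have S0 u : S u !=set0 by exists (sval a0 u), a0.
  have Slb u : has_lbound (S u).
    exists (- q (- u)) => _ [[a [sa qa]] Aa <-] /=.
    by have := sublinearN u sa; have := qa (- u); lra.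
  have Sle a u : A a -> inf (S u) <= sval a u.
    by move=> Aa; apply: ge_inf => //; exists a.
  have infs : sublinear (fun u => inf (S u)).
    split=> [u v|t u t0].
      apply: le_infD => // _ _ [a Aa <-] [b Ab <-].
      have [/asboolP ab|/asboolP ba] := Atot _ _ Aa Ab.
        apply: le_trans (Sle b _ Ab) _; apply: le_trans ((svalP b).1.1 _ _) _.
        by rewrite lerD2r; exact: ab.
      apply: le_trans (Sle a _ Aa) _; apply: le_trans ((svalP a).1.1 _ _) _.
      by rewrite lerD2l; exact: ba.
    rewrite -ler_pdivrMl //; apply: lb_le_inf => // _ [a Aa <-].
    rewrite ler_pdivrMl //; apply: le_trans (Sle a _ Aa) _; exact: (svalP a).1.2.
  have infq u : inf (S u) <= q u by apply: le_trans (Sle a0 _ Aa0) _; exact: (svalP a0).2.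
  by exists (exist (fun p : W -> R => sublinear p /\ forall u, p u <= q u) _
    (conj infs infq)) => a Aa; apply/asboolP => u; exact: Sle.
exists p; split=> // p' p's p'p.
have p'q u : p' u <= q u by exact: le_trans (p'p u) (pq u).
have /pmin : le (exist _ p (conj ps pq)) (exist _ p' (conj p's p'q)) by apply/asboolP.
by move=> /(congr1 sval).
Qed.

(** The minimal functional is sought below [descend q u0] instead of [q]: this gives P (- u0) <= - q
    u0, and so equality at u0. *)
Lemma hahn_banach q u0 : sublinear q -> exists P : W -> R,
  [/\ forall t u v, P (t *: u + v) = t * P u + P v, forall u, P u <= q u & P u0 = q u0].
Proof.
move=> qs; have qs' := descend_sublinear u0 qs.
have [p [ps pq pmin]] := minimal_sublinear qs'.
have pD u v : p (u + v) = p u + p v.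
  apply: le_anti; rewrite ps.1 /=.
  have E : descend p v = p.
    by apply: pmin; [exact: descend_sublinear|move=> w; exact: descend_le_self].
  by have := descend_le v u ps (@ler01 R); rewrite E scale1r mul1r; lra.
have pN u : p (- u) = - p u.
  by apply/eqP; rewrite -addr_eq0 -pD addNr sublinear0.
have pZ t u : p (t *: u) = t * p u.
  have [t0|t0] := leP 0 t; first exact: sublinearZ.
  have : p ((- t) *: u) = - t * p u by rewrite sublinearZ // oppr_ge0 ltW.
  by rewrite scaleNr pN mulNr => /oppr_inj.
have pq2 u : p u <= q u by exact: le_trans (pq u) (descend_le_self _ _ qs).
exists p; split=> // [t u v|]; first by rewrite pD pZ.
apply: le_anti; rewrite pq2 /=.
by have := le_trans (pq (- u0)) (descend_self u0 qs); rewrite pN lerN2.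
Qed.

End HahnBanach.

(** * Separation of points by linear functionals *)

Definition is_functional (R : realType) (V : lmodType R[i]) (f : V -> R[i]) :=
  forall c u v, f (c *: u + v) = c * f u + f v.

Section Functionals.
Variables (R : realType) (V : lmodType R[i]).
Local Notation C := (R[i]).
Implicit Types (f : V -> C).

Lemma functional0 f : is_functional f -> f 0 = 0.
Proof. by move=> fl; have := fl (-1) 0 0; rewrite scaler0 addr0 mulN1r addNr. Qed.

Lemma functionalD f u v : is_functional f -> f (u + v) = f u + f v.
Proof. by move=> fl; have := fl 1 u v; rewrite scale1r mul1r. Qed.

Lemma functionalZ f c u : is_functional f -> f (c *: u) = c * f u.
Proof. by move=> fl; have := fl c u 0; rewrite functional0 // !addr0. Qed.

Lemma functional_sum f (I : Type) (r : seq I) (F : I -> V) : is_functional f ->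
  f (\sum_(i <- r) F i) = \sum_(i <- r) f (F i).
Proof.
move=> fl; elim: r => [|i r IH]; first by rewrite !big_nil functional0.
by rewrite !big_cons functionalD // IH.
Qed.

Lemma functional_lincomb r (g : 'I_r -> V -> C) (d : 'I_r -> C) :
  (forall i, is_functional (g i)) -> is_functional (fun v => \sum_i d i * g i v).
Proof.
move=> gl c u v; rewrite mulr_sumr -big_split; apply: eq_bigr => i _.
by rewrite /= gl; ring.
Qed.

Definition separating := forall v, (forall f, is_functional f -> f v = 0) -> v = 0.

End Functionals.

(** An alias that carries the structure of a real vector space, as [hahn_banach] asks for, apart
    from the complex structure of [V]. *)
Definition realified (R : realType) (V : lmodType R[i]) : Type := V.

Section Realified.
Variables (R : realType) (V : lmodType R[i]).

HB.instance Definition _ := GRing.Zmodule.on (realified V).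

Definition realified_scale (t : R) (v : realified V) : realified V := (t%:C : R[i]) *: (v : V).

Lemma realified_scaleA a b v :
  realified_scale a (realified_scale b v) = realified_scale (a * b) v.
Proof. by rewrite /realified_scale scalerA rmorphM. Qed.

Lemma realified_scale1 : left_id 1 realified_scale.
Proof. by move=> v; rewrite /realified_scale scale1r. Qed.

Lemma realified_scaleDr : right_distributive realified_scale +%R.
Proof. by move=> a u v; rewrite /realified_scale scalerDr. Qed.

Lemma realified_scaleDl v : {morph realified_scale^~ v : a b / a + b}.
Proof. by move=> a b; rewrite /realified_scale rmorphD scalerDl. Qed.

HB.instance Definition _ := GRing.Zmodule_isLmodule.Build R (realified V)
  realified_scaleA realified_scale1 realified_scaleDr realified_scaleDl.

End Realified.

(** A real linear P below the norm with P v = |v| is the real part of the complex linear functional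
    u |-> P u - i P (i u); if that functional vanishes at v, so does |v|. *)
Lemma normed_separating (R : realType) (V : normedModType R[i]) : separating V.
Proof.
move=> v hv; apply: rnorm_eq0.
have ns : sublinear (fun u : realified V => rnorm (u : V)).
  split=> [u w|t u t0]; first exact: rnormD.
  by rewrite [rnorm _]rnormZ rnorm_real gtr0_norm.
have [P [PL _ Pv]] := @hahn_banach R (realified V) (fun u => rnorm (u : V)) v ns.
have PZ t (u : V) : P ((t%:C : R[i]) *: u) = t * P u.
  by have := PL t u 0; rewrite (_ : P 0 = 0) ?addr0 //; have := PL (-1) 0 0;
    rewrite scaler0 addr0 mulN1r addNr.
have PD (u w : V) : P (u + w) = P u + P w.
  by have := PL 1 u w; rewrite scale1r mul1r.
have Pc (c : R[i]) (x : V) : P (c *: x) = Re c * P x + Im c * P ('i *: x).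
  rewrite -!PZ -PD scalerA -scalerDl; have <- // : c = (Re c)%:C + (Im c)%:C * 'i.
  by apply: complexP; rewrite ?ReD ?ImD ?Re_mul ?Im_mul /=; ring.
have Pii (x : V) : P ('i *: ('i *: x)) = - P x.
  have ii : 'i * 'i = (-1)%:C :> R[i].
    by apply: complexP; rewrite ?Re_mul ?Im_mul /=; ring.
  by rewrite scalerA ii PZ mulN1r.
have fl : is_functional (fun u : V => P u -i* P ('i *: u)).
  move=> c u w; apply: complexP; rewrite ?ReD ?ImD ?Re_mul ?Im_mul /=.
    by rewrite PD Pc; ring.
  by rewrite scalerDr PD scalerA mulrC -scalerA Pc Pii; ring.
by have /(congr1 (@complex.Re _)) := hv _ fl; rewrite /= Pv.
Qed.

(** * Contractions of C^N from inequalities between squares of functionals *)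

Section OrthonormalFamilies.
Variables (R : realType) (V : preHilbert R).
Local Notation C := (R[i]).
Local Notation g := (@ph_form R V).

Lemma ph_form_suml (I : Type) (r : seq I) (F : I -> V) w :
  g (\sum_(i <- r) F i) w = \sum_(i <- r) g (F i) w.
Proof.
elim: r => [|i r IH]; first by rewrite !big_nil ph_form0l.
by rewrite !big_cons ph_formDl IH.
Qed.

Lemma ph_form_sumr (I : Type) (r : seq I) (F : I -> V) w :
  g w (\sum_(i <- r) F i) = \sum_(i <- r) g w (F i).
Proof.
by rewrite ph_form_conj ph_form_suml rmorph_sum; apply: eq_bigr => i _; rewrite [RHS]ph_form_conj.
Qed.

Definition orthonormal r (e : 'I_r -> V) := forall i j, g (e i) (e j) = (i == j)%:R.

Lemma orthonormal_coord r (e : 'I_r -> V) (d : 'I_r -> C) j : orthonormal e ->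
  g (\sum_i d i *: e i) (e j) = d j.
Proof.
move=> eo; rewrite ph_form_suml (bigD1 j) //= ph_formZl eo eqxx mulr1 big1 ?addr0 // => i ij.
by rewrite ph_formZl eo (negbTE ij) mulr0.
Qed.

Lemma orthonormal_bessel r (e : 'I_r -> V) z : orthonormal e ->
  phq (\sum_i g z (e i) *: e i) <= phq z.
Proof.
move=> eo; set s := \sum_i _.
have sE : g z s = g s s.
  rewrite {1 3}/s !ph_form_sumr; apply: eq_bigr => i _.
  by rewrite !ph_formZr orthonormal_coord.
have := phq_ge0 (z + (-1) *: s); rewrite phqD phqZ ph_formZr sE ph_form_diag.
by rewrite rmorphN rmorph1 mulN1r ReN rnormN (rnorm_real 1) normr1 /=; lra.
Qed.

End OrthonormalFamilies.

Section Contraction.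
Variables (R : realType) (N : nat).
Local Notation C := (R[i]).

Definition cpow_form (u v : 'I_N -> C^o) : C := \sum_i u i * Num.conj (v i).

Lemma cpow_form_linearl (c : C) u v w :
  cpow_form (c *: u + v) w = c * cpow_form u w + cpow_form v w.
Proof.
rewrite mulr_sumr -big_split; apply: eq_bigr => i _ /=.
have -> : (c *: u + v) i = c * u i + v i by [].
by ring.
Qed.

Lemma cpow_form_conj u v : cpow_form u v = Num.conj (cpow_form v u).
Proof.
rewrite rmorph_sum; apply: eq_bigr => i _.
by rewrite rmorphM /= conjCK mulrC.
Qed.

Lemma cpow_form_diag u : cpow_form u u = (\sum_i rnorm (u i : C) ^+ 2)%:C.
Proof. by rewrite rmorph_sum; apply: eq_bigr => i _; rewrite mul_conj. Qed.

Lemma cpow_form_ge0 u : 0 <= Re (cpow_form u u).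
Proof. by rewrite cpow_form_diag /= sumr_ge0 // => i _; exact: sqr_ge0. Qed.

Definition cpow : preHilbert R :=
  PreHilbert cpow_form_linearl cpow_form_conj cpow_form_ge0.

Lemma cpow_q (u : cpow) : phq u = \sum_i rnorm (u i : C) ^+ 2.
Proof. by rewrite /phq /= cpow_form_diag. Qed.

Lemma orthonormal_size r (e : 'I_r -> cpow) : orthonormal e -> (r <= N)%N.
Proof.
move=> eo; pose Q : 'M[C]_(r, N) := \matrix_(i, k) (e i k : C).
pose Q' : 'M[C]_(N, r) := \matrix_(k, i) Num.conj (e i k : C).
have QQ : Q *m Q' = 1%:M.
  apply/matrixP => i j; rewrite !mxE -[RHS]eo; apply: eq_bigr => k _.
  by rewrite !mxE.
by rewrite -(mxrank1 C r) -QQ (leq_trans (mxrankM_maxl _ _)) // rank_leq_col.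
Qed.

Variables (V : lmodType R[i]) (x y : 'I_N -> V).
Hypothesis Vsep : separating V.
Hypothesis xy : forall f : V -> C, is_functional f ->
  \sum_i rnorm (f (x i)) ^+ 2 <= \sum_i rnorm (f (y i)) ^+ 2.

Let ev (f : V -> C) : cpow := fun k => f (y k).

(** The size of an orthonormal family of vectors [ev g] is at most N, so a largest one exists. It
    spans every [ev f]: otherwise the normalised remainder of f would enlarge it. *)
Lemma orthonormal_functionals : exists r (g : 'I_r -> V -> C),
  [/\ forall i, is_functional (g i), orthonormal (fun i => ev (g i))
    & forall f, is_functional f -> forall k,
        f (y k) = \sum_i ph_form (ev f) (ev (g i)) * g i (y k)].
Proof.
pose P r := `[< exists g : 'I_r -> V -> C,
  (forall i, is_functional (g i)) /\ orthonormal (fun i => ev (g i)) >].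
have P0 : exists r, P r by exists 0%N; apply/asboolP; exists (fun _ _ => 0); split=> -[].
have PN r : P r -> (r <= N)%N by move=> /asboolP[g [_ /orthonormal_size]].
case: (ex_maxnP P0 PN) => r /asboolP[g [gl go]] rmax; exists r, g; split=> // f fl k.
pose d i := ph_form (ev f) (ev (g i)).
pose h v := f v - \sum_i d i * g i v.
have hl : is_functional h.
  move=> c u v; rewrite /h fl (functional_lincomb d gl); ring.
have hE : ev h = ev f + (-1) *: \sum_i d i *: ev (g i).
  apply/funext => j; rewrite scaleN1r.
  have -> : (ev f - \sum_i d i *: ev (g i)) j = ev f j - (\sum_i d i *: ev (g i)) j by [].
  by rewrite /ev /h fct_sumE; congr (_ - _).
have ho i : ph_form (ev h) (ev (g i)) = 0.
  by rewrite hE ph_formDl ph_formZl orthonormal_coord // mulN1r subrr.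
suff : h (y k) = 0 by rewrite /h => /eqP; rewrite subr_eq0 => /eqP.
apply: contrapT => hk.
have q0 : 0 < phs (ev h).
  rewrite /phs sqrtr_gt0 cpow_q (bigD1 k) //= ltr_pwDl //; last first.
    by apply: sumr_ge0 => i _; exact: sqr_ge0.
  by rewrite exprn_gt0 // lt_def rnorm_ge0 andbT; apply/eqP => /rnorm_eq0.
pose c := ((phs (ev h))^-1)%:C.
have hc : ev (fun v => c * h v) = c *: ev h by [].
suff /rmax : P r.+1 by rewrite ltnn.
apply/asboolP; exists (fun i => if unlift ord_max i is Some j then g j else fun v => c * h v).
split=> [i|i j].
  case: unliftP => [j _|_]; first exact: gl.
  by move=> a u v; rewrite hl; ring.
case: (unliftP ord_max i) => [i' ->|->]; case: (unliftP ord_max j) => [j' ->|->].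
- by rewrite go (inj_eq lift_inj).
- by rewrite hc ph_formZr ph_form_conj ho rmorph0 mulr0 eq_sym eq_liftF.
- by rewrite hc ph_formZl ho mulr0 eq_liftF.
- rewrite hc eqxx ph_formZl ph_formZr ph_form_diag -sqr_phs.
  have -> : Num.conj c = c by apply: complexP; rewrite ?ReJ ?ImJ /= ?oppr0.
  by rewrite /c -2!rmorphM expr2 mulKf ?gt_eqF // mulVf ?gt_eqF.
Qed.

(** By [xy], sending the values of f on y to its values on x is well defined and contractive on the
    space of all [ev f]. L extends this map by 0 on the orthogonal complement, and separation turns
    the identities between values into identities between vectors. *)
Lemma contraction_exists : exists L : 'M[C]_N,
  (forall z : 'cV[C]_N, l2norm (L *m z) <= l2norm z) /\
  forall k, x k = \sum_l L k l *: y l.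
Proof.
have [r [g [gl go gE]]] := orthonormal_functionals.
have gx f : is_functional f -> forall k,
    f (x k) = \sum_i ph_form (ev f) (ev (g i)) * g i (x k).
  move=> fl k; pose h v := f v - \sum_i ph_form (ev f) (ev (g i)) * g i v.
  have hl : is_functional h.
    by move=> c u v; rewrite /h fl (functional_lincomb _ gl); ring.
  have hy j : h (y j) = 0 by rewrite /h -gE // subrr.
  (* The remainder [h] vanishes on every [y j], so the inequality of squares makes it vanish on
     every [x k]. *)
  have := xy hl; rewrite [leRHS]big1 => [hx|j _]; last by rewrite hy rnorm0 expr0n.
  have : rnorm (h (x k)) ^+ 2 <= 0.
    apply: le_trans hx; rewrite (bigD1 k) //= lerDl.
    by apply: sumr_ge0 => i _; exact: sqr_ge0.
  rewrite -[leRHS](expr0n _ 2) ler_sqr ?nnegrE ?rnorm_ge0 // => hk.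
  have /rnorm_eq0/eqP : rnorm (h (x k)) = 0 by apply: le_anti; rewrite hk rnorm_ge0.
  by rewrite subr_eq0 => /eqP.
(* Orthogonal projection onto the span of the [ev (g i)], followed by the map sending [ev (g i)] to
   the values of [g i] on x. *)
exists (\matrix_(k, l) \sum_i g i (x k) * Num.conj (g i (y l))); split=> [z|k]; last first.
  apply/eqP; rewrite -subr_eq0; apply/eqP/Vsep => f fl.
  rewrite -scaleN1r functionalD // functionalZ // functional_sum // mulN1r gx //.
  apply/eqP; rewrite subr_eq0; apply/eqP.
  transitivity (\sum_i \sum_l f (y l) * (g i (x k) * Num.conj (g i (y l)))).
    apply: eq_bigr => i _; rewrite mulr_suml; apply: eq_bigr => l _.
    by rewrite /ev; ring.
  rewrite exchange_big; apply: eq_bigr => l _; rewrite functionalZ // mxE mulr_suml.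
  by apply: eq_bigr => i _; rewrite mulrC.
pose zc : cpow := fun k => z k 0.
pose d i := ph_form zc (ev (g i)).
pose f v := \sum_i d i * g i v.
have fl : is_functional f by exact: functional_lincomb.
have fx k : ((\matrix_(k, l) \sum_i g i (x k) * Num.conj (g i (y l))) *m z) k 0 = f (x k).
  rewrite mxE /f.
  transitivity (\sum_l \sum_i g i (x k) * Num.conj (g i (y l)) * z l 0).
    by apply: eq_bigr => l _; rewrite mxE mulr_suml.
  rewrite exchange_big; apply: eq_bigr => i _; rewrite mulr_suml.
  by apply: eq_bigr => l _; rewrite /zc /ev /=; ring.
have lz : l2norm z = phs zc by rewrite /phs cpow_q.
rewrite lz /l2norm; under eq_bigr do rewrite fx.
apply: ler_wsqrtr; apply: le_trans (xy fl) _.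
have <- : phq (ev f) = \sum_i rnorm (f (y i)) ^+ 2 by rewrite cpow_q.
have -> : ev f = \sum_i d i *: ev (g i).
  by apply/funext => k; rewrite /ev /f fct_sumE.
exact: orthonormal_bessel.
Qed.

End Contraction.

(* Matrices over G act on column vectors over V; the members of as_K are to
   become contractions for a semi-inner product on V. *)
Record actionSystem (R : realType) := ActionSystem {
  as_space :> lmodType R[i];
  as_gen : zmodType;
  as_act : as_gen -> as_space -> as_space;
  as_act_linear : forall g, linear (as_act g);
  as_act0 : forall v, as_act 0 v = 0;
  as_K : forall m, 'M[as_gen]_m -> Prop;
  as_K0 : as_K (0 : 'M[as_gen]_0);
  as_K_dsum : forall m p (a : 'M[as_gen]_m) (b : 'M[as_gen]_p),
    as_K a -> as_K b -> as_K (block_mx a 0 0 b);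
  as_size : nat;
  as_unit : 'I_as_size -> as_space
}.

(** * Semi-inner products from dominations *)

Section Domination.
Variables (R : realType) (S : actionSystem R).
Local Notation C := (R[i]).
Local Notation V := (as_space S).
Local Notation G := (as_gen S).
Local Notation n := (as_size S).
Local Notation e := (@as_unit R S).

Definition functional := {f : V -> C | is_functional f}.
Implicit Types (f : functional) (u w : functional -> R) (s t : R).

Definition act_mx m (a : 'M[G]_m) (v : 'I_m -> V) : 'I_m -> V :=
  fun i => \sum_k as_act (a i k) (v k).

Definition sqf m (v : 'I_m -> V) f : R := \sum_k rnorm (sval f (v k)) ^+ 2.

Lemma sqf_ge0 m (v : 'I_m -> V) f : 0 <= sqf v f.
Proof. by apply: sumr_ge0 => k _; exact: sqr_ge0. Qed.

Lemma sqf_coord m (v : 'I_m -> V) f k : rnorm (sval f (v k)) ^+ 2 <= sqf v f.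
Proof.
by rewrite /sqf (bigD1 k) //= lerDl sumr_ge0 // => i _; exact: sqr_ge0.
Qed.

Definition col_vec m p (v : 'I_m -> V) (w : 'I_p -> V) : 'I_(m + p) -> V :=
  fun i => match fintype.split i with inl j => v j | inr j => w j end.

Lemma sqf_col m p (v : 'I_m -> V) (w : 'I_p -> V) f :
  sqf (col_vec v w) f = sqf v f + sqf w f.
Proof.
rewrite /sqf big_split_ord; congr (_ + _); apply: eq_bigr => i _.
  by rewrite /col_vec (unsplitK (inl i)).
by rewrite /col_vec (unsplitK (inr i)).
Qed.

Lemma act_mx_col m p (a : 'M[G]_m) (b : 'M[G]_p) (v : 'I_m -> V) (w : 'I_p -> V) :
  act_mx (block_mx a 0 0 b) (col_vec v w) = col_vec (act_mx a v) (act_mx b w).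
Proof.
apply/funext => i; rewrite /act_mx /col_vec big_split_ord /=.
case: split_ordP => j ->.
  rewrite [X in _ + X]big1 ?addr0 => [|k _]; last by rewrite block_mxEur mxE as_act0.
  by apply: eq_bigr => k _; rewrite block_mxEul (unsplitK (inl k)).
rewrite [X in X + _]big1 ?add0r => [|k _]; last by rewrite block_mxEdl mxE as_act0.
by apply: eq_bigr => k _; rewrite block_mxEdr (unsplitK (inr k)).
Qed.

(** A certificate for an upper bound. A positive functional P that has value 1 at [sqf e] and
    satisfies P (sqf (act_mx a v)) <= P (sqf v) for all [a] in [as_K] must satisfy P u <= s.
    Hahn-Banach will produce P from the absence of contradictory certificates. *)
Definition dom s u := exists m (a : 'M[G]_m) (v : 'I_m -> V), as_K a /\
  forall f, u f + sqf v f - sqf (act_mx a v) f <= s * sqf e f.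

Lemma domD s t u w : dom s u -> dom t w -> dom (s + t) (u + w).
Proof.
move=> [m [a [v [Ka hv]]]] [p [b [x [Kb hx]]]].
exists (m + p)%N, (block_mx a 0 0 b), (col_vec v x); split; first exact: as_K_dsum.
move=> f; rewrite act_mx_col !sqf_col.
have -> : (u + w) f = u f + w f by [].
by have := hv f; have := hx f; lra.
Qed.

Lemma dom_le s u w : (forall f, u f <= w f) -> dom s w -> dom s u.
Proof.
move=> uw [m [a [v [Ka hv]]]]; exists m, a, v; split=> // f.
by have := hv f; have := uw f; lra.
Qed.

Lemma dom0 s u : (forall f, u f <= s * sqf e f) -> dom s u.
Proof.
move=> h; exists 0%N, 0, (fun _ => 0); split; first exact: as_K0.
by move=> f; rewrite /sqf !big_ord0; have := h f; rewrite /sqf; lra.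
Qed.

Lemma as_actZ g c v : @as_act R S g (c *: v) = c *: as_act g v.
Proof.
have := as_act_linear g c v 0; rewrite !addr0 => ->.
suff -> : @as_act R S g 0 = 0 by rewrite addr0.
by have := as_act_linear g (-1) 0 0; rewrite scaler0 addr0 scaleN1r addNr.
Qed.

Lemma domZ c s u : 0 <= c -> dom s u -> dom (c * s) (c *: u).
Proof.
move=> c0 [m [a [v [Ka hv]]]].
pose r : C := (Num.sqrt c)%:C.
have rZ p (x : 'I_p -> V) f : sqf (fun k => r *: x k) f = c * sqf x f.
  rewrite /sqf mulr_sumr; apply: eq_bigr => k _.
  rewrite (functionalZ _ _ (svalP f)) rnormM exprMn; congr (_ * _).
  by rewrite rnorm_real ger0_norm ?sqrtr_ge0 // sqr_sqrtr.
exists m, a, (fun k => r *: v k); split=> // f.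
have -> : act_mx a (fun k => r *: v k) = (fun k => r *: act_mx a v k).
  by apply/funext => i; rewrite /act_mx scaler_sumr; apply: eq_bigr => k _; rewrite as_actZ.
rewrite !rZ; have -> : (c *: u) f = c * u f by [].
by have := hv f; nra.
Qed.

(** A certificate for [- u] bounds the gauge of u from below, so on this subspace the gauge is a
    finite real number. *)
Definition dominated_pred : {pred (functional -> R)} :=
  [pred u : functional -> R | `[< (exists s, dom s u) /\ (exists s, dom s (- u)) >]].

Lemma dominated_submod_closed : submod_closed dominated_pred.
Proof.
split.
  apply/asboolP; split; exists 0; apply: dom0 => f; rewrite mul0r //.
  by rewrite oppr0.
move=> c u w /asboolP[[s hs] [s' hs']] /asboolP[[t ht] [t' ht']].
apply/asboolP; have [c0|c0] := leP 0 c.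
  split; first by exists (c * s + t); apply: domD => //; exact: domZ.
  exists (c * s' + t'); rewrite opprD -scalerN; apply: domD => //; exact: domZ.
have cN : 0 <= - c by rewrite oppr_ge0 ltW.
split.
  exists (- c * s' + t); rewrite -[c *: u]opprK -scaleNr -scalerN.
  by apply: domD => //; exact: domZ.
exists (- c * s + t'); rewrite opprD -scaleNr; apply: domD => //; exact: domZ.
Qed.

End Domination.

Section Dominated.
Variables (R : realType) (S : actionSystem R).

HB.instance Definition _ := GRing.isSubmodClosed.Build R (functional S -> R)
  (@dominated_pred R S) (@dominated_submod_closed R S).

Record dominated := Dominated {
  dominated_fun :> functional S -> R;
  dominatedP : dominated_fun \in @dominated_pred R S }.

HB.instance Definition _ := [isSub for dominated_fun].
HB.instance Definition _ := [Choice of dominated by <:].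
HB.instance Definition _ := [SubChoice_isSubLmodule of dominated by <:].

End Dominated.

Section DominatedForm.
Variables (R : realType) (S : actionSystem R).
Local Notation C := (R[i]).
Local Notation V := (as_space S).
Local Notation F := (functional S).
Local Notation e := (@as_unit R S).
Implicit Types (u w : F -> R) (s t : R).

(** Consistency of the certificates: the gauge is not minus infinity. The second hypothesis,
    [dom_vec], makes every square finite, and hence every product of two values. *)
Hypothesis dom_unit : ~ dom (-1) (0 : F -> R).
Hypothesis dom_vec : forall v : V, exists s, dom s (fun f : F => rnorm (sval f v) ^+ 2).

Lemma dom_ge0 s : dom s (0 : F -> R) -> 0 <= s.
Proof.
move=> h; rewrite leNgt; apply/negP => s0; apply: dom_unit.
have c0 : 0 <= - s^-1 by rewrite oppr_ge0 invr_le0 ltW.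
by have := domZ c0 h; rewrite scaler0 mulNr mulVf // lt_eqF.
Qed.

Definition gauge_set u := [set s | dom s u].
Definition gauge u : R := inf (gauge_set u).

Lemma dominatedE u : u \in @dominated_pred R S ->
  (exists s, dom s u) /\ (exists s, dom s (- u)).
Proof. by move=> /asboolP. Qed.

Lemma gauge_has_inf u : u \in @dominated_pred R S -> has_inf (gauge_set u).
Proof.
move=> /dominatedE[[s hs] [t ht]]; split; first by exists s.
exists (- t) => r /= hr; rewrite -subr_ge0 opprK.
by apply: dom_ge0; rewrite -(subrr u); exact: domD.
Qed.

Lemma gauge_le u s : u \in @dominated_pred R S -> dom s u -> gauge u <= s.
Proof. by move=> ud us; apply: ge_inf => //; exact: (gauge_has_inf ud).2. Qed.

Lemma gauge_sublinear : sublinear (fun u : dominated S => gauge u).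
Proof.
split=> [u w|t u t0].
  apply: le_infD; try exact: (gauge_has_inf (dominatedP _)).1.
  move=> s t hs ht; apply: (gauge_le (dominatedP (u + w))); exact: domD.
rewrite -ler_pdivrMl //; apply: lb_le_inf; first exact: (gauge_has_inf (dominatedP _)).1.
move=> s hs; rewrite ler_pdivrMl //.
apply: (gauge_le (dominatedP (t *: u))); exact: domZ (ltW t0) hs.
Qed.

Definition polar (v w : V) (f : F) : C := sval f v * Num.conj (sval f w).

Lemma dominated_le u w : (forall f, `|u f| <= w f) -> (exists s, dom s w) ->
  u \in @dominated_pred R S.
Proof.
move=> uw [s hs]; apply/asboolP; split; exists s; apply: dom_le hs => f.
  by apply: le_trans (uw f); exact: ler_norm.
by apply: le_trans (uw f); rewrite -normrN; exact: ler_norm.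
Qed.

Lemma polar_dominated (v w : V) (g : C -> R) : (forall z, `|g z| <= rnorm z) ->
  (fun f => g (polar v w f)) \in @dominated_pred R S.
Proof.
move=> gl; have [s hs] := dom_vec v; have [t ht] := dom_vec w.
apply: (@dominated_le _ ((fun f => rnorm (sval f v) ^+ 2) + (fun f => rnorm (sval f w) ^+ 2))).
  move=> f; apply: le_trans (gl _) _; rewrite rnormM rnorm_conj.
  have -> : ((fun f => rnorm (sval f v) ^+ 2) + (fun f => rnorm (sval f w) ^+ 2)) f
    = rnorm (sval f v) ^+ 2 + rnorm (sval f w) ^+ 2 by [].
  have := sqr_ge0 (rnorm (sval f v) - rnorm (sval f w)).
  by have := rnorm_ge0 (sval f v); have := rnorm_ge0 (sval f w); nra.
by exists (s + t); exact: domD.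
Qed.

Definition repolar (v w : V) : dominated S := Dominated (@polar_dominated v w _ (@Re_le_rnorm R)).
Definition impolar (v w : V) : dominated S := Dominated (@polar_dominated v w _ (@Im_le_rnorm R)).

Lemma dominated_ext (u w : dominated S) : (forall f, u f = w f) -> u = w.
Proof. by move=> h; apply/val_inj/funext. Qed.

(** P is a linear functional below the gauge that attains it at the square sum of w0, and p v w is P
    applied to the real and imaginary parts of f |-> f(v) conj(f(w)). Every inequality claimed for p
    is P u <= s for a certified u; the lower bound c holds because P attains the gauge. *)
Lemma form_exists m (w0 : 'I_m -> V) (c : R) :
  (forall s, 0 <= s -> dom s (sqf w0) -> c <= s) ->
  exists p : V -> V -> C,
  [/\ forall a (x y z : V), p (a *: x + y) z = a * p x z + p y z,
      forall x y : V, p x y = Num.conj (p y x),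
      forall x : V, 0 <= Re (p x x),
      forall k (a : 'M[as_gen S]_k) (v : 'I_k -> V), as_K a ->
        \sum_i Re (p (act_mx a v i) (act_mx a v i)) <= \sum_i Re (p (v i) (v i))
    & \sum_i Re (p (e i) (e i)) <= 1 /\ c <= \sum_i Re (p (w0 i) (w0 i))].
Proof.
move=> cw0; pose sqd k (v : 'I_k -> V) : dominated S := \sum_i repolar (v i) (v i).
have sqdE k (v : 'I_k -> V) f : sqd k v f = sqf v f.
  rewrite /sqd (@big_morph _ _ (fun u : dominated S => (u : F -> R) f) 0 +%R 0 +%R) //.
  apply: eq_bigr => i _; rewrite /= /polar mul_conj //.
have [P [PL Pq Pu0]] := hahn_banach (sqd m w0) gauge_sublinear.
have P0 : P 0 = 0 by have := PL (-1) 0 0; rewrite scaler0 addr0 mulN1r addNr.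
have PD (u w : dominated S) : P (u + w) = P u + P w by have := PL 1 u w; rewrite scale1r mul1r.
have PZ t (u : dominated S) : P (t *: u) = t * P u by have := PL t u 0; rewrite P0 !addr0.
have PB (u w : dominated S) : P (u - w) = P u - P w by rewrite PD -scaleN1r PZ mulN1r.
have PS k (v : 'I_k -> V) : P (sqd k v) = \sum_i P (repolar (v i) (v i)).
  by rewrite /sqd (big_morph P PD P0).
have Pdom s (u : dominated S) : dom s u -> P u <= s.
  by move=> us; apply: le_trans (Pq u) (gauge_le (dominatedP u) us).
pose p (v w : V) : C := P (repolar v w) +i* P (impolar v w).
have pS k (v : 'I_k -> V) : \sum_i Re (p (v i) (v i)) = P (sqd k v) by rewrite PS.
exists p; split=> [a u v w|u v|u|k a v Ka|].
- apply: complexP; rewrite ?ReD ?ImD ?Re_mul ?Im_mul /=.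
    rewrite -!PZ -PB -PD; congr P; apply: dominated_ext => f.
    have -> : repolar (a *: u + v) w f = Re (polar (a *: u + v) w f) by [].
    by rewrite /polar (svalP f) mulrDl -mulrA ReD Re_mul.
  rewrite -!PZ -!PD; congr P; apply: dominated_ext => f.
  have -> : impolar (a *: u + v) w f = Im (polar (a *: u + v) w f) by [].
  by rewrite /polar (svalP f) mulrDl -mulrA ImD Im_mul.
- apply: complexP; rewrite ?ReJ ?ImJ /=.
    congr P; apply: dominated_ext => f /=.
    by rewrite /polar !Re_mul !ReJ !ImJ; ring.
  rewrite -mulN1r -PZ; congr P; apply: dominated_ext => f.
  have -> : (-1 *: impolar v u) f = -1 * Im (polar v u f) by [].
  by rewrite /= /polar !Im_mul !ReJ !ImJ; ring.
- rewrite /= -oppr_le0 -mulN1r -PZ; apply: Pdom; apply: dom0 => f.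
  have -> : (-1 *: repolar u u) f = -1 * Re (polar u u f) by [].
  by rewrite mul0r mulN1r /polar mul_conj /= oppr_le0 sqr_ge0.
(* The pair (a, v) is itself a certificate, with constant 0, for the difference of the two square
   sums. *)
- rewrite !pS -subr_le0 -PB; apply: Pdom; exists k, a, v; split=> // f.
  have -> : (sqd k (act_mx a v) - sqd k v) f = sqd k (act_mx a v) f - sqd k v f by [].
  by rewrite !sqdE; lra.
- rewrite !pS; split; first by apply: Pdom; apply: dom0 => f; rewrite sqdE mul1r.
  rewrite Pu0; apply: lb_le_inf; first exact: (gauge_has_inf (dominatedP _)).1.
  move=> s hs; have {}hs : dom s (sqf w0) by apply: dom_le hs => f; rewrite sqdE.
  apply: cw0 => //; apply: dom_ge0; apply: dom_le hs => f; exact: sqf_ge0.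
Qed.

End DominatedForm.

(** * The action of a correspondence *)

Section OperatorSpaceFacts.
Variables (R : realType) (X : operatorSpace R).
Local Notation C := (R[i]).
Implicit Types (n : nat).

Lemma mxnorm0 n : mxnorm (0 : 'M[X]_n) = 0.
Proof.
have := mxnorm_scale 0 (0 : 'M[X]_n); rewrite rnorm0 mul0r => h.
by rewrite -[RHS]h; congr mxnorm; apply/matrixP => i j; rewrite !mxE scaler0.
Qed.

Lemma mxnormZ n (c : R) (x : 'M[X]_n) :
  mxnorm (map_mx ( *:%R (c%:C : C)) x) = `|c| * mxnorm x.
Proof. by rewrite mxnorm_scale rnorm_real. Qed.

Lemma mxnorm_ge0 n (x : 'M[X]_n) : 0 <= mxnorm x.
Proof.
have := mxnorm_triangle x (map_mx ( *:%R ((-1)%:C : C)) x).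
have -> : x + map_mx ( *:%R ((-1)%:C : C)) x = 0.
  by apply/matrixP => i j; rewrite !mxE rmorphN rmorph1 scaleN1r subrr.
by rewrite mxnorm0 mxnormZ normrN normr1; lra.
Qed.

Lemma l2norm_ge0 n (v : 'cV[C]_n) : 0 <= l2norm v.
Proof. exact: sqrtr_ge0. Qed.

Lemma cmxnorm_bounds n (l : 'M[C]_n) (M : R) : 0 <= M ->
  (forall v : 'cV[C]_n, l2norm (l *m v) <= M * l2norm v) -> 0 <= cmxnorm l <= M.
Proof.
move=> M0 h.
have S0 : [set l2norm (l *m v) | v in [set v : 'cV[C]_n | l2norm v <= 1]] (l2norm (l *m 0)).
  by exists 0 => //=; rewrite /l2norm big1 ?sqrtr0 // => i _; rewrite mxE rnorm0 expr0n.
have SM : ubound [set l2norm (l *m v) | v in [set v : 'cV[C]_n | l2norm v <= 1]] M.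
  by move=> _ [v /= v1 <-]; rewrite (le_trans (h v)) // -[leRHS]mulr1 ler_wpM2l.
apply/andP; split; last by apply: ge_sup => //; exists (l2norm (l *m 0)).
apply: le_trans (l2norm_ge0 (l *m 0)) _.
by apply: sup_upper_bound => //; split; [exists (l2norm (l *m 0))|exists M].
Qed.

Lemma cmxnorm1 n : 0 <= cmxnorm (1%:M : 'M[C]_n) <= 1.
Proof. by apply: cmxnorm_bounds => // v; rewrite mul1mx mul1r. Qed.

Lemma mxprodZ1 n (x : 'M[X]_n) : mxprod (fun (y : X) (c : C) => c *: y) x 1%:M = x.
Proof.
apply/matrixP => i j; rewrite mxE (bigD1 j) //= mxE eqxx scale1r big1 ?addr0 // => k kj.
by rewrite mxE (negbTE kj) scale0r.
Qed.

Lemma mxprod1Z n (x : 'M[X]_n) : mxprod *:%R (1%:M : 'M[C]_n) x = x.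
Proof.
apply/matrixP => i j; rewrite mxE (bigD1 i) //= mxE eqxx scale1r big1 ?addr0 // => k ki.
by rewrite mxE eq_sym (negbTE ki) scale0r.
Qed.

Lemma mxnorm_lmulC n (l : 'M[C]_n) (x : 'M[X]_n) (M : R) : 0 <= M ->
  (forall v : 'cV[C]_n, l2norm (l *m v) <= M * l2norm v) ->
  mxnorm (mxprod *:%R l x) <= M * mxnorm x.
Proof.
move=> M0 lM; have := mxnorm_bimodule l 1%:M x; rewrite mxprodZ1 => /le_trans; apply.
have /andP[l0 lM'] := cmxnorm_bounds M0 lM; have /andP[u0 u1] := cmxnorm1 n.
rewrite -[leRHS]mulr1 ler_pM ?mulr_ge0 ?mxnorm_ge0 //.
by rewrite ler_wpM2r ?mxnorm_ge0.
Qed.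

Lemma mxnorm_rmulC n (l : 'M[C]_n) (x : 'M[X]_n) (M : R) : 0 <= M ->
  (forall v : 'cV[C]_n, l2norm (l *m v) <= M * l2norm v) ->
  mxnorm (mxprod (fun (y : X) (c : C) => c *: y) x l) <= mxnorm x * M.
Proof.
move=> M0 lM; have := mxnorm_bimodule 1%:M l x; rewrite mxprod1Z => /le_trans; apply.
have /andP[l0 lM'] := cmxnorm_bounds M0 lM; have /andP[u0 u1] := cmxnorm1 n.
rewrite ler_pM ?mulr_ge0 ?mxnorm_ge0 //.
by rewrite -[leRHS]mul1r ler_wpM2r ?mxnorm_ge0.
Qed.

Lemma mxnorm_block_ul m n (x : 'M[X]_m) : mxnorm (block_mx x 0 0 (0 : 'M[X]_n)) = mxnorm x.
Proof. by rewrite mxnorm_dsum mxnorm0; apply/max_idPl; exact: mxnorm_ge0. Qed.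

End OperatorSpaceFacts.

Section CorrespondenceModule.
Variables (R : realType) (A B : operatorStarAlgebra R) (X : operatorStarCorrespondence A B).
Local Notation C := (R[i]).

(* The correspondence acts on Z = C + A + B + X; the scalar summand is a unit
   adjoined simultaneously to A and B, from which A, B and X are recovered. *)
Definition zspace : lmodType C := (C^o * A * B * X)%type.
(** Only an additive group is asked of the generators, since the last component acts
    antilinearly. *)
Definition zgen : zmodType := (A * B * X * X)%type.

Definition zc (z : zspace) : C := z.1.1.1.
Definition za (z : zspace) : A := z.1.1.2.
Definition zb (z : zspace) : B := z.1.2.
Definition zx (z : zspace) : X := z.2.
Definition ga (g : zgen) : A := g.1.1.1.
Definition gb (g : zgen) : B := g.1.1.2.
Definition gx (g : zgen) : X := g.1.2.
Definition gy (g : zgen) : X := g.2.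

Definition zmk (c : C) (a : A) (b : B) (x : X) : zspace := (c : C^o, a, b, x).
Definition gmk (a : A) (b : B) (x y : X) : zgen := (a, b, x, y).

(** On the components in [B] and [X] this is the linking matrix with rows (b, <y, .>) and (x, a)
    acting on columns. The summand [A] carries the regular action of a, and the scalar c adds c
    times the generator, as an adjoined unit does. *)
Definition zact (g : zgen) (z : zspace) : zspace :=
  zmk 0 (zc z *: ga g + amul (ga g) (za z))
        (zc z *: gb g + amul (gb g) (zb z) + pairing (gy g) (zx z))
        (lact X (ga g) (zx z) + (zc z *: gx g + ract (gx g) (zb z))).

Lemma z_ext (z w : zspace) :
  zc z = zc w -> za z = za w -> zb z = zb w -> zx z = zx w -> z = w.
Proof.
by case: z => [[[c a] b] x]; case: w => [[[c' a'] b'] x'];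
  rewrite /zc /za /zb /zx /= => -> -> -> ->.
Qed.

Lemma linear_map0 (U W : lmodType C) (f : U -> W) : linear f -> f 0 = 0.
Proof. by move=> fl; have := fl (-1) 0 0; rewrite scaler0 addr0 scaleN1r addNr. Qed.

Lemma linear_mapD (U W : lmodType C) (f : U -> W) u v : linear f -> f (u + v) = f u + f v.
Proof. by move=> fl; have := fl 1 u v; rewrite !scale1r. Qed.

Lemma linear_mapZ (U W : lmodType C) (f : U -> W) c u : linear f -> f (c *: u) = c *: f u.
Proof. by move=> fl; have := fl c u 0; rewrite (linear_map0 fl) !addr0. Qed.

Lemma zc_lin c z w : zc (c *: z + w) = c * zc z + zc w. Proof. by []. Qed.
Lemma za_lin c z w : za (c *: z + w) = c *: za z + za w. Proof. by []. Qed.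
Lemma zb_lin c z w : zb (c *: z + w) = c *: zb z + zb w. Proof. by []. Qed.
Lemma zx_lin c z w : zx (c *: z + w) = c *: zx z + zx w. Proof. by []. Qed.

Lemma zact_c g z : zc (zact g z) = 0. Proof. by []. Qed.
Lemma zact_a g z : za (zact g z) = zc z *: ga g + amul (ga g) (za z). Proof. by []. Qed.
Lemma zact_b g z :
  zb (zact g z) = zc z *: gb g + amul (gb g) (zb z) + pairing (gy g) (zx z).
Proof. by []. Qed.
Lemma zact_x g z :
  zx (zact g z) = lact X (ga g) (zx z) + (zc z *: gx g + ract (gx g) (zb z)).
Proof. by []. Qed.

Lemma pairing0l (y : X) : pairing (0 : X) y = 0.
Proof.
rewrite pairing_dagger (linear_map0 (pairing_linearr y)).
by have := daggerZ 0 (0 : B); rewrite rmorph0 !scale0r.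
Qed.

Lemma pairingDl (x y z : X) : pairing (x + y) z = pairing x z + pairing y z.
Proof.
rewrite pairing_dagger (linear_mapD _ _ (pairing_linearr z)) daggerD.
by rewrite -!pairing_dagger.
Qed.

Lemma pairingZl c (x z : X) : pairing (c *: x) z = Num.conj c *: pairing x z.
Proof.
by rewrite pairing_dagger (linear_mapZ _ _ (pairing_linearr z)) daggerZ -pairing_dagger.
Qed.

Lemma zact0 z : zact 0 z = 0.
Proof.
apply: z_ext; rewrite ?(zact_c, zact_a, zact_b, zact_x) //.
- rewrite [zc z *: _]scaler0 [amul _ _](linear_map0 (amul_linearl _)).
  exact: addr0.
- rewrite [zc z *: _]scaler0 [amul _ _](linear_map0 (amul_linearl _)) [pairing _ _]pairing0l.
  by rewrite !addr0.
- rewrite [lact X _ _](linear_map0 (lom_act_linearl (lact X) _)) [zc z *: _]scaler0.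
  by rewrite [ract _ _](linear_map0 (ract_linearl _)) !addr0.
Qed.

Lemma zact_linear g : linear (zact g).
Proof.
move=> c z w; apply: z_ext.
- by rewrite zc_lin !zact_c mulr0 addr0.
- rewrite za_lin !zact_a zc_lin za_lin amul_linearr scalerDl scalerDr scalerA; exact: addrACA.
- rewrite zb_lin !zact_b zc_lin zb_lin zx_lin amul_linearr pairing_linearr scalerDl !scalerDr
    scalerA.
  by rewrite [in RHS]addrACA; congr (_ + _); exact: addrACA.
- rewrite zx_lin !zact_x zc_lin zb_lin zx_lin lom_act_linearr ract_linearr scalerDl !scalerDr
    scalerA.
  by rewrite [in RHS]addrACA; congr (_ + _); exact: addrACA.
Qed.

(** The scalar is real so that the antilinear last component scales like the others. *)
Lemma zactZ (t : R) g z :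
  zact (gmk ((t%:C : C) *: ga g) ((t%:C : C) *: gb g) ((t%:C : C) *: gx g) ((t%:C : C) *: gy g)) z
  = (t%:C : C) *: zact g z.
Proof.
have tc : Num.conj (t%:C : C) = t%:C by apply: complexP; rewrite ?ReJ ?ImJ /= ?oppr0.
rewrite -[RHS]addr0; apply: z_ext.
- by rewrite zc_lin !zact_c mulr0 addr0.
- rewrite za_lin !zact_a (linear_mapZ _ _ (amul_linearl _)) scalerDr [RHS]addr0.
  by congr (_ + _); rewrite !scalerA mulrC.
- rewrite zb_lin !zact_b (linear_mapZ _ _ (amul_linearl _)) pairingZl tc !scalerDr [RHS]addr0.
  by congr (_ + _ + _); rewrite !scalerA mulrC.
- rewrite zx_lin !zact_x (linear_mapZ _ _ (lom_act_linearl (lact X) _)).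
  rewrite (linear_mapZ _ _ (ract_linearl _)) !scalerDr [RHS]addr0.
  by congr (_ + (_ + _)); rewrite !scalerA mulrC.
Qed.

End CorrespondenceModule.

(** * The a priori estimate for the transfer equation *)

Section Estimate.
Variables (R : realType) (A B : operatorStarAlgebra R) (X : operatorStarCorrespondence A B).
Local Notation C := (R[i]).
Local Notation Z := (zspace X).
Local Notation G := (zgen X).

(** The last norm is that of the transpose because [mxnorm_pairing] transposes its left factor. *)
Definition zcontr m (a : 'M[G]_m) : Prop :=
  [/\ mxnorm (map_mx (@ga _ _ _ X) a) <= 8^-1,
      mxnorm (map_mx (@gb _ _ _ X) a) <= 8^-1,
      mxnorm (map_mx (@gx _ _ _ X) a) <= 8^-1
    & mxnorm (map_mx (@gy _ _ _ X) a)^T <= 8^-1].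

Definition l2contr n (L : 'M[C]_n) (M : R) :=
  forall v : 'cV[C]_n, l2norm (L *m v) <= M * l2norm v.

Lemma za0 : za (0 : Z) = 0. Proof. by []. Qed.
Lemma zb0 : zb (0 : Z) = 0. Proof. by []. Qed.
Lemma zx0 : zx (0 : Z) = 0. Proof. by []. Qed.
Lemma zaD (z w : Z) : za (z + w) = za z + za w. Proof. by []. Qed.
Lemma zbD (z w : Z) : zb (z + w) = zb z + zb w. Proof. by []. Qed.
Lemma zxD (z w : Z) : zx (z + w) = zx z + zx w. Proof. by []. Qed.

Lemma map_lmulC (T : lmodType C) (h : Z -> T) n (L : 'M[C]_n) (Y : 'M[Z]_n) : linear h ->
  map_mx h (mxprod *:%R L Y) = mxprod *:%R L (map_mx h Y).
Proof.
move=> hl; apply/matrixP => i j; rewrite !mxE.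
rewrite (big_morph h (fun u v => linear_mapD u v hl) (linear_map0 hl)).
by apply: eq_bigr => k _; rewrite mxE (linear_mapZ _ _ hl).
Qed.

Lemma map_linear_mxD (T : lmodType C) (h : Z -> T) n (P Q : 'M[Z]_n) : linear h ->
  map_mx h (P + Q) = map_mx h P + map_mx h Q.
Proof. by move=> hl; apply/matrixP => i j; rewrite !mxE (linear_mapD _ _ hl). Qed.

Section Components.
Variables (n : nat) (a : 'M[G]_n) (U : 'M[Z]_n).

Lemma map_za_act : map_mx (@za _ _ _ X) (mxprod (@zact _ _ _ X) a U) =
  mxprod (fun (y : A) (c : C) => c *: y) (map_mx (@ga _ _ _ X) a) (map_mx (@zc _ _ _ X) U)
  + mxprod (@amul R A) (map_mx (@ga _ _ _ X) a) (map_mx (@za _ _ _ X) U).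
Proof.
apply/matrixP => i j; rewrite !mxE (big_morph _ zaD za0) -big_split.
by apply: eq_bigr => k _; rewrite !mxE zact_a.
Qed.

Lemma map_zb_act : map_mx (@zb _ _ _ X) (mxprod (@zact _ _ _ X) a U) =
  mxprod (fun (y : B) (c : C) => c *: y) (map_mx (@gb _ _ _ X) a) (map_mx (@zc _ _ _ X) U)
  + mxprod (@amul R B) (map_mx (@gb _ _ _ X) a) (map_mx (@zb _ _ _ X) U)
  + mxprod (@pairing R B X) (map_mx (@gy _ _ _ X) a)^T^T (map_mx (@zx _ _ _ X) U).
Proof.
apply/matrixP => i j; rewrite trmxK !mxE (big_morph _ zbD zb0) -!big_split.
by apply: eq_bigr => k _; rewrite !mxE zact_b.
Qed.

Lemma map_zx_act : map_mx (@zx _ _ _ X) (mxprod (@zact _ _ _ X) a U) =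
  mxprod (lact X) (map_mx (@ga _ _ _ X) a) (map_mx (@zx _ _ _ X) U)
  + (mxprod (fun (y : X) (c : C) => c *: y) (map_mx (@gx _ _ _ X) a) (map_mx (@zc _ _ _ X) U)
  + mxprod (@ract R B X) (map_mx (@gx _ _ _ X) a) (map_mx (@zb _ _ _ X) U)).
Proof.
apply/matrixP => i j; rewrite !mxE (big_morph _ zxD zx0) -!big_split.
by apply: eq_bigr => k _; rewrite !mxE zact_x.
Qed.

End Components.

(* The system U = L (E + a U) is solved by a Neumann series; since the entries of
   a have norm at most 1/8, an a priori bound on U replaces its summation. *)
Lemma transfer_estimate n (a : 'M[G]_n) (L : 'M[C]_n) (E U : 'M[Z]_n) (s : R) :
  0 <= s -> zcontr a -> l2contr L 1 -> l2contr (map_mx (@zc _ _ _ X) E) s ->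
  map_mx (@za _ _ _ X) E = 0 -> map_mx (@zb _ _ _ X) E = 0 -> map_mx (@zx _ _ _ X) E = 0 ->
  U = mxprod *:%R L (E + mxprod (@zact _ _ _ X) a U) ->
  [/\ map_mx (@zc _ _ _ X) U = L *m map_mx (@zc _ _ _ X) E,
      mxnorm (map_mx (@za _ _ _ X) U) <= s,
      mxnorm (map_mx (@zb _ _ _ X) U) <= s
    & mxnorm (map_mx (@zx _ _ _ X) U) <= s].
Proof.
move=> s0 [a8 b8 x8 y8] L1 Es Ea Eb Ex UE.
have cE : map_mx (@zc _ _ _ X) U = L *m map_mx (@zc _ _ _ X) E.
  rewrite {1}UE; apply/matrixP => i j; rewrite !mxE.
  rewrite (@big_morph _ _ (@zc _ _ _ X) 0 +%R 0 +%R) //; apply: eq_bigr => k _.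
  rewrite !mxE; transitivity (L i k * zc (E k j + \sum_k0 zact (a k k0) (U k0 j))) => //.
  have -> : zc (E k j + \sum_k0 zact (a k k0) (U k0 j))
    = zc (E k j) + zc (\sum_k0 zact (a k k0) (U k0 j)) by [].
  by rewrite (@big_morph _ _ (@zc _ _ _ X) 0 +%R 0 +%R) // big1 ?addr0.
(* The action has no scalar component, so the scalars of U are known exactly and do not enter the
   feedback. *)
have cs : l2contr (map_mx (@zc _ _ _ X) U) s.
  move=> v; rewrite cE -mulmxA; apply: le_trans (L1 _) _; rewrite mul1r; exact: Es.
have bound (T : operatorSpace R) (h : Z -> T) : linear h -> map_mx h E = 0 ->
    mxnorm (map_mx h U) <= mxnorm (map_mx h (mxprod (@zact _ _ _ X) a U)).
  move=> hl hE; rewrite {1}UE map_lmulC //.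
  apply: le_trans (mxnorm_lmulC _ ler01 L1) _; rewrite mul1r.
  suff -> : map_mx h (E + mxprod (@zact _ _ _ X) a U)
    = map_mx h (mxprod (@zact _ _ _ X) a U) by [].
  by rewrite map_linear_mxD // hE add0r.
have := bound A _ (@za_lin _ _ _ X) Ea; rewrite map_za_act => hA.
have := bound B _ (@zb_lin _ _ _ X) Eb; rewrite map_zb_act => hB.
have := bound X _ (@zx_lin _ _ _ X) Ex; rewrite map_zx_act => hX.
have {}hA := le_trans hA (mxnorm_triangle _ _).
have {}hB := le_trans hB (le_trans (mxnorm_triangle _ _) (lerD (mxnorm_triangle _ _) (lexx _))).
have {}hX := le_trans hX (le_trans (mxnorm_triangle _ _) (lerD (lexx _) (mxnorm_triangle _ _))).
have A1 := mxnorm_rmulC (map_mx (@ga _ _ _ X) a) s0 cs.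
have A2 := mxnorm_amul (map_mx (@ga _ _ _ X) a) (map_mx (@za _ _ _ X) U).
have B1 := mxnorm_rmulC (map_mx (@gb _ _ _ X) a) s0 cs.
have B2 := mxnorm_amul (map_mx (@gb _ _ _ X) a) (map_mx (@zb _ _ _ X) U).
have B3 := mxnorm_pairing (map_mx (@gy _ _ _ X) a)^T (map_mx (@zx _ _ _ X) U).
have X1 := mxnorm_lom_act (lact X) (map_mx (@ga _ _ _ X) a) (map_mx (@zx _ _ _ X) U).
have X2 := mxnorm_rmulC (map_mx (@gx _ _ _ X) a) s0 cs.
have X3 := mxnorm_ract (map_mx (@gx _ _ _ X) a) (map_mx (@zb _ _ _ X) U).
move: hA hB hX A1 A2 B1 B2 B3 X1 X2 X3 a8 b8 x8 y8.
have := mxnorm_ge0 (map_mx (@za _ _ _ X) U).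
have := mxnorm_ge0 (map_mx (@zb _ _ _ X) U).
have := mxnorm_ge0 (map_mx (@zx _ _ _ X) U).
set al := mxnorm (map_mx (@za _ _ _ X) U).
set be := mxnorm (map_mx (@zb _ _ _ X) U).
set xi := mxnorm (map_mx (@zx _ _ _ X) U).
set na := mxnorm (map_mx (@ga _ _ _ X) a).
set nb := mxnorm (map_mx (@gb _ _ _ X) a).
set nx := mxnorm (map_mx (@gx _ _ _ X) a).
set ny := mxnorm (map_mx (@gy _ _ _ X) a)^T.
move: al be xi na nb nx ny => al be xi na nb nx ny.
do 8!(set t := mxnorm (mxprod _ _ _); move: t => ?).
move=> xi0 be0 al0 hA hB hX A1 A2 B1 B2 B3 X1 X2 X3 a8 b8 x8 y8.
have e1 : na * s <= 8^-1 * s by rewrite ler_wpM2r.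
have e2 : na * al <= 8^-1 * al by rewrite ler_wpM2r.
have e3 : nb * s <= 8^-1 * s by rewrite ler_wpM2r.
have e4 : nb * be <= 8^-1 * be by rewrite ler_wpM2r.
have e5 : ny * xi <= 8^-1 * xi by rewrite ler_wpM2r.
have e6 : na * xi <= 8^-1 * xi by rewrite ler_wpM2r.
have e7 : nx * s <= 8^-1 * s by rewrite ler_wpM2r.
have e8 : nx * be <= 8^-1 * be by rewrite ler_wpM2r.
(* The bounds read 8 al <= s + al, 8 be <= s + be + xi and 8 xi <= s + be + xi. Adding the last two
   gives be + xi <= s / 3, and the first gives al <= s / 7. *)
by split=> //; lra.
Qed.

End Estimate.

(** * The semi-inner product of a given triple of matrices *)

Section CorrespondenceForm.
Variables (R : realType) (A B : operatorStarAlgebra R) (X : operatorStarCorrespondence A B).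
Local Notation C := (R[i]).
Local Notation Z := (zspace X).
Local Notation G := (zgen X).
Variable N : nat.
Local Notation n := N.+1.
Local Notation V := ('I_n -> Z).

Definition vact (g : G) (v : V) : V := fun i => zact g (v i).

Lemma vact_linear g : linear (vact g : V -> V).
Proof. by move=> c u v; apply/funext => i; exact: zact_linear. Qed.

Lemma vact0 v : vact 0 v = 0.
Proof. by apply/funext => i; exact: zact0. Qed.

Lemma mxnorm_M0 (T : operatorSpace R) (x : 'M[T]_0) : mxnorm x <= 8^-1.
Proof. by rewrite (flatmx0 x) mxnorm0 invr_ge0. Qed.

Lemma zcontr_M0 : zcontr (0 : 'M[G]_0).
Proof. by split; exact: mxnorm_M0. Qed.

Lemma mxnorm_map_dsum (T : operatorSpace R) (h : G -> T) m p (a : 'M[G]_m) (b : 'M[G]_p) :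
  h 0 = 0 -> mxnorm (map_mx h (block_mx a 0 0 b))
    = Num.max (mxnorm (map_mx h a)) (mxnorm (map_mx h b)).
Proof.
move=> h0; rewrite map_block_mx.
have z k l : map_mx h (0 : 'M[G]_(k, l)) = 0 by apply/matrixP => i j; rewrite !mxE.
by rewrite !z mxnorm_dsum.
Qed.

Lemma zcontr_dsum m p (a : 'M[G]_m) (b : 'M[G]_p) :
  zcontr a -> zcontr b -> zcontr (block_mx a 0 0 b).
Proof.
move=> [a1 a2 a3 a4] [b1 b2 b3 b4]; split; rewrite ?mxnorm_map_dsum ?ge_max ?a1 ?a2 ?a3 //.
rewrite map_block_mx tr_block_mx.
have z k l : (map_mx (@gy _ _ _ X) (0 : 'M[G]_(k, l)))^T = 0 by apply/matrixP => i j;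
  rewrite !mxE.
by rewrite !z mxnorm_dsum ge_max a4 b4.
Qed.

Definition vunit (k : 'I_n) : V := fun i => if i == k then zmk 1 0 0 0 else 0.

Definition corrSystem : actionSystem R :=
  @ActionSystem R (V : lmodType C) G vact vact_linear vact0 (@zcontr R A B X) zcontr_M0
    zcontr_dsum n vunit.

Lemma zspace_separating : separating Z.
Proof.
move=> z hz; apply: z_ext.
- by apply: (hz (@zc _ _ _ X)) => c u v.
- by apply: normed_separating => f fl; apply: (hz (fun w => f (za w))) => c u v; rewrite -fl.
- by apply: normed_separating => f fl; apply: (hz (fun w => f (zb w))) => c u v; rewrite -fl.
- by apply: normed_separating => f fl; apply: (hz (fun w => f (zx w))) => c u v; rewrite -fl.
Qed.

Lemma V_separating : separating (V : lmodType C).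
Proof.
move=> v hv; apply/funext => i; apply: zspace_separating => f fl.
by apply: (hv (fun w => f (w i))) => c u w; exact: fl.
Qed.

Local Notation S := corrSystem.

(** Norms exist for square matrices only, so the n + m vectors of Z^n become rows padded by m zero
    columns. *)
Definition vmx m (u : 'I_(n + m) -> S) : 'M[Z]_(n + m) :=
  \matrix_(i, j) match fintype.split j with inl k => (u i : V) k | inr _ => 0 end.

(** The certificate says that the squares of (w, v) are below those of (sqrt s e, a v). The
    contraction L implementing this gives U = L (E + a U), with E made of sqrt s times the units,
    and the a priori estimate applies. The scalar part of U is recorded because it yields the
    contradiction in the case s = 0. *)
Lemma dom_transfer m (a : 'M[as_gen S]_m) (v : 'I_m -> S) (w : 'I_n -> S) (s : R) : 0 <= s ->
  as_K a ->
  (forall f : functional S, sqf w f + sqf v f - sqf (act_mx a v) f <= s * sqf (@as_unit R S) f) ->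
  let U := vmx (col_vec w v) in
  exists E : 'M[Z]_(n + m),
  [/\ exists2 L, l2contr L 1 & map_mx (@zc _ _ _ X) U = L *m map_mx (@zc _ _ _ X) E,
      s = 0 -> map_mx (@zc _ _ _ X) E = 0,
      mxnorm (map_mx (@za _ _ _ X) U) <= Num.sqrt s,
      mxnorm (map_mx (@zb _ _ _ X) U) <= Num.sqrt s
    & mxnorm (map_mx (@zx _ _ _ X) U) <= Num.sqrt s].
Proof.
move=> s0 az hdom U.
pose r : C := (Num.sqrt s)%:C.
pose e' (k : 'I_n) : S := r *: @as_unit R S k.
pose x : 'I_(n + m) -> S := col_vec w v.
pose y : 'I_(n + m) -> S := col_vec e' (act_mx a v).
have xy (f : S -> C) : is_functional f ->
    \sum_i rnorm (f (x i)) ^+ 2 <= \sum_i rnorm (f (y i)) ^+ 2.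
  move=> fl; pose f' : functional S := exist _ f fl.
  rewrite -/(sqf x f') -/(sqf y f') !sqf_col.
  have -> : sqf e' f' = s * sqf (@as_unit R S) f'.
    rewrite mulr_sumr; apply: eq_bigr => k _.
    have -> : sval f' (e' k) = r * sval f' (@as_unit R S k) by exact: functionalZ.
    by rewrite rnormM exprMn rnorm_real ger0_norm ?sqrtr_ge0 // sqr_sqrtr.
  by have := hdom f'; lra.
have [L [L1 xL]] := contraction_exists V_separating xy.
(* Padding by 0 lets [a] act on the v-part of (w, v) only; the first n vectors of y come from E. *)
pose ah : 'M[as_gen S]_(n + m) := block_mx 0 0 0 a.
have ahz : zcontr (ah : 'M[G]_(n + m)).
  have z0 (T : operatorSpace R) (h : G -> T) : h 0 = 0 -> mxnorm (map_mx h (0 : 'M[G]_n)) <= 8^-1.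
    move=> h0; have -> : map_mx h (0 : 'M[G]_n) = 0 by apply/matrixP => i j; rewrite !mxE.
    by rewrite mxnorm0 invr_ge0.
  apply: zcontr_dsum => //; split; try exact: z0.
  have -> : (map_mx (@gy _ _ _ X) (0 : 'M[G]_n))^T = 0 by apply/matrixP => i j; rewrite !mxE.
  by rewrite mxnorm0 invr_ge0.
pose E : 'M[Z]_(n + m) := vmx (col_vec e' (fun _ : 'I_m => 0)).
have yE l : y l = col_vec e' (fun=> 0 : S) l + act_mx ah x l.
  rewrite [act_mx ah x](act_mx_col 0 a w v) /y /col_vec; case: fintype.split => k; last
    by rewrite add0r.
  rewrite [act_mx 0 w k]big1 ?addr0 // => k' _; rewrite mxE; exact: as_act0.
have UE : U = mxprod *:%R L (E + mxprod (@zact _ _ _ X) ah U).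
  apply/matrixP => i j; rewrite [RHS]mxE.
  under eq_bigr do rewrite mxE.
  rewrite [LHS]mxE -/x; case jk : (fintype.split j) => [k|k].
    transitivity (\sum_l (L i l *: y l : V) k).
      by rewrite xL fct_sumE.
    apply: eq_bigr => l _; rewrite yE; congr (L i l *: _).
    transitivity ((col_vec e' (fun=> 0 : S) l : V) k + (act_mx ah x l : V) k); first by [].
    congr (_ + _); first by rewrite mxE jk.
    rewrite [RHS]mxE /act_mx fct_sumE; apply: eq_bigr => k' _.
    by rewrite [U k' j]mxE jk.
  rewrite big1 // => l _; rewrite [E l j]mxE jk add0r mxE big1 ?scaler0 // => k' _.
  rewrite [U k' j]mxE jk; exact: (linear_map0 (zact_linear _)).
have Ec i j : map_mx (@zc _ _ _ X) E i j =
    if (val i == val j) && (val i < n)%N then r else 0.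
  rewrite !mxE; case: (fintype.split_ordP j) => k jk; last first.
    by rewrite jk /=; case: eqP => //= ->; rewrite ltnNge leq_addr.
  rewrite /col_vec; case: (fintype.split_ordP i) => l il; last first.
    by rewrite andbF.
  rewrite andbT il jk /=.
  have -> : zc ((e' l : V) k) = r * zc (vunit l k) by [].
  rewrite /vunit; have [->|kl] := eqVneq k l; first by rewrite eqxx; exact: (mulr1 r).
  have -> : (l == k :> nat) = false by rewrite eq_sym; exact: negbTE kl.
  exact: (mulr0 r).
have Es : l2contr (map_mx (@zc _ _ _ X) E) (Num.sqrt s).
  move=> z; rewrite /l2norm -sqrtrM //; apply: ler_wsqrtr; rewrite mulr_sumr ler_sum // => i _.
  have -> : (map_mx (@zc _ _ _ X) E *m z) i 0 = if (val i < n)%N then r * z i 0 else 0.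
    rewrite mxE (bigD1 i) //= Ec eqxx /= big1 ?addr0 => [|j ji].
      by case: ifP; rewrite ?mul0r.
    by rewrite Ec eq_sym (inj_eq val_inj) (negbTE ji) mul0r.
  case: ifP => _; last by rewrite rnorm0 expr0n mulr_ge0 ?sqr_ge0.
  by rewrite rnormM exprMn rnorm_real ger0_norm ?sqrtr_ge0 // sqr_sqrtr.
have E0 (T : lmodType C) (h : Z -> T) : linear h -> (forall c, h (zmk c 0 0 0) = 0) ->
  map_mx h E = 0.
  move=> hl hc; apply/matrixP => i j; rewrite !mxE.
  case: fintype.split => k; last exact: linear_map0.
  rewrite /col_vec; case: fintype.split => l; last exact: linear_map0.
  have -> : (e' l : V) k = r *: vunit l k by [].
  rewrite (linear_mapZ _ _ hl) /vunit; case: eqP => _; first by rewrite hc scaler0.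
  by rewrite (linear_map0 hl) scaler0.
have L1' : l2contr L 1 by move=> z; rewrite mul1r.
have [h1 h2 h3 h4] := transfer_estimate (sqrtr_ge0 s) ahz L1' Es
  (E0 _ _ (@za_lin _ _ _ X) (fun=> erefl))
  (E0 _ _ (@zb_lin _ _ _ X) (fun=> erefl)) (E0 _ _ (@zx_lin _ _ _ X) (fun=> erefl)) UE.
exists E; split=> //; first by exists L.
move=> s00; apply/matrixP => i j; rewrite Ec mxE; case: ifP => // _.
by rewrite /r s00 sqrtr0.
Qed.

(** The lower rows of U may be nonzero. Multiplying on the left by the projection D onto the first n
    rows removes them and leaves P padded by zeros. *)
Lemma mxnorm_corner (T : operatorSpace R) m (P : 'M[T]_n) (U : 'M[T]_(n + m)) :
  (forall i j, U (lshift m i) (lshift m j) = P i j) ->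
  (forall i j, U (lshift m i) (rshift n j) = 0) -> mxnorm P <= mxnorm U.
Proof.
move=> UP U0; pose D : 'M[C]_(n + m) := \matrix_(i, j) ((i == j) && (val i < n)%N)%:R.
have D1 : l2contr D 1.
  move=> z; rewrite mul1r; apply: ler_wsqrtr; rewrite ler_sum // => i _.
  have -> : (D *m z) i 0 = if (val i < n)%N then z i 0 else 0.
    rewrite mxE (bigD1 i) //= big1 ?addr0 => [|j ji].
      by rewrite mxE eqxx /=; case: ifP; rewrite ?mul1r ?mul0r.
    by rewrite mxE eq_sym (negbTE ji) mul0r.
  by case: ifP => // _; rewrite rnorm0 expr0n sqr_ge0.
have := mxnorm_lmulC U ler01 D1; rewrite mul1r; apply: le_trans.
rewrite -(mxnorm_block_ul m P); suff -> : block_mx P 0 0 0 = mxprod *:%R D U by [].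
apply/matrixP => i j; rewrite [RHS]mxE (bigD1 i) //= big1 => [|k ki]; last first.
  by rewrite mxE eq_sym (negbTE ki) scale0r.
rewrite addr0 [D i i]mxE eqxx /=; case: (fintype.split_ordP i) => k ->; last first.
  case: (fintype.split_ordP j) => l ->; first by rewrite block_mxEdl mxE scale0r.
  by rewrite block_mxEdr mxE scale0r.
rewrite scale1r; case: (fintype.split_ordP j) => l ->.
  by rewrite block_mxEul UP.
by rewrite block_mxEur mxE U0.
Qed.

(** The i-th vector obtained by applying the given matrix of generators to the column of units
    [vunit]. *)
Definition ztarget (a0 : 'M[A]_n) (b0 : 'M[B]_n) (x0 : 'M[X]_n) (i : 'I_n) : S :=
  (fun j => zmk 0 (a0 i j) (b0 i j) (x0 i j)) : V.

Lemma ztarget_bound a0 b0 x0 s : 0 <= s -> dom s (sqf (ztarget a0 b0 x0)) ->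
  [/\ mxnorm a0 ^+ 2 <= s, mxnorm b0 ^+ 2 <= s & mxnorm x0 ^+ 2 <= s].
Proof.
move=> s0 [m [a [v [Ka hdom]]]].
have [E [_ _ hA hB hX]] := dom_transfer s0 Ka hdom.
have key (T : operatorSpace R) (P : 'M[T]_n) (h : Z -> T) : linear h ->
    (forall i j, h ((ztarget a0 b0 x0 i : V) j) = P i j) ->
    mxnorm (map_mx h (vmx (col_vec (ztarget a0 b0 x0) v))) <= Num.sqrt s ->
    mxnorm P ^+ 2 <= s.
  move=> hl hP hs; rewrite -[leRHS]sqr_sqrtr // ler_sqr ?nnegrE ?sqrtr_ge0 ?mxnorm_ge0 //.
  apply: le_trans hs; apply: mxnorm_corner => i j; rewrite !mxE.
    by rewrite (unsplitK (inl j)) /col_vec (unsplitK (inl i)) hP.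
  by rewrite (unsplitK (inr j)) linear_map0.
by split; [apply: key hA|apply: key hB|apply: key hX].
Qed.

(** Such a certificate would dominate the units themselves with constant 0. The transfer then gives
    them scalar part L 0 = 0, although it is the identity. *)
Lemma corr_dom_unit : ~ dom (-1) (0 : functional S -> R).
Proof.
move=> [m [a [v [Ka hdom]]]].
have hdom' (f : functional S) : sqf (@as_unit R S) f + sqf v f - sqf (act_mx a v) f
    <= 0 * sqf (@as_unit R S) f.
  have := hdom f; have -> : (0 : functional S -> R) f = 0 by [].
  lra.
have [E [[L _ UE] E0 _ _ _]] := dom_transfer (lexx 0) Ka hdom'.
have := congr1 (fun M : 'M[C]_(n + m) => M (lshift m 0) (lshift m 0)) UE.
rewrite (E0 erefl) mulmx0 !mxE (unsplitK (inl (0 : 'I_n))) /col_vec (unsplitK (inl (0 : 'I_n))).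
by move=> /eqP; rewrite (oner_eq0 C).
Qed.

Lemma corr_dom_act g k : exists s, dom s
  (fun f : functional S => rnorm (sval f (vact g (vunit k))) ^+ 2).
Proof.
pose c := 8 * (1 + rnorm (ga g) + rnorm (gb g) + rnorm (gx g) + rnorm (gy g)).
have := rnorm_ge0 (ga g); have := rnorm_ge0 (gb g); have := rnorm_ge0 (gx g); have :=
  rnorm_ge0 (gy g).
move=> y0 x0 b0 a0; have c0 : 0 < c by rewrite /c; lra.
pose t : C := (c^-1)%:C.
pose h := gmk (t *: ga g) (t *: gb g) (t *: gx g) (t *: gy g).
have hnorm (T : operatorSpace R) (y : T) : 8 * rnorm y <= c ->
    mxnorm (const_mx (t *: y) : 'M[T]_1) <= 8^-1.
  move=> yc; rewrite mxnorm_norm rnormZ rnorm_real gtr0_norm ?invr_gt0 //.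
  by rewrite ler_pdivrMl // mulrC ler_pdivlMl //; lra.
have hK : zcontr (const_mx h : 'M[G]_1).
  split.
  - have -> : map_mx (@ga _ _ _ X) (const_mx h) = const_mx (t *: ga g) :> 'M[A]_1
      by apply/matrixP => i j; rewrite !mxE.
    by apply: hnorm; rewrite /c; lra.
  - have -> : map_mx (@gb _ _ _ X) (const_mx h) = const_mx (t *: gb g) :> 'M[B]_1
      by apply/matrixP => i j; rewrite !mxE.
    by apply: hnorm; rewrite /c; lra.
  - have -> : map_mx (@gx _ _ _ X) (const_mx h) = const_mx (t *: gx g) :> 'M[X]_1
      by apply/matrixP => i j; rewrite !mxE.
    by apply: hnorm; rewrite /c; lra.
  - have -> : (map_mx (@gy _ _ _ X) (const_mx h))^T = const_mx (t *: gy g) :> 'M[X]_1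
      by apply/matrixP => i j; rewrite !mxE.
    by apply: hnorm; rewrite /c; lra.
have h1 : dom 1 (fun f : functional S => rnorm (sval f (vact h (vunit k))) ^+ 2).
  (* For the vector [vunit k] and the rescaled generator h, the square of h [vunit k] cancels; the
     square at the unit remains, and it is one summand of [sqf e]. *)
  exists 1%N, (const_mx h : 'M[as_gen S]_1), (fun=> vunit k : S); split=> // f.
  rewrite {1 2}/sqf !big_ord1 /act_mx big_ord1 mxE mul1r.
  rewrite -[as_act _ _]/(vact h (vunit k)) addrAC subrr add0r.
  exact: (@sqf_coord R S n (@as_unit R S) f k).
exists (c ^+ 2 * 1); have := domZ (sqr_ge0 c) h1; apply: dom_le => f.
have vE : vact h (vunit k) = t *: vact g (vunit k) :> V.
  by apply/funext => i; rewrite /vact; exact: zactZ.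
have -> : (c ^+ 2 *: (fun f : functional S => rnorm (sval f (vact h (vunit k))) ^+ 2)) f
  = c ^+ 2 * rnorm (sval f (vact h (vunit k))) ^+ 2 by [].
rewrite vE [sval f (t *: _)](functionalZ _ _ (svalP f)) rnormM rnorm_real.
by rewrite gtr0_norm ?invr_gt0 // -[leRHS]exprMn mulrA mulfV ?gt_eqF // mul1r.
Qed.

(** The units together with their images under the generators span Z^n, and the vectors whose square
    is dominated form a subspace. *)
Lemma corr_dom_vec (v : S) : exists s, dom s (fun f : functional S => rnorm (sval f v) ^+ 2).
Proof.
pose D (v : S) := exists s, dom s (fun f : functional S => rnorm (sval f v) ^+ 2).
have D0 : D 0.
  exists 0; apply: dom0 => f; rewrite (functional0 (svalP f)) rnorm0 expr0n mul0r //.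
have DD u w : D u -> D w -> D (u + w).
  move=> [s hs] [t ht]; exists (2 * s + 2 * t).
  have := domD (domZ (ler0n R 2) hs) (domZ (ler0n R 2) ht); apply: dom_le => f.
  rewrite (functionalD _ _ (svalP f)).
  have := rnormD (sval f u) (sval f w); have := rnorm_ge0 (sval f u + sval f w).
  have -> : (2 *: (fun f : functional S => rnorm (sval f u) ^+ 2)
    + 2 *: (fun f : functional S => rnorm (sval f w) ^+ 2)) f
    = 2 * rnorm (sval f u) ^+ 2 + 2 * rnorm (sval f w) ^+ 2 by [].
  have := sqr_ge0 (rnorm (sval f u) - rnorm (sval f w)); nra.
have DZ (c : C) u : D u -> D (c *: u).
  move=> [s hs]; exists (rnorm c ^+ 2 * s); have := domZ (sqr_ge0 (rnorm c)) hs.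
  by apply: dom_le => f; rewrite (functionalZ _ _ (svalP f)) rnormM exprMn.
have Du k : D (vunit k).
  by exists 1; apply: dom0 => f; rewrite mul1r; exact: (@sqf_coord R S n (@as_unit R S) f k).
have -> : v = \sum_k (zc ((v : V) k) *: @as_unit R S k
    + as_act (gmk (za ((v : V) k)) (zb ((v : V) k)) (zx ((v : V) k)) 0 : as_gen S)
      (@as_unit R S k)).
  apply/funext => i; rewrite fct_sumE (bigD1 i) //= big1 => [|k ki].
    rewrite addr0.
    set z := (v : V) i.
    transitivity (zc z *: (vunit i i) + zact (gmk (za z) (zb z) (zx z) 0) (vunit i i)) => //.
    rewrite /vunit eqxx; apply: z_ext.
    - by rewrite zc_lin zact_c addr0; exact: esym (mulr1 _).
    - by rewrite za_lin zact_a /= scaler0 add0r scale1r (linear_map0 (amul_linearr _)) addr0.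
    - rewrite zb_lin zact_b /= scaler0 add0r scale1r (linear_map0 (amul_linearr _)) addr0.
      by rewrite (linear_map0 (pairing_linearr _)) addr0.
    - rewrite zx_lin zact_x /= scaler0 add0r scale1r (linear_map0 (ract_linearr _)) addr0.
      by rewrite (linear_map0 (lom_act_linearr (lact X) _)) add0r.
  set z := (v : V) k.
  transitivity (zc z *: (vunit k i) + zact (gmk (za z) (zb z) (zx z) 0) (vunit k i)) => //.
  have -> : vunit k i = 0 by rewrite /vunit eq_sym (negbTE ki).
  by rewrite scaler0 add0r (linear_map0 (zact_linear _)).
rewrite -/(D _); apply: (big_ind D) => // k _; apply: DD; first exact: DZ.
exact: corr_dom_act.
Qed.

Lemma corr_form_exists (a0 : 'M[A]_n) (b0 : 'M[B]_n) (x0 : 'M[X]_n) : exists p : V -> V -> C,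
  [/\ forall c u v w, p (c *: u + v) w = c * p u w + p v w,
      forall u v, p u v = Num.conj (p v u),
      forall u, 0 <= Re (p u u),
      forall k (a : 'M[G]_k) (v : 'I_k -> V), zcontr a ->
        \sum_i Re (p (fun j => \sum_l zact (a i l) (v l j))
          (fun j => \sum_l zact (a i l) (v l j)))
          <= \sum_i Re (p (v i) (v i))
    & \sum_i Re (p (vunit i) (vunit i)) <= 1 /\
      [/\ mxnorm a0 ^+ 2 <= \sum_i Re (p (ztarget a0 b0 x0 i) (ztarget a0 b0 x0 i)),
          mxnorm b0 ^+ 2 <= \sum_i Re (p (ztarget a0 b0 x0 i) (ztarget a0 b0 x0 i))
        & mxnorm x0 ^+ 2 <= \sum_i Re (p (ztarget a0 b0 x0 i) (ztarget a0 b0 x0 i))]].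
Proof.
pose c := Num.max (mxnorm a0 ^+ 2) (Num.max (mxnorm b0 ^+ 2) (mxnorm x0 ^+ 2)).
have cs s : 0 <= s -> dom s (sqf (ztarget a0 b0 x0)) -> c <= s.
  by move=> s0 /(ztarget_bound s0)[h1 h2 h3]; rewrite !ge_max h1 h2 h3.
have [p [p1 p2 p3 p4 [p5 p6]]] := form_exists corr_dom_unit corr_dom_vec cs.
exists p; split=> //; last first.
  by split=> //; split; apply: le_trans p6; rewrite /c !le_max lexx ?orbT.
move=> k a v az; apply: le_trans (p4 k a v az).
rewrite le_eqVlt; apply/orP; left; apply/eqP; apply: eq_bigr => i _.
suff -> : act_mx (a : 'M[as_gen S]_k) (v : 'I_k -> S) i
    = (fun j => \sum_l zact (a i l) (v l j)) :> V by [].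
by apply/funext => j; rewrite /act_mx fct_sumE.
Qed.

End CorrespondenceForm.

(** * Direct sums *)

Section DirectSum.
Variables (R : realType) (J : choiceType) (Y : lmodType R[i]).
Local Notation C := (R[i]).

Definition finsupp_pred : {pred (J -> Y)} :=
  [pred u : J -> Y | `[< finite_set [set j | u j != 0] >]].

Lemma finsupp_submod_closed : submod_closed finsupp_pred.
Proof.
split.
  apply/asboolP; rewrite (_ : [set j | _] = set0) ?finite_set0 //.
  by apply/seteqP; split=> j //=; rewrite eqxx.
move=> c u v /asboolP uf /asboolP vf; apply/asboolP.
apply: (sub_finite_set (B := [set j | u j != 0] `|` [set j | v j != 0])); last
  by rewrite finite_setU.
move=> j /= h; have [u0|] := eqVneq (u j) 0; last by left.
right; apply: contraNN h => /eqP v0.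
have -> : (c *: u + v) j = c *: u j + v j by [].
by rewrite u0 v0 scaler0 addr0.
Qed.

HB.instance Definition _ :=
  GRing.isSubmodClosed.Build _ _ finsupp_pred finsupp_submod_closed.

Record dsum := Dsum { dsum_fun :> J -> Y; dsumP : dsum_fun \in finsupp_pred }.

HB.instance Definition _ := [isSub for dsum_fun].
HB.instance Definition _ := [Choice of dsum by <:].
HB.instance Definition _ := [SubChoice_isSubLmodule of dsum by <:].

Lemma dsum_ext (u v : dsum) : (forall j, u j = v j) -> u = v.
Proof. by move=> h; apply/val_inj/funext. Qed.

Definition dsupp (u : dsum) : {fset J} := fset_set [set j | u j != 0].

Lemma in_dsupp u j : (j \in dsupp u) = (u j != 0).
Proof.
have uf : finite_set [set j | u j != 0] by have /asboolP := dsumP u.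
rewrite in_fset_set //; apply/idP/idP => [/set_mem //|h]; exact: mem_set.
Qed.

Section Form.
Variable p : J -> Y -> Y -> C.
Hypothesis p_linear : forall j c u v w, p j (c *: u + v) w = c * p j u w + p j v w.
Hypothesis p_conj : forall j u v, p j u v = Num.conj (p j v u).
Hypothesis p_ge0 : forall j u, 0 <= Re (p j u u).

Definition dsum_form (u v : dsum) : C := \sum_(j <- dsupp u) p j (u j) (v j).

Lemma p0l j w : p j 0 w = 0.
Proof. by have := p_linear j (-1) 0 0 w; rewrite scaler0 addr0 mulN1r addNr. Qed.

Lemma dsum_form_sub (F : {fset J}) (u v : dsum) : (forall j, u j != 0 -> j \in F) ->
  dsum_form u v = \sum_(j <- F) p j (u j) (v j).
Proof.
move=> uF; apply: big_fset_incl => [|j _].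
  by apply/fsubsetP => j; rewrite in_dsupp; exact: uF.
by rewrite in_dsupp negbK => /eqP ->; rewrite p0l.
Qed.

Lemma dsum_form_linear c u v w :
  dsum_form (c *: u + v) w = c * dsum_form u w + dsum_form v w.
Proof.
pose F := (dsupp u `|` dsupp v)%fset.
rewrite !(@dsum_form_sub F); first last.
- move=> j h; rewrite in_fsetU !in_dsupp; have [u0|//] := eqVneq (u j) 0.
  apply: contraNN h => /eqP v0; have -> : (c *: u + v) j = c *: u j + v j by [].
  by rewrite u0 v0 scaler0 addr0.
- by move=> j h; rewrite in_fsetU !in_dsupp h.
- by move=> j h; rewrite in_fsetU !in_dsupp h orbT.
by rewrite mulr_sumr -big_split; apply: eq_bigr => j _; rewrite /= -p_linear.
Qed.

Lemma dsum_form_conj u v : dsum_form u v = Num.conj (dsum_form v u).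
Proof.
pose F := (dsupp u `|` dsupp v)%fset.
rewrite !(@dsum_form_sub F); first last.
- by move=> j h; rewrite in_fsetU !in_dsupp h.
- by move=> j h; rewrite in_fsetU !in_dsupp h orbT.
by rewrite rmorph_sum; apply: eq_bigr => j _; exact: p_conj.
Qed.

Lemma dsum_form_ge0 u : 0 <= Re (dsum_form u u).
Proof. by rewrite Re_sum; apply: sumr_ge0 => j _; exact: p_ge0. Qed.

Definition dsumPH : preHilbert R := PreHilbert dsum_form_linear dsum_form_conj dsum_form_ge0.

Lemma dsum_q_sub (F : {fset J}) (u : dsum) : (forall j, u j != 0 -> j \in F) ->
  phq (u : dsumPH) = \sum_(j <- F) Re (p j (u j) (u j)).
Proof. by move=> uF; rewrite /phq /= (dsum_form_sub _ uF) Re_sum. Qed.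

(** Families of vectors are compared, rather than single ones, so that inequalities for matrices of
    operators pass to the direct sum. *)
Lemma dsum_q_le m k (u : 'I_m -> dsum) (v : 'I_k -> dsum) (c : R) :
  (forall j, \sum_i Re (p j (u i j) (u i j)) <= c * \sum_i Re (p j (v i j) (v i j))) ->
  \sum_i phq (u i : dsumPH) <= c * \sum_i phq (v i : dsumPH).
Proof.
move=> h.
pose F := fsetU (\big[@fsetU J/fset0]_(i : 'I_m) dsupp (u i))
  (\big[@fsetU J/fset0]_(i : 'I_k) dsupp (v i)).
have uF i j : u i j != 0 -> j \in F.
  by move=> uj; rewrite in_fsetU; apply/orP; left; apply/bigfcupP; exists i;
    rewrite ?mem_index_enum ?in_dsupp.
have vF i j : v i j != 0 -> j \in F.
  by move=> vj; rewrite in_fsetU; apply/orP; right; apply/bigfcupP; exists i;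
    rewrite ?mem_index_enum ?in_dsupp.
under eq_bigr do rewrite (dsum_q_sub (uF _)).
under [X in _ <= c * X]eq_bigr do rewrite (dsum_q_sub (vF _)).
by rewrite exchange_big [X in _ <= c * X]exchange_big mulr_sumr ler_sum.
Qed.

End Form.

Section Single.
Variable j : J.

Lemma dsingle_subproof (y : Y) : (fun k => if k == j then y else 0) \in finsupp_pred.
Proof.
apply/asboolP; apply: (sub_finite_set (B := [set j])); last exact: finite_set1.
by move=> k /=; case: (k =P j) => // _; rewrite eqxx.
Qed.
Definition dsingle (y : Y) : dsum := Dsum (dsingle_subproof y).

End Single.

(** The test for 0 keeps the support finite for an arbitrary [T]; [dmapE] removes it when
    [T j 0 = 0]. *)
Lemma dmap_subproof (T : J -> Y -> Y) (u : dsum) :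
  (fun j => if u j == 0 then 0 else T j (u j)) \in finsupp_pred.
Proof.
apply/asboolP; apply: (sub_finite_set (B := [set j | u j != 0])); last by have /asboolP :=
  dsumP u.
by move=> j /=; case: (u j == 0); rewrite ?eqxx.
Qed.
Definition dmap (T : J -> Y -> Y) (u : dsum) : dsum := Dsum (dmap_subproof T u).

Lemma dmapE T u j : T j 0 = 0 -> dmap T u j = T j (u j).
Proof. by move=> T0 /=; case: eqP => [->|]. Qed.

Lemma dperm_subproof (f : J -> J) (fK : involutive f) (u : dsum) :
  (fun j => u (f j)) \in finsupp_pred.
Proof.
apply/asboolP; apply: (sub_finite_set (B := f @` [set j | u j != 0])).
  by move=> j /= uj; exists (f j) => //; rewrite fK.
by apply: finite_image; have /asboolP := dsumP u.
Qed.
Definition dperm f fK (u : dsum) : dsum := Dsum (@dperm_subproof f fK u).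

End DirectSum.

(** * The doubled representation *)

Section DenseExtension.
Variables (R : realType) (V : preHilbert R).
Local Notation C := (R[i]).
Local Notation H := (completionHilbert V).
Implicit Types (S T : bounded_op H).

Definition hext (t : V -> V) : bounded_op H :=
  xget (0 : bounded_op H) [set T : bounded_op H | forall v, T (hiota v) = hiota (t v)].

Lemma hextE (t : V -> V) (M : R) : linear t -> (forall v, phs (t v) <= M * phs v) ->
  forall v, hext t (hiota v) = hiota (t v).
Proof.
move=> tl tM; apply: (xgetPex (0 : bounded_op H)
  (P := [set T : bounded_op H | forall v, T (hiota v) = hiota (t v)])).
by have [T hT] := completion_extend tl tM; exists T.
Qed.

Lemma adjointP T : is_adjoint T (adjoint T).
Proof. by have [S TS] := completion_adjoint_ex T; rewrite (is_adjoint_adjoint TS). Qed.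

Lemma adjoint_dense T S :
  (forall u v, hdot H (T (hiota u)) (hiota v) = hdot H (hiota u) (S (hiota v))) -> adjoint T = S.
Proof.
move=> h; apply: dense_op_ext => v; apply: dense_ext => u.
by rewrite hdot_conj -adjointP h -hdot_conj.
Qed.

Lemma adjointK T : adjoint (adjoint T) = T.
Proof. exact: is_adjoint_adjoint (is_adjointC (adjointP T)). Qed.

Lemma adjointD S T : adjoint (S + T) = adjoint S + adjoint T.
Proof. exact: is_adjoint_adjoint (is_adjointD (adjointP S) (adjointP T)). Qed.

Lemma adjointM S T : adjoint (S * T) = adjoint T * adjoint S.
Proof. exact: is_adjoint_adjoint (is_adjointM (adjointP S) (adjointP T)). Qed.

Lemma adjoint0 : adjoint (0 : bounded_op H) = 0.
Proof. by apply: is_adjoint_adjoint => x y; rewrite linear0l linear0r. Qed.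

Lemma adjointZ (c : C) T : adjoint (c *: T) = Num.conj c *: adjoint T.
Proof.
apply: is_adjoint_adjoint => x y.
have -> : (c *: T) x = c *: T x by [].
have -> : (Num.conj c *: adjoint T) y = Num.conj c *: adjoint T y by [].
by rewrite hdotZl adjointP hdotZr conjCK.
Qed.

End DenseExtension.

Section Representation.
Variables (R : realType) (A B : operatorStarAlgebra R) (X : operatorStarCorrespondence A B).
Local Notation C := (R[i]).
Local Notation Z := (zspace X).
Local Notation G := (zgen X).

Definition target : choiceType := {N : nat & ('M[A]_N.+1 * 'M[B]_N.+1 * 'M[X]_N.+1)%type}.
Definition target_form (j : target) := 
  cid (corr_form_exists (projT2 j).1.1 (projT2 j).1.2 (projT2 j).2).

(* Every target occurs twice: the second copy carries adjoints. *)
Definition jindex : choiceType := (target * bool)%type.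
(** One fibre for targets of all sizes. [jform] reads only the first N + 1 coordinates; the others
    are null, which a semi-inner product permits. *)
Definition yspace : lmodType C := nat -> Z.

Definition jform (j : jindex) (u v : yspace) : C :=
  sval (target_form j.1) (fun k => u k) (fun k => v k).

Lemma jform_linear j c u v w : jform j (c *: u + v) w = c * jform j u w + jform j v w.
Proof.
rewrite /jform; case: (target_form j.1) => p [p1 _ _ _ _] /=; exact: p1.
Qed.

Lemma jform_conj j u v : jform j u v = Num.conj (jform j v u).
Proof. by rewrite /jform; case: (target_form j.1) => p [_ p2 _ _ _] /=; exact: p2. Qed.

Lemma jform_ge0 j u : 0 <= Re (jform j u u).
Proof. by rewrite /jform; case: (target_form j.1) => p [_ _ p3 _ _] /=; exact: p3. Qed.

Lemma jformZ j (t : R) u : Re (jform j ((t%:C : C) *: u) ((t%:C : C) *: u))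
  = t ^+ 2 * Re (jform j u u).
Proof.
have jZ (c : C) x y : jform j (c *: x) y = c * jform j x y.
  by have := jform_linear j c x 0 y; rewrite addr0 => ->; rewrite (p0l jform_linear) addr0.
rewrite jZ jform_conj jZ rmorphM /= -jform_conj mulrA mul_conj rnorm_real real_normK ?num_real //.
by rewrite Re_mul /= mul0r subr0.
Qed.

Definition D : preHilbert R := dsumPH jform_linear jform_conj jform_ge0.
Local Notation H := (completionHilbert D).

(** The two values of g are the generators acting on the two copies. *)
Definition gen (g : bool -> G) : D -> D :=
  dmap (fun (j : jindex) (y : yspace) => (fun k => zact (g j.2) (y k)) : yspace).

Lemma genE g (u : D) (j : jindex) k : (gen g u : dsum _ _) j k
  = zact (g j.2) ((u : dsum _ _) j k).
Proof.
rewrite /gen dmapE //; apply/funext => i; exact: (linear_map0 (zact_linear _)).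
Qed.

Lemma D_ext (u v : D) :
  (forall (j : jindex) k, (u : dsum _ _) j k = (v : dsum _ _) j k) -> u = v.
Proof. by move=> h; apply: dsum_ext => j; apply/funext => k. Qed.

Lemma gen_linear g : linear (gen g).
Proof.
move=> c u v; apply: D_ext => j k.
have -> : (c *: gen g u + gen g v : dsum _ _) j k
  = c *: (gen g u : dsum _ _) j k + (gen g v : dsum _ _) j k by [].
by rewrite !genE -zact_linear.
Qed.

Definition zscale (t : R) (g : G) : G :=
  gmk ((t%:C : C) *: ga g) ((t%:C : C) *: gb g) ((t%:C : C) *: gx g) ((t%:C : C) *: gy g).

Definition zbound m (g : 'M[G]_m) (M : R) : Prop :=
  [/\ mxnorm (map_mx (@ga _ _ _ X) g) <= M, mxnorm (map_mx (@gb _ _ _ X) g) <= M,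
      mxnorm (map_mx (@gx _ _ _ X) g) <= M & mxnorm (map_mx (@gy _ _ _ X) g)^T <= M].

Lemma zcontr_scale m (g : 'M[G]_m) (M : R) : 0 < M -> zbound g (8^-1 * M) ->
  zcontr (map_mx (zscale M^-1) g).
Proof.
move=> M0 [h1 h2 h3 h4].
have key (T : operatorSpace R) (x : 'M[T]_m) : mxnorm x <= 8^-1 * M ->
    mxnorm (map_mx ( *:%R (M^-1%:C : C)) x) <= 8^-1.
  by rewrite mxnormZ gtr0_norm ?invr_gt0 // ler_pdivrMl // mulrC.
split.
- by rewrite (_ : map_mx _ _ = map_mx ( *:%R (M^-1%:C : C)) (map_mx (@ga _ _ _ X) g)) ?key //;
    apply/matrixP => i j; rewrite !mxE.
- by rewrite (_ : map_mx _ _ = map_mx ( *:%R (M^-1%:C : C)) (map_mx (@gb _ _ _ X) g)) ?key //;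
    apply/matrixP => i j; rewrite !mxE.
- by rewrite (_ : map_mx _ _ = map_mx ( *:%R (M^-1%:C : C)) (map_mx (@gx _ _ _ X) g)) ?key //;
    apply/matrixP => i j; rewrite !mxE.
- by rewrite (_ : _^T = map_mx ( *:%R (M^-1%:C : C)) (map_mx (@gy _ _ _ X) g)^T) ?key //;
    apply/matrixP => i j; rewrite !mxE.
Qed.

Lemma jform_contr j m (a : 'M[G]_m) (w : 'I_m -> yspace) : zcontr a ->
  \sum_i Re (jform j (fun k => \sum_l zact (a i l) (w l k))
    (fun k => \sum_l zact (a i l) (w l k)))
    <= \sum_i Re (jform j (w i) (w i)).
Proof.
rewrite /jform; case: (target_form j.1) => p [_ _ _ p4 _] /= az.
exact: (p4 m a (fun l k => w l k)).
Qed.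

(** Dividing by M brings the matrices into [zcontr], which are contractions in every fibre. So the
    bound is 8 times the norm of the generators, whatever the target. *)
Lemma gen_bound m (g : bool -> 'M[G]_m) (M : R) : 0 < M -> (forall b, zbound (g b) (8^-1 * M)) ->
  forall v : 'I_m -> D,
  \sum_i phq (\sum_l gen (fun b => g b i l) (v l) : D) <= M ^+ 2 * \sum_l phq (v l).
Proof.
move=> M0 gM v; apply: dsum_q_le => j.
have ev (F : 'I_m -> D) k : (\sum_l F l : dsum _ _) j k = \sum_l (F l : dsum _ _) j k.
  exact: (@big_morph _ _ (fun u : dsum jindex yspace => u j k) 0 +%R 0 +%R).
have := jform_contr j (fun l => (v l : dsum _ _) j) (zcontr_scale M0 (gM j.2)).
rewrite -ler_pdivrMl ?exprn_gt0 // mulr_sumr; apply: le_trans; rewrite le_eqVlt.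
apply/orP; left; apply/eqP; apply: eq_bigr => i _.
rewrite -exprVn -jformZ.
suff -> : (M^-1%:C : C) *: ((\sum_l gen (fun b => g b i l) (v l) : dsum _ _) j)
   = (fun k => \sum_l zact (map_mx (zscale M^-1) (g j.2) i l) ((v l : dsum _ _) j k)) by [].
apply/funext => k.
transitivity ((M^-1%:C : C) *: (\sum_l gen (fun b => g b i l) (v l) : dsum _ _) j k) => //.
by rewrite ev scaler_sumr; apply: eq_bigr => l _; rewrite genE mxE -zactZ.
Qed.

Lemma const_zbound (g : G) : exists2 M : R, 0 < M & zbound (const_mx g : 'M[G]_1) (8^-1 * M).
Proof.
have := rnorm_ge0 (ga g); have := rnorm_ge0 (gb g); have := rnorm_ge0 (gx g); have :=
  rnorm_ge0 (gy g).
move=> y0 x0 b0 a0.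
pose c := 1 + rnorm (ga g) + rnorm (gb g) + rnorm (gx g) + rnorm (gy g).
exists (8 * c); first by rewrite /c; lra.
rewrite mulKf //; split.
- by rewrite (_ : map_mx _ _ = const_mx (ga g)) ?mxnorm_norm;
    [rewrite /c; lra|apply/matrixP => i j; rewrite !mxE].
- by rewrite (_ : map_mx _ _ = const_mx (gb g)) ?mxnorm_norm;
    [rewrite /c; lra|apply/matrixP => i j; rewrite !mxE].
- by rewrite (_ : map_mx _ _ = const_mx (gx g)) ?mxnorm_norm;
    [rewrite /c; lra|apply/matrixP => i j; rewrite !mxE].
- by rewrite (_ : _^T = const_mx (gy g)) ?mxnorm_norm;
    [rewrite /c; lra|apply/matrixP => i j; rewrite !mxE].
Qed.

Lemma zbound_le m (g : 'M[G]_m) (M N : R) : M <= N -> zbound g M -> zbound g N.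
Proof. by move=> MN [h1 h2 h3 h4]; split; apply: le_trans MN. Qed.

Lemma gen_bounded g : exists M : R, forall v, phs (gen g v) <= M * phs v.
Proof.
have [M M0 gM] := const_zbound (g true); have [N N0 gN] := const_zbound (g false).
have MN0 : 0 < M + N by rewrite addr_gt0.
exists (M + N) => v.
have zb b : zbound (const_mx (g b) : 'M[G]_1) (8^-1 * (M + N)).
  by case: b; [apply: zbound_le gM|apply: zbound_le gN]; rewrite ler_wpM2l //; lra.
have := @gen_bound 1 (fun b => const_mx (g b)) (M + N) MN0 zb (fun=> v).
rewrite !big_ord1 => h.
rewrite -ler_sqr ?nnegrE ?mulr_ge0 ?phs_ge0 ?(ltW MN0) // exprMn !sqr_phs.
have -> : gen g v = gen (fun b => (const_mx (g b) : 'M[G]_1) 0 0) v.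
  by congr gen; apply/funext => b; rewrite mxE.
exact: h.
Qed.

Definition genop g : bounded_op H := hext (gen g).

Lemma genopE g v : genop g (hiota v) = hiota (gen g v).
Proof. by have [M hM] := gen_bounded g; exact: hextE (gen_linear g) hM v. Qed.

Lemma genopM g h k : (forall b z, zact (g b) (zact (h b) z) = zact (k b) z) ->
  genop g * genop h = genop k.
Proof.
move=> ghk; apply: dense_op_ext => v.
transitivity (genop g (genop h (hiota v))) => //; rewrite !genopE; congr hiota.
by apply: D_ext => j i; rewrite !genE.
Qed.

Definition on_copy (b : bool) (g : G) : bool -> G := fun b' => if b' == b then g else 0.

Lemma on_copyM b (g h k : G) : (forall z, zact g (zact h z) = zact k z) ->
  genop (on_copy b g) * genop (on_copy b h) = genop (on_copy b k).
Proof.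
by move=> ghk; apply: genopM => b' z; rewrite /on_copy; case: eqP => _ //; rewrite !zact0.
Qed.

(** The adjoint of a [genop] has no formula on the dense subspace. Projections onto the copies show
    where it lives. *)
Definition copy_projf b : D -> D :=
  dmap (fun (j : jindex) (y : yspace) => if j.2 == b then y else 0).
Definition copy_proj b : bounded_op H := hext (copy_projf b).

Lemma copy_projfE b (u : D) (j : jindex) :
  (copy_projf b u : dsum _ _) j = if j.2 == b then (u : dsum _ _) j else 0.
Proof. by rewrite /copy_projf dmapE // if_same. Qed.

Lemma copy_projf_linear b : linear (copy_projf b).
Proof.
move=> c u v; apply: dsum_ext => j.
have -> : (c *: copy_projf b u + copy_projf b v : dsum _ _) j
  = c *: (copy_projf b u : dsum _ _) j + (copy_projf b v : dsum _ _) j by [].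
rewrite !copy_projfE; case: eqP => _ //.
by rewrite scaler0 addr0.
Qed.

Lemma copy_projE b v : copy_proj b (hiota v) = hiota (copy_projf b v).
Proof.
apply: (@hextE _ _ _ 1); first exact: copy_projf_linear.
move=> {}v; rewrite mul1r; apply: ler_wsqrtr.
have := @dsum_q_le _ _ _ _ jform_linear jform_conj jform_ge0 1 1 (fun=> copy_projf b v)
  (fun=> v) 1.
rewrite !big_ord1 mul1r; apply=> j; rewrite !big_ord1 mul1r copy_projfE.
case: eqP => _; first exact: lexx.
by rewrite (p0l jform_linear); exact: jform_ge0.
Qed.

Lemma dsum_form_eq (u u' v v' : D) :
  (forall j : jindex, jform j ((u : dsum _ _) j) ((v : dsum _ _) j)
    = jform j ((u' : dsum _ _) j) ((v' : dsum _ _) j)) ->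
  ph_form u v = ph_form u' v'.
Proof.
move=> h; pose F := fsetU (dsupp (u : dsum _ _)) (dsupp (u' : dsum _ _)).
rewrite /= !(@dsum_form_sub _ _ _ _ jform_linear F) => [|j uj|j uj].
- by apply: eq_bigr => j _; exact: h.
- by rewrite in_fsetU !in_dsupp uj orbT.
- by rewrite in_fsetU !in_dsupp uj.
Qed.

Lemma jform0r j y : jform j y 0 = 0.
Proof. by rewrite jform_conj (p0l jform_linear) rmorph0. Qed.

Lemma adjoint_copy_proj b : adjoint (copy_proj b) = copy_proj b.
Proof.
apply: adjoint_dense => u v; rewrite !copy_projE !hdot_ciota2.
apply: dsum_form_eq => j; rewrite !copy_projfE; case: eqP => _ //.
by rewrite (p0l jform_linear) jform0r.
Qed.

Lemma genop_proj b g : genop (on_copy b g) * copy_proj b = genop (on_copy b g).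
Proof.
apply: dense_op_ext => v.
transitivity (genop (on_copy b g) (copy_proj b (hiota v))) => //.
rewrite copy_projE !genopE; congr hiota; apply: D_ext => j i; rewrite !genE copy_projfE.
by rewrite /on_copy; case: eqP => _ //; rewrite !zact0.
Qed.

Lemma proj_genop b g : copy_proj b * genop (on_copy b g) = genop (on_copy b g).
Proof.
apply: dense_op_ext => v.
transitivity (copy_proj b (genop (on_copy b g) (hiota v))) => //.
rewrite genopE copy_projE; congr hiota; apply: dsum_ext => j; rewrite copy_projfE.
case: eqP => // jb; apply/funext => i; rewrite genE /on_copy.
by case: eqP jb => // _ _; rewrite zact0.
Qed.

Lemma genop_proj0 b g : genop (on_copy b g) * copy_proj (~~ b) = 0.
Proof.
apply: dense_op_ext => v.
transitivity (genop (on_copy b g) (copy_proj (~~ b) (hiota v))) => //.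
rewrite copy_projE !genopE; transitivity (hiota (0 : D)); last first.
  exact: linear_map0 (@hiota_linear R D).
congr hiota; apply: D_ext => j i; rewrite !genE copy_projfE.
rewrite /on_copy; have [->|jb] := eqVneq j.2 b; last by rewrite zact0.
by rewrite (_ : (b == ~~ b) = false) ?(linear_map0 (zact_linear _)) //; case: (b).
Qed.

Lemma proj_genop0 b g : copy_proj (~~ b) * genop (on_copy b g) = 0.
Proof.
apply: dense_op_ext => v.
transitivity (copy_proj (~~ b) (genop (on_copy b g) (hiota v))) => //.
rewrite genopE copy_projE; transitivity (hiota (0 : D)); last first.
  exact: linear_map0 (@hiota_linear R D).
congr hiota; apply: dsum_ext => j; rewrite copy_projfE; case: eqP => // jb.
apply/funext => i; rewrite genE /on_copy jb (_ : (~~ b == b) = false) ?zact0 //.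
by case: (b).
Qed.

(** Insert the projection of copy b between the factors: it fixes the left one and, by
    self-adjointness, kills the adjoint of an operator living on the other copy. *)
Lemma genop_cross b g h : genop (on_copy b g) * adjoint (genop (on_copy (~~ b) h)) = 0.
Proof.
rewrite -genop_proj -mulrA -[copy_proj b]adjoint_copy_proj -adjointM.
by have := genop_proj0 (~~ b) h; rewrite negbK => ->; rewrite adjoint0 mulr0.
Qed.

Lemma genop_cross' b g h : adjoint (genop (on_copy (~~ b) h)) * genop (on_copy b g) = 0.
Proof.
by rewrite -[X in adjoint X]proj_genop adjointM adjoint_copy_proj -mulrA proj_genop0 mulr0.
Qed.

Definition swap_index (j : jindex) : jindex := (j.1, ~~ j.2).
Lemma swap_indexK : involutive swap_index.
Proof. by case=> i b; rewrite /swap_index /= negbK. Qed.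

Definition swapf : D -> D := dperm swap_indexK.
Definition swap : bounded_op H := hext swapf.

Lemma swapf_linear : linear swapf.
Proof. by move=> c u v; exact: dsum_ext. Qed.

(** [jform] depends on the target but not on the copy, so this is a reindexing of the sum over a
    swap-invariant finite set. *)
Lemma swapf_form u v : ph_form (swapf u) v = ph_form u (swapf v).
Proof.
pose F := fsetU (dsupp (u : dsum _ _)) (dsupp (swapf u : dsum _ _)).
have FS j : (swap_index j \in F) = (j \in F).
  by rewrite !in_fsetU !in_dsupp /= swap_indexK orbC.
have uF (j : jindex) : (u : dsum _ _) j != 0 -> j \in F by rewrite in_fsetU !in_dsupp => ->.
have suF (j : jindex) : (swapf u : dsum _ _) j != 0 -> j \in F
  by rewrite in_fsetU !in_dsupp orbC => ->.
rewrite /= (@dsum_form_sub _ _ _ _ jform_linear F _ _ suF)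
  (@dsum_form_sub _ _ _ _ jform_linear F _ _ uF).
pose K j := jform j ((u : dsum _ _) j) ((swapf v : dsum _ _) j).
transitivity (\sum_(j <- F) K (swap_index j)).
  by apply: eq_bigr => j _; rewrite /K /= swap_indexK.
rewrite -(big_map swap_index xpredT K).
apply: perm_big; apply: uniq_perm; rewrite ?(map_inj_uniq (inv_inj swap_indexK)) ?fset_uniq //.
by move=> j; rewrite -(FS j) -{1}[j]swap_indexK (mem_map (inv_inj swap_indexK)).
Qed.

Lemma swapfK v : swapf (swapf v) = v.
Proof. by apply: dsum_ext => j /=; rewrite swap_indexK. Qed.

Lemma swapE v : swap (hiota v) = hiota (swapf v).
Proof.
apply: (@hextE _ _ _ 1); first exact: swapf_linear.
by move=> {}v; rewrite mul1r /phs /phq swapf_form swapfK.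
Qed.

Lemma adjoint_swap : adjoint swap = swap.
Proof. by apply: adjoint_dense => u v; rewrite !swapE !hdot_ciota2 swapf_form. Qed.

Lemma swap_sqr : swap * swap = 1.
Proof.
by apply: dense_op_ext => v; transitivity (swap (swap (hiota v))) => //; rewrite !swapE swapfK.
Qed.

Lemma swap_conj b g : swap * genop (on_copy b g) * swap = genop (on_copy (~~ b) g).
Proof.
apply: dense_op_ext => v.
transitivity (swap (genop (on_copy b g) (swap (hiota v)))) => //.
rewrite swapE !genopE swapE; congr hiota; apply: D_ext => j i.
have -> : (swapf (gen (on_copy b g) (swapf v)) : dsum _ _) j i
  = (gen (on_copy b g) (swapf v) : dsum _ _) (swap_index j) i by [].
rewrite !genE /= swap_indexK /on_copy /=.
by congr (zact _ _); case: (j.2); case: (b).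
Qed.

Definition repop (g h : G) : bounded_op H :=
  genop (on_copy true g) + adjoint (genop (on_copy false h)).

(** Cross terms vanish. On the second copy adjoints reverse products, hence the reversed order in
    the hypothesis on h. *)
Lemma repopM g h g' h' g'' h'' :
  (forall z, zact g (zact g' z) = zact g'' z) -> (forall z, zact h' (zact h z) = zact h'' z) ->
  repop g h * repop g' h' = repop g'' h''.
Proof.
move=> gg hh; rewrite /repop mulrDl !mulrDr (genop_cross true) (genop_cross' true).
by rewrite (on_copyM _ gg) -adjointM (on_copyM _ hh) addr0 add0r.
Qed.

Lemma repop_adjoint g h : swap * adjoint (repop g h) * swap = repop h g.
Proof.
rewrite /repop adjointD adjointK mulrDr mulrDl swap_conj addrC; congr (_ + _).
by rewrite -{1}adjoint_swap -adjointM -[X in _ * X]adjoint_swap -adjointM mulrA swap_conj.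
Qed.

End Representation.

(** * Complete isomorphisms onto closed ranges *)

Section ClosedRange.
Variables (R : realType) (V : operatorSpace R) (H : hilbertSpace R) (f : V -> bounded_op H)
  (K : R).
Local Notation C := (R[i]).
Hypothesis f_linear : linear f.
Hypothesis f_upper : forall n (x : 'M[V]_n), opnorm (map_mx f x) <= K * mxnorm x.
Hypothesis f_lower : forall n (x : 'M[V]_n.+1), mxnorm x <= opnorm (map_mx f x).

Lemma opnormD n (S T : 'M[bounded_op H]_n) : opnorm (S + T) <= opnorm S + opnorm T.
Proof.
apply: opnorm_le; first by rewrite addr_ge0 ?opnorm_ge0.
by apply: mxboundedD; exact: opnorm_bounded.
Qed.

Lemma opnormN n (T : 'M[bounded_op H]_n) : opnorm (- T) <= opnorm T.
Proof.
apply: opnorm_le; first exact: opnorm_ge0.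
move=> v; have := opnorm_bounded T v.
suff -> : mxapp (- T) v = (-1 : C) *: mxapp T v
  by rewrite phsZ rnormN (rnorm_real 1) normr1 mul1r.
apply/funext => i; rewrite /mxapp.
transitivity ((-1 : C) *: \sum_k T i k (v k)) => //.
by rewrite scaler_sumr; apply: eq_bigr => k _; rewrite mxE scaleN1r.
Qed.

Lemma opnorm1_eq0 (T : bounded_op H) : opnorm (const_mx T : 'M[bounded_op H]_1) <= 0 -> T = 0.
Proof.
move=> T0; apply: bounded_op_ext => x; apply: rnorm_eq0; apply: le_anti; rewrite rnorm_ge0 andbT.
have := opnorm_bounded (const_mx T : 'M[bounded_op H]_1) ((fun=> x) : hpow H 1).
move=> /(le_trans (hpow_coord_le _ 0)); rewrite /mxapp big_ord1 mxE => /le_trans; apply.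
by rewrite mulr_le0_ge0 ?phs_ge0.
Qed.

Lemma const_lower (x y : V) : rnorm (x - y) <= opnorm (const_mx (f x - f y) : 'M[bounded_op H]_1).
Proof.
have fB : f (x - y) = f x - f y by rewrite addrC -scaleN1r f_linear scaleN1r addrC.
by have := @f_lower 0%N (const_mx (x - y)); rewrite map_const_mx fB mxnorm_norm.
Qed.

Lemma const_upper (x y : V) : opnorm (const_mx (f x - f y) : 'M[bounded_op H]_1)
  <= K * rnorm (x - y).
Proof.
have fB : f (x - y) = f x - f y by rewrite addrC -scaleN1r f_linear scaleN1r addrC.
by have := @f_upper 1%N (const_mx (x - y)); rewrite map_const_mx fB mxnorm_norm.
Qed.

Lemma f_inj : injective f.
Proof.
move=> x y fxy; apply/eqP; rewrite -subr_eq0; apply/eqP/rnorm_eq0/le_anti.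
rewrite rnorm_ge0 andbT; apply: le_trans (const_lower x y) _; rewrite fxy subrr.
apply: opnorm_le => // v; rewrite mul0r; apply: le_trans (hpow_le_sum _) _.
by rewrite big1 // => i _; rewrite /mxapp big_ord1 mxE rnorm0.
Qed.

(** The lower bound makes preimages of an approximating sequence Cauchy; [V] is complete, and the
    upper bound carries the limit back. *)
Lemma range_closed : norm_closed (@opnorm R H) (range f).
Proof.
move=> w hw.
have /choice[x hx] (n : nat) : exists x, opnorm (const_mx (w - f x) : 'M[bounded_op H]_1) <
  n.+1%:R^-1.
  by have [|_ [x _ <-] h] := hw n.+1%:R^-1; [rewrite invr_gt0|exists x].
have inv_lt (e : R) : 0 < e -> \forall n \near \oo, (n.+1%:R^-1 : R) < e.
  move=> e0; have /cvgrPdist_lt/(_ _ e0) := @cvg_harmonic R.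
  by apply: filterS => n; rewrite sub0r normrN /= ger0_norm // invr_ge0.
have xC : cauchy (x n @[n --> \oo]).
  apply: cauchy_exP => z z0.
  have [e ze] : exists e : R, z = e%:C.
    by exists (Re z); apply: complexP => //=; move: z0; rewrite ltcE => /andP[/eqP].
  rewrite ze ltcR in z0 *; have e2 : 0 < e / 2 by rewrite divr_gt0.
  have hN := inv_lt _ e2; have [N hNN] := filter_ex hN.
  exists (x N); suff : \forall n \near \oo, ball (x N) e%:C (x n) by [].
  apply: filterS hN => n hn; rewrite -ball_normE /= rnormE ltcR.
  apply: le_lt_trans (const_lower _ _) _.
  have -> : f (x N) - f (x n) = - (w - f (x N)) + (w - f (x n)) by rewrite opprB addrA subrK.
  have -> : const_mx (- (w - f (x N)) + (w - f (x n))) = - const_mx (w - f (x N))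
    + const_mx (w - f (x n)) :> 'M[bounded_op H]_1.
    by apply/matrixP => i j; rewrite !mxE.
  apply: le_lt_trans (opnormD _ _) _.
  apply: le_lt_trans (lerD (opnormN _) (lexx _)) _.
  by rewrite [e]splitr ltrD //; [exact: lt_trans (hx N) hNN|exact: lt_trans (hx n) hn].
have xl : x n @[n --> \oo] --> lim (x n @[n --> \oo]) by apply: cauchy_cvg.
move: xl; set l := lim _ => xl.
exists l => //; apply/esym/eqP; rewrite -subr_eq0; apply/eqP/opnorm1_eq0.
apply: (@le0_of_small _ _ (1 + `|K|)) => e e0.
have /cvgrPdist_le/(_ e%:C) := xl; rewrite ltcR => /(_ e0) hl.
have [n [h1 h2]] := filter_ex (filterI (inv_lt _ e0) hl).
have -> : w - f l = (w - f (x n)) + (f (x n) - f l) by rewrite addrA subrK.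
have -> : const_mx (w - f (x n) + (f (x n) - f l)) = const_mx (w - f (x n))
  + const_mx (f (x n) - f l) :> 'M[bounded_op H]_1.
  by apply/matrixP => i j; rewrite !mxE.
apply: le_trans (opnormD _ _) _; rewrite mulrDl mul1r lerD //.
  by apply: ltW; apply: lt_trans h1; exact: hx.
apply: le_trans (const_upper _ _) _.
move: h2; rewrite rnormE lecR rnormB => h2.
apply: le_trans (ler_wpM2l _ h2) => //.
by rewrite ler_wpM2r ?rnorm_ge0 // ler_norm.
Qed.

Lemma cb_iso_of_bounds : cb_iso_onto_image (@mxnorm R V) (@opnorm R H) f.
Proof.
split; last exact: range_closed.
  by split=> //; exists K => n x _; exact: f_upper.
have gP w : range f w -> f (xget 0 [set v | f v = w]) = w.
  by move=> [v _ fv]; apply: (xgetPex 0 (P := [set v | f v = w])); exists v.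
exists (fun w => xget 0 [set v | f v = w]) => [x|].
  by apply: f_inj; apply: gP; exists x.
(* The lower bound is given from size 1 on; in size 0 the norm is 0. *)
exists 1 => -[|n] T hT; rewrite mul1r.
  by rewrite [map_mx _ T]flatmx0 mxnorm0 opnorm_ge0.
apply: le_trans (f_lower _) _; rewrite le_eqVlt; apply/orP; left; apply/eqP; congr opnorm.
by apply/matrixP => i j; rewrite !mxE gP.
Qed.

End ClosedRange.

(** * Relations between the generators *)

Section Actions.
Variables (R : realType) (A B : operatorStarAlgebra R) (X : operatorStarCorrespondence A B).
Local Notation C := (R[i]).
Local Notation Z := (zspace X).
Implicit Types (a : A) (b : B) (x y : X) (z : Z).

Definition genA a : zgen X := gmk a 0 0 0.
Definition genB b : zgen X := gmk 0 b 0 0.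
Definition genX x : zgen X := gmk 0 0 x 0.
Definition genY y : zgen X := gmk 0 0 0 y.

Lemma amul0l (D : operatorAlgebra R) (d : D) : amul 0 d = 0.
Proof. exact: (linear_map0 (amul_linearl d)). Qed.
Lemma amul0r (D : operatorAlgebra R) (d : D) : amul d 0 = 0.
Proof. exact: (linear_map0 (amul_linearr d)). Qed.
Lemma lact0l x : lact X 0 x = 0. Proof. exact: (linear_map0 (lom_act_linearl (lact X) x)). Qed.
Lemma lact0r a : lact X a 0 = 0. Proof. exact: (linear_map0 (lom_act_linearr (lact X) a)). Qed.
Lemma ract0l b : ract (0 : X) b = 0. Proof. exact: (linear_map0 (ract_linearl b)). Qed.
Lemma ract0r x : ract x (0 : B) = 0. Proof. exact: (linear_map0 (ract_linearr x)). Qed.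
Lemma pairing0r x : pairing x (0 : X) = 0. Proof. exact: (linear_map0 (pairing_linearr x)). Qed.

Lemma zactA a z : zact (genA a) z = zmk 0 (zc z *: a + amul a (za z)) 0 (lact X a (zx z)).
Proof. by rewrite /zact /= !scaler0 amul0l pairing0l ract0l !addr0. Qed.

Lemma zactB b z : zact (genB b) z = zmk 0 0 (zc z *: b + amul b (zb z)) 0.
Proof. by rewrite /zact /= !scaler0 amul0l pairing0l ract0l lact0l !addr0. Qed.

Lemma zactX x z : zact (genX x) z = zmk 0 0 0 (zc z *: x + ract x (zb z)).
Proof. by rewrite /zact /= !scaler0 !amul0l pairing0l lact0l !addr0 add0r. Qed.

Lemma zactY y z : zact (genY y) z = zmk 0 0 (pairing y (zx z)) 0.
Proof. by rewrite /zact /= !scaler0 !amul0l ract0l lact0l !addr0 add0r. Qed.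

Lemma zactAA a a' z : zact (genA a) (zact (genA a') z) = zact (genA (amul a a')) z.
Proof.
rewrite !zactA /zc /za /zx /= scale0r add0r (linear_mapD _ _ (amul_linearr _)).
by rewrite (linear_mapZ _ _ (amul_linearr _)) amulA lom_actM.
Qed.

Lemma zactBB b b' z : zact (genB b) (zact (genB b') z) = zact (genB (amul b b')) z.
Proof.
rewrite !zactB /zc /zb /= scale0r add0r (linear_mapD _ _ (amul_linearr _)).
by rewrite (linear_mapZ _ _ (amul_linearr _)) amulA.
Qed.

Lemma zactAX a x z : zact (genA a) (zact (genX x) z) = zact (genX (lact X a x)) z.
Proof.
rewrite zactA !zactX /zc /za /zx /zb /= scale0r add0r amul0r
  (linear_mapD _ _ (lom_act_linearr _ _)).
by rewrite (linear_mapZ _ _ (lom_act_linearr _ _)) lact_ract.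
Qed.

Lemma zactXB x b z : zact (genX x) (zact (genB b) z) = zact (genX (ract x b)) z.
Proof.
rewrite zactB !zactX /zc /zb /= scale0r add0r (linear_mapD _ _ (ract_linearr _)).
by rewrite (linear_mapZ _ _ (ract_linearr _)) ractM.
Qed.

Lemma zactYX y x z : zact (genY y) (zact (genX x) z) = zact (genB (pairing y x)) z.
Proof.
rewrite zactB zactY zactX /zx /= (linear_mapD _ _ (pairing_linearr _)).
by rewrite (linear_mapZ _ _ (pairing_linearr _)) pairing_ract.
Qed.

(** Adjointness of the left action, read as a relation between generators. With [zactBY] it makes
    the second copy compatible with both module actions. *)
Lemma zactYA y a z : zact (genY y) (zact (genA (dagger a)) z) = zact (genY (lact X a y)) z.
Proof. by rewrite !zactY zactA /zx /= pairing_lact. Qed.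

Lemma zactBY b y z : zact (genB (dagger b)) (zact (genY y) z) = zact (genY (ract y b)) z.
Proof.
rewrite zactB !zactY /zc /zb /zx /= scale0r add0r.
by rewrite [in RHS]pairing_dagger pairing_ract daggerM -pairing_dagger.
Qed.

Lemma zactA_linear c a a' z :
  zact (genA (c *: a + a')) z = c *: zact (genA a) z + zact (genA a') z.
Proof.
rewrite !zactA (linear_mapD _ _ (amul_linearl _)) (linear_mapZ _ _ (amul_linearl _))
  lom_act_linearl.
apply: z_ext.
- by rewrite zc_lin /zc /= mulr0 addr0.
- by rewrite za_lin /za /= scalerDr scalerDr !scalerA [_ * c]mulrC -!scalerA addrACA.
- by rewrite zb_lin /zb /= scaler0 addr0.
- by rewrite zx_lin.
Qed.

Lemma zactB_linear c b b' z :
  zact (genB (c *: b + b')) z = c *: zact (genB b) z + zact (genB b') z.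
Proof.
rewrite !zactB (linear_mapD _ _ (amul_linearl _)) (linear_mapZ _ _ (amul_linearl _)).
apply: z_ext.
- by rewrite zc_lin /zc /= mulr0 addr0.
- by rewrite za_lin /za /= scaler0 addr0.
- by rewrite zb_lin /zb /= scalerDr scalerDr !scalerA [_ * c]mulrC -!scalerA addrACA.
- by rewrite zx_lin /zx /= scaler0 addr0.
Qed.

Lemma zactX_linear c x x' z :
  zact (genX (c *: x + x')) z = c *: zact (genX x) z + zact (genX x') z.
Proof.
rewrite !zactX ract_linearl; apply: z_ext.
- by rewrite zc_lin /zc /= mulr0 addr0.
- by rewrite za_lin /za /= scaler0 addr0.
- by rewrite zb_lin /zb /= scaler0 addr0.
- by rewrite zx_lin /zx /= scalerDr scalerDr !scalerA [_ * c]mulrC -!scalerA addrACA.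
Qed.

Lemma zactY_antilinear c y y' z :
  zact (genY (c *: y + y')) z = Num.conj c *: zact (genY y) z + zact (genY y') z.
Proof.
rewrite !zactY pairingDl pairingZl; apply: z_ext.
- by rewrite zc_lin /zc /= mulr0 addr0.
- by rewrite za_lin /za /= scaler0 addr0.
- by rewrite zb_lin.
- by rewrite zx_lin /zx /= scaler0 addr0.
Qed.

End Actions.

(** * The standard form representation and its bounds *)

Section StandardForm.
Variables (R : realType) (A B : operatorStarAlgebra R) (X : operatorStarCorrespondence A B).
Local Notation C := (R[i]).
Local Notation Z := (zspace X).
Local Notation G := (zgen X).
Local Notation H := (completionHilbert (D X)).
Local Notation DS := (dsum (jindex X) (yspace X)).

Lemma genop_comb b (g g' k : G) (c : C) :
  (forall z, zact k z = c *: zact g z + zact g' z) ->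
  genop (on_copy b k) = c *: genop (on_copy b g) + genop (on_copy b g').
Proof.
move=> kE; apply: dense_op_ext => v.
transitivity (c *: genop (on_copy b g) (hiota v) + genop (on_copy b g') (hiota v)) => //.
rewrite !genopE -hiota_linear; congr hiota; apply: D_ext => j i.
have -> : (c *: gen (on_copy b g) v + gen (on_copy b g') v : DS) j i
  = c *: (gen (on_copy b g) v : DS) j i + (gen (on_copy b g') v : DS) j i by [].
rewrite !genE /on_copy; case: eqP => _; first exact: kE.
by rewrite !zact0 scaler0 addr0.
Qed.

Lemma repop_linear (W : lmodType C) (f h : W -> G) :
  (forall c x y z, zact (f (c *: x + y)) z = c *: zact (f x) z + zact (f y) z) ->
  (forall c x y z, zact (h (c *: x + y)) z = Num.conj c *: zact (h x) z + zact (h y) z) ->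
  linear (fun w => repop (f w) (h w)).
Proof.
move=> fl hl c x y; rewrite /repop (genop_comb true (fl c x y)) (genop_comb false (hl c x y)).
by rewrite adjointD adjointZ conjCK scalerDr addrACA.
Qed.

Lemma hiota_sum (V : preHilbert R) m (F : 'I_m -> V) : hiota (\sum_i F i) = \sum_i hiota (F i).
Proof. exact: (big_morph (@hiota R V) (fun u w => linear_mapD u w (@hiota_linear R V))
  (linear_map0 (@hiota_linear R V))). Qed.

Lemma genop_mxbounded b m (g : 'M[G]_m) (M : R) : 0 < M -> zbound g (8^-1 * M) ->
  mxbounded (\matrix_(i, j) genop (on_copy b (g i j))) M.
Proof.
move=> M0 gM; apply: mxbounded_dense => [|v]; first exact: ltW.
pose g' (b' : bool) : 'M[G]_m := if b' == b then g else 0.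
have g'M b' : zbound (g' b') (8^-1 * M).
  rewrite /g'; case: eqP => _ //.
  have z0 (T : operatorSpace R) (h : G -> T) : h 0 = 0 -> mxnorm (map_mx h (0 : 'M[G]_m))
    <= 8^-1 * M.
    move=> h0; have -> : map_mx h (0 : 'M[G]_m) = 0 by apply/matrixP => i j; rewrite !mxE.
    by rewrite mxnorm0 mulr_ge0 ?invr_ge0 ?ltW.
  split; try exact: z0.
  have -> : (map_mx (@gy _ _ _ X) (0 : 'M[G]_m))^T = 0 by apply/matrixP => i j; rewrite !mxE.
  by rewrite mxnorm0 mulr_ge0 ?invr_ge0 ?ltW.
have := gen_bound M0 g'M v; rewrite /phs hpow_q.
have E i : mxapp (\matrix_(i, j) genop (on_copy b (g i j))) (fun i : 'I_m => hiota (v i)) i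
    = hiota (\sum_l gen (fun b' => g' b' i l) (v l)).
  rewrite hiota_sum; apply: eq_bigr => l _; rewrite mxE genopE; congr (hiota (gen _ _)).
  by apply/funext => b'; rewrite /on_copy /g'; case: eqP; rewrite ?mxE.
under [X in Num.sqrt X <= _]eq_bigr do rewrite E rnorm_hiota sqr_phs.
move=> h; apply: le_trans (ler_wsqrtr h) _.
by rewrite sqrtrM ?sqr_ge0 // sqrtr_sqr gtr0_norm.
Qed.

Lemma repop_upper m (g h : 'M[G]_m) (K : R) : 0 <= K -> zbound g K -> zbound h^T K ->
  opnorm (\matrix_(i, j) repop (g i j) (h i j)) <= 16 * K.
Proof.
move=> K0 gK hK; apply/ler_addgt0Pr => e e0.
(* [gen_bound] requires a positive constant while K may be 0; each copy contributes one M. *)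
pose M := 8 * K + e / 2.
have M0 : 0 < M by rewrite /M; lra.
have KM : K <= 8^-1 * M by rewrite /M; lra.
have -> : 16 * K + e = M + M by rewrite /M; lra.
apply: opnorm_le; first by lra.
have -> : \matrix_(i, j) repop (g i j) (h i j) = \matrix_(i, j) genop (on_copy true (g i j))
   + \matrix_(i, j) adjoint (genop (on_copy false (h i j))).
  by apply/matrixP => i j; rewrite !mxE.
apply: mxboundedD; first by apply: genop_mxbounded => //; exact: zbound_le gK.
(* The matrix of entrywise adjoints is the adjoint of the transposed matrix; hence the hypothesis on
   the transpose of h. *)
apply: (mxbounded_adjoint (T := \matrix_(i, j) genop (on_copy false (h^T i j)))) => [|i j|].
- exact: ltW.
- by rewrite !mxE; exact: adjointP.
- by apply: genop_mxbounded => //; exact: zbound_le hK.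
Qed.

Lemma zact_unit (a : A) (b : B) (x y : X) :
  zact (gmk a b x y) (zmk 1 0 0 0) = zmk 0 a b x.
Proof.
apply: z_ext; rewrite ?zact_a ?zact_b ?zact_x /zc /za /zb /zx /=.
- by [].
- by rewrite scale1r amul0r addr0.
- by rewrite scale1r amul0r pairing0r !addr0.
- by rewrite lact0r ract0r addr0 add0r scale1r.
Qed.

Section Lower.
Variables (N : nat) (a0 : 'M[A]_N.+1) (b0 : 'M[B]_N.+1) (x0 : 'M[X]_N.+1).

Definition tindex : jindex X := (existT _ N (a0, b0, x0), true).
Definition yunit (k : 'I_N.+1) : yspace X :=
  fun i => if i == k :> nat then zmk 1 0 0 0 else 0.
Definition eunit (k : 'I_N.+1) : D X := dsingle tindex (yunit k).

Lemma jform_tindex (u v : yspace X) :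
  jform tindex u v = sval (target_form (existT _ N (a0, b0, x0) : target X)) (fun k => u k)
    (fun k => v k).
Proof. by []. Qed.

Lemma phq_tindex (u : D X) : (forall j, j != tindex -> (u : DS) j = 0) ->
  phq u = Re (jform tindex ((u : DS) tindex) ((u : DS) tindex)).
Proof.
move=> hu; rewrite (@dsum_q_sub _ _ _ _ (@jform_linear _ _ _ X) (@jform_conj _ _ _ X)
  (@jform_ge0 _ _ _ X) [fset tindex]%fset).
  by rewrite big_seq_fset1.
by move=> j; rewrite in_fset1; apply: contraR => /hu ->.
Qed.

Lemma eunit_norm : phs ((fun k => hiota (eunit k)) : hpow H N.+1) <= 1.
Proof.
rewrite -[leRHS]sqrtr1; apply: ler_wsqrtr; rewrite hpow_q.
have E k : rnorm (hiota (eunit k)) ^+ 2 = Re (jform tindex (yunit k) (yunit k)).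
  rewrite rnorm_hiota sqr_phs phq_tindex => [|j jt]; first by rewrite /= eqxx.
  by rewrite /= (negbTE jt).
under eq_bigr do rewrite E.
rewrite /jform /tindex /=; case: (target_form _) => p [_ _ _ _ [h _]] /=.
exact: h.
Qed.

Lemma ph_form_eq0 (u v : D X) :
  (forall j : jindex X, jform j ((u : DS) j) ((v : DS) j) = 0) -> ph_form u v = 0.
Proof. by move=> h; apply: big1 => j _; exact: h. Qed.

Lemma eunitE k j : (eunit k : DS) j = if j == tindex then yunit k else 0.
Proof. by []. Qed.

Lemma gen_tindex g v : (gen (on_copy false g) v : DS) tindex = 0.
Proof. by apply/funext => i; rewrite genE zact0. Qed.

Lemma form_eunit_gen g k v : ph_form (eunit k) (gen (on_copy false g) v) = 0.
Proof.
apply: ph_form_eq0 => j; rewrite eunitE; case: eqP => [->|_].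
  by rewrite gen_tindex jform0r.
exact: (p0l (@jform_linear _ _ _ X)).
Qed.

(** The unit vectors lie in the first copy and are orthogonal to the range of any operator living on
    the second. *)
Lemma adjoint_eunit g k : adjoint (genop (on_copy false g)) (hiota (eunit k)) = 0.
Proof.
apply: dense_ext => w; rewrite linear0l.
by rewrite (is_adjointC (adjointP _)) genopE hdot_ciota2 form_eunit_gen.
Qed.

(** The triple is itself one of the summation indices. In that fibre the units have total length at
    most 1 and are sent to [ztarget], whose length is at least each of the three norms by the choice
    of the form. *)
Lemma repop_lower (h : 'M[G]_N.+1) :
  let T := opnorm (\matrix_(i, j) repop (gmk (a0 i j) (b0 i j) (x0 i j) 0) (h i j)) in
  [/\ mxnorm a0 <= T, mxnorm b0 <= T & mxnorm x0 <= T].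
Proof.
move=> T.
have T0 : 0 <= T by exact: opnorm_ge0.
suff key : \sum_i Re (sval (target_form (existT _ N (a0, b0, x0) : target X))
      (ztarget a0 b0 x0 i) (ztarget a0 b0 x0 i)) <= T ^+ 2.
  move: key; case: (target_form _) => p [_ _ _ _ [_ [ha hb hx]]] /= key.
  by split; rewrite -ler_sqr ?nnegrE ?mxnorm_ge0 //; apply: le_trans key.
have := opnorm_ge1 (\matrix_(i, j) repop (gmk (a0 i j) (b0 i j) (x0 i j) 0) (h i j)) eunit_norm.
rewrite -/T -ler_sqr ?nnegrE ?phs_ge0 // sqr_phs hpow_q; apply: le_trans.
rewrite le_eqVlt; apply/orP; left; apply/eqP; apply: eq_bigr => i _.
pose u : D X := \sum_k gen (on_copy true (gmk (a0 i k) (b0 i k) (x0 i k) 0)) (eunit k).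
have -> : mxapp (\matrix_(i, j) repop (gmk (a0 i j) (b0 i j) (x0 i j) 0) (h i j))
   (fun k => hiota (eunit k)) i = hiota u.
  rewrite /u hiota_sum; apply: eq_bigr => k _; rewrite mxE.
  transitivity (genop (on_copy true (gmk (a0 i k) (b0 i k) (x0 i k) 0)) (hiota (eunit k))
     + adjoint (genop (on_copy false (h i k))) (hiota (eunit k))) => //.
  by rewrite adjoint_eunit addr0 genopE.
have uE j l : (u : DS) j l = \sum_k zact (on_copy true (gmk (a0 i k) (b0 i k) (x0 i k) 0) j.2)
    ((eunit k : DS) j l).
  rewrite (@big_morph _ _ (fun u : DS => u j l) 0 +%R 0 +%R) //.
  by apply: eq_bigr => k _; rewrite genE.
rewrite rnorm_hiota sqr_phs phq_tindex => [|j jt]; last first.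
  apply/funext => l; rewrite uE big1 // => k _.
  by rewrite /= (negbTE jt) (linear_map0 (zact_linear _)).
have uT : (fun l : 'I_N.+1 => (u : DS) tindex l) = ztarget a0 b0 x0 i.
  apply/funext => l; rewrite uE (bigD1 l) // big1 => [|k kl].
    by rewrite /= addr0 eqxx /yunit eqxx zact_unit.
  rewrite eunitE eqxx /yunit (_ : (l == k :> nat) = false);
    first exact: (linear_map0 (zact_linear _)).
  by apply/negbTE; rewrite eq_sym.
by rewrite jform_tindex uT.
Qed.

End Lower.

Lemma zbound_of m (g : 'M[G]_m) (K : R) (a : 'M[A]_m) (b : 'M[B]_m) (x y : 'M[X]_m) :
  (forall i j, g i j = gmk (a i j) (b i j) (x i j) (y i j)) ->
  mxnorm a <= K -> mxnorm b <= K -> mxnorm x <= K -> mxnorm y^T <= K -> zbound g K.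
Proof.
move=> gE aK bK xK yK; split.
- by rewrite (_ : map_mx _ _ = a) //; apply/matrixP => i j; rewrite !mxE gE.
- by rewrite (_ : map_mx _ _ = b) //; apply/matrixP => i j; rewrite !mxE gE.
- by rewrite (_ : map_mx _ _ = x) //; apply/matrixP => i j; rewrite !mxE gE.
- by rewrite (_ : map_mx _ _ = y) //; apply/matrixP => i j; rewrite !mxE gE.
Qed.

Definition repA (a : A) := repop (genA X a) (genA X (dagger a)).
Definition repB (b : B) := repop (genB X b) (genB X (dagger b)).
Definition repX (x : X) := repop (genX x) (genY x).

Lemma repA_linear : linear repA.
Proof.
apply: repop_linear => [c x y z|c x y z]; first exact: zactA_linear.
by rewrite daggerD daggerZ zactA_linear.
Qed.

Lemma repB_linear : linear repB.
Proof.
apply: repop_linear => [c x y z|c x y z]; first exact: zactB_linear.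
by rewrite daggerD daggerZ zactB_linear.
Qed.

Lemma repX_linear : linear repX.
Proof.
apply: repop_linear => [c x y z|c x y z]; first exact: zactX_linear.
exact: zactY_antilinear.
Qed.

Lemma repAM : {morph repA : a b / amul a b >-> a * b}.
Proof. by move=> a b; apply/esym/repopM => z; rewrite zactAA // daggerM. Qed.

Lemma repBM : {morph repB : a b / amul a b >-> a * b}.
Proof. by move=> a b; apply/esym/repopM => z; rewrite zactBB // daggerM. Qed.

Lemma repX_ract x b : repX (ract x b) = repX x * repB b.
Proof. by apply/esym/repopM => z; rewrite ?zactXB ?zactBY. Qed.

Lemma repX_lact a x : repX (lact X a x) = repA a * repX x.
Proof. by apply/esym/repopM => z; rewrite ?zactAX ?zactYA. Qed.

Lemma repA_dagger a : swap X * adjoint (repA a) * swap X = repA (dagger a).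
Proof. by rewrite repop_adjoint /repA daggerK. Qed.

Lemma repB_dagger b : swap X * adjoint (repB b) * swap X = repB (dagger b).
Proof. by rewrite repop_adjoint /repB daggerK. Qed.

(** Conjugation by the swap turns (genX x, genY x) into (genY x, genX x). Multiplied by (genX y,
    genY y) it gives <x, y> on the first copy and, in reversed order, <y, x> on the second, which is
    the dagger of <x, y>. *)
Lemma repX_pairing x y : swap X * adjoint (repX x) * swap X * repX y = repB (pairing x y).
Proof.
rewrite repop_adjoint; apply: repopM => z; first by rewrite zactYX.
by rewrite zactYX pairing_dagger.
Qed.

(** The shared argument for [A], [B] and [X]: in each case the first-copy generators come from a
    target in which x is one of the three matrices. *)
Lemma rep_cb_iso (W : operatorSpace R) (f h : W -> G) :
  linear (fun w => repop (f w) (h w)) ->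
  (forall n (x : 'M[W]_n), zbound (map_mx f x) (mxnorm x)) ->
  (forall n (x : 'M[W]_n), zbound (map_mx h x)^T (mxnorm x)) ->
  (forall n (x : 'M[W]_n.+1), exists (a : 'M[A]_n.+1) (b : 'M[B]_n.+1) (y : 'M[X]_n.+1),
     (forall i j, f (x i j) = gmk (a i j) (b i j) (y i j) 0) /\
     [\/ mxnorm x = mxnorm a, mxnorm x = mxnorm b | mxnorm x = mxnorm y]) ->
  cb_iso_onto_image (@mxnorm R W) (@opnorm R H) (fun w => repop (f w) (h w)).
Proof.
move=> fh_linear f_bound h_bound f_lower.
have repE n (x : 'M[W]_n) : map_mx (fun w => repop (f w) (h w)) x
    = \matrix_(i, j) repop (map_mx f x i j) (map_mx h x i j).
  by apply/matrixP => i j; rewrite !mxE.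
apply: (@cb_iso_of_bounds _ _ _ _ 16) => // n x; rewrite repE.
  by apply: repop_upper; rewrite ?mxnorm_ge0.
have [a [b [y [fE xE]]]] := f_lower n x.
have [ha hb hy] := repop_lower a b y (map_mx h x).
have -> : \matrix_(i, j) repop (map_mx f x i j) (map_mx h x i j)
  = \matrix_(i, j) repop (gmk (a i j) (b i j) (y i j) 0) (map_mx h x i j).
  by apply/matrixP => i j; rewrite [LHS]mxE [RHS]mxE [map_mx f x i j]mxE fE.
by case: xE => ->.
Qed.

Lemma repA_cb_iso : cb_iso_onto_image (@mxnorm R A) (@opnorm R H) repA.
Proof.
apply: rep_cb_iso; first exact: repA_linear.
- move=> n x; apply: (@zbound_of _ _ _ x 0 0 0); rewrite ?trmx0 ?mxnorm0 ?mxnorm_ge0 //.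
  by move=> i j; rewrite !mxE.
- move=> n x; apply: (@zbound_of _ _ _ (map_mx (@dagger R A) x^T) 0 0 0);
    rewrite ?trmx0 ?mxnorm_dagger ?mxnorm0 ?mxnorm_ge0 //.
  by move=> i j; rewrite !mxE.
move=> n x; exists x, 0, 0; split; last by constructor.
by move=> i j; rewrite !mxE.
Qed.

Lemma repB_cb_iso : cb_iso_onto_image (@mxnorm R B) (@opnorm R H) repB.
Proof.
apply: rep_cb_iso; first exact: repB_linear.
- move=> n x; apply: (@zbound_of _ _ _ 0 x 0 0); rewrite ?trmx0 ?mxnorm0 ?mxnorm_ge0 //.
  by move=> i j; rewrite !mxE.
- move=> n x; apply: (@zbound_of _ _ _ 0 (map_mx (@dagger R B) x^T) 0 0);
    rewrite ?trmx0 ?mxnorm_dagger ?mxnorm0 ?mxnorm_ge0 //.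
  by move=> i j; rewrite !mxE.
move=> n x; exists 0, x, 0; split; last by constructor.
by move=> i j; rewrite !mxE.
Qed.

Lemma repX_cb_iso : cb_iso_onto_image (@mxnorm R X) (@opnorm R H) repX.
Proof.
apply: rep_cb_iso; first exact: repX_linear.
- move=> n x; apply: (@zbound_of _ _ _ 0 0 x 0); rewrite ?trmx0 ?mxnorm0 ?mxnorm_ge0 //.
  by move=> i j; rewrite !mxE.
(* The transposition due to the adjoint and the one in the norm of the last component cancel, which
   leaves the norm of x. *)
- move=> n x; apply: (@zbound_of _ _ _ 0 0 0 x^T); rewrite ?trmxK ?mxnorm0 ?mxnorm_ge0 //.
  by move=> i j; rewrite !mxE.
move=> n x; exists 0, 0, x; split; last by constructor.
by move=> i j; rewrite !mxE.
Qed.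

End StandardForm.

Theorem theorem4p2 (R : realType) (A B : operatorStarAlgebra R)
    (X : operatorStarCorrespondence A B) :
  exists (H : hilbertSpace R) (U : bounded_op H) (piA : A -> bounded_op H)
         (piB : B -> bounded_op H) (piX : X -> bounded_op H),
    standard_form U piA piB piX.
Proof.
exists (completionHilbert (D X)), (@swap _ _ _ X), (@repA _ _ _ X), (@repB _ _ _ X),
  (@repX _ _ _ X).
split.
- exact: adjoint_swap.
- by rewrite /unitary adjoint_swap swap_sqr.
- by split; [exact: repA_linear|exact: repAM].
- by split; [exact: repB_linear|exact: repBM].
- exact: repA_cb_iso.
- exact: repB_cb_iso.
- exact: repX_cb_iso.
- exact: repX_ract.
- exact: repX_lact.
- exact: repA_dagger.
- exact: repB_dagger.
- exact: repX_pairing.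
Qed.
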